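(* Let $S$ be a complete hyperbolic Riemann surface of finite area and let $S_c$ be its conformal compactification, with $S$ regarded as a subset of $S_c$. Suppose that the cusps of $S$ are bigger than $2\pi$. Then $S_c$ admits a conformal Riemannian metric of negative curvature which coincides with the hyperbolic metric of $S$ outside horocyclic neighbourhoods $\mathcal{U}_1,\dots,\mathcal{U}_l$ of the cusps of $S$, each of area $>2\pi$.
   Context: A complete hyperbolic Riemann surface is a Riemann surface equipped with a complete Riemannian metric, compatible with its conformal structure, of constant curvature $-1$. If it has finite area, it has finitely many cusps. Let $\mathbb{D}^*=\{z\in\mathbb{C}:0<|z|<1\}$ carry its complete hyperbolic metric $ds^2_{\mathbb{D}^*}=\left(\frac{1}{r\log r}\right)^2|dz|^2$, $r=|z|$, and for $0<r<1$ put $\mathcal{B}_r=\{z\in\mathbb{D}^*:|z|<r\}$. A horocyclic neighbourhood of a cusp of $S$ is a neighbourhood of the cusp isometric to $\mathcal{B}_r$ for some $0<r<1$. The cusps of $S$ are said to be bigger than $c$ if there exist pairwise disjoint horocyclic neighbourhoods $\mathcal{U}_1,\dots,\mathcal{U}_l$ of the cusps (one for each cusp) such that $\mathrm{area}(\mathcal{U}_i)>c$ for all $i$. The conformal compactification $S_c$ of $S$ is the compact Riemann surface obtained from $S$ by choosing pairwise disjoint neighbourhoods of the cusps, each conformally equivalent to a punctured disk, and filling in the missing point of each punctured disk. A Riemannian metric on $S_c$ is conformal if it is compatible with the conformal structure of $S_c$. *)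

(* Defs.v *)
From HB Require Import structures.
From mathcomp Require Import all_boot all_order all_algebra.
From mathcomp Require Import all_classical all_reals all_analysis.
From mathcomp Require Import complex.

Set Implicit Arguments.
Unset Strict Implicit.
Unset Printing Implicit Defensive.

Import Order.TTheory GRing.Theory Num.Theory.
Import numFieldNormedType.Exports.

Local Open Scope classical_set_scope.
Local Open Scope ring_scope.

(* The complex plane is carried by R * R, which is at the same time a normed
   R-module and a measurable space; complex differentiability is the
   derivability of the library over the field R[i], through the evident
   identification of R * R with R[i]. *)
Notation plane R := (R * R)%type.

Section Plane.
Variable R : realType.
Implicit Types (D : set (plane R)) (z v : plane R).

Definition to_complex z : R[i] := Complex z.1 z.2.
Definition of_complex (w : R[i]) : plane R := (complex.Re w, complex.Im w).

Definition holomorphic_at (f : plane R -> plane R) z : Prop :=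
  derivable (to_complex \o f \o of_complex : R[i]^o -> R[i]^o)
            (to_complex z : R[i]^o) 1.

(* The modulus of z; the library norm of R * R is the sup norm. *)
Definition modulus z : R := Num.sqrt (z.1 ^+ 2 + z.2 ^+ 2).

(* C^oo on D (used with D open): every iterated directional derivative is
   differentiable at every point of D. *)
Definition smooth_on (W : normedModType R) D (f : plane R -> W) : Prop :=
  forall (vs : seq (plane R)) z, D z ->
    differentiable (foldr (fun v h => 'D_v h) f vs) z.

Definition laplacian (f : plane R -> R) : plane R -> R :=
  fun z => 'D_(1, 0) ('D_(1, 0) f) z + 'D_(0, 1) ('D_(0, 1) f) z.

(* A function lam > 0 is the density of the conformal metric lam^2 |dz|^2. *)

Definition gauss_curvature (lam : plane R -> R) z : R :=
  - laplacian (fun w => ln (lam w)) z / lam z ^+ 2.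

(* f^*(mu^2 |dw|^2) = lam^2 |dz|^2 at the point z. *)
Definition isometric_at (lam mu : plane R -> R) (f : plane R -> plane R) z :
    Prop :=
  differentiable f z /\
  forall v, mu (f z) * modulus ('d f z v) = lam z * modulus v.

Definition punctured_disk (r : R) : set (plane R) :=
  [set z | 0 < modulus z < r].

Definition punctured_disk_density z : R := `|modulus z * ln (modulus z)|^-1.

End Plane.

(* The values of cfun outside cdom and of cinv outside crng are irrelevant. *)
Record chart (R : realType) (X : topologicalType) := Chart {
  cdom : set X;
  crng : set (plane R);
  cfun : X -> plane R;
  cinv : plane R -> X;
  cdom_open : open cdom;
  crng_open : open crng;
  cfun_crng : forall x, cdom x -> crng (cfun x);
  cinv_cdom : forall z, crng z -> cdom (cinv z);
  cfunK : forall x, cdom x -> cinv (cfun x) = x;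
  cinvK : forall z, crng z -> cfun (cinv z) = z;
  cfun_continuous : forall x, cdom x -> {for x, continuous cfun};
  cinv_continuous : forall z, crng z -> {for z, continuous cinv}
}.

Definition holomorphic_transition (R : realType) (X : topologicalType)
    (c d : chart R X) : Prop :=
  forall z, crng c z -> cdom d (cinv c z) ->
    holomorphic_at (cfun d \o cinv c) z.

(* The complex structure is given by its maximal atlas. Second countability is
   automatic by Rado's theorem. *)
Record riemannSurface (R : realType) := RiemannSurface {
  rs_space :> topologicalType;
  atlas : set (chart R rs_space);
  rs_hausdorff : hausdorff_space rs_space;
  rs_connected : connected [set: rs_space];
  atlas_cover : forall x, exists2 c, atlas c & cdom c x;
  atlas_holomorphic : forall c d, atlas c -> atlas d ->
    holomorphic_transition c d;
  atlas_maximal : forall c,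
    (forall d, atlas d ->
       holomorphic_transition c d /\ holomorphic_transition d c) ->
    atlas c
}.
Arguments atlas {R} _.

Section Maps.
Variable R : realType.

Definition holomorphic_on (D : set (plane R)) (Y : riemannSurface R)
    (f : plane R -> Y) : Prop :=
  (forall z, D z -> {for z, continuous f}) /\
  forall d z, atlas Y d -> D z -> cdom d (f z) -> holomorphic_at (cfun d \o f) z.

Definition holomorphic (X Y : riemannSurface R) (f : X -> Y) : Prop :=
  continuous f /\
  forall c d z, atlas X c -> atlas Y d -> crng c z -> cdom d (f (cinv c z)) ->
    holomorphic_at (cfun d \o f \o cinv c) z.

End Maps.

(* A Riemannian metric compatible with the conformal structure: it reads
   (dens c)^2 |dz|^2 in each chart c of the atlas. *)
Record conformalMetric (R : realType) (X : riemannSurface R) :=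
  ConformalMetric {
  dens :> chart R X -> plane R -> R;
  dens_gt0 : forall c z, atlas X c -> crng c z -> 0 < dens c z;
  dens_smooth : forall c, atlas X c -> smooth_on (crng c) (dens c : _ -> R^o);
  dens_transition : forall c d z, atlas X c -> atlas X d ->
    crng c z -> cdom d (cinv c z) ->
    isometric_at (dens c) (dens d) (cfun d \o cinv c) z
}.

Section Metrics.
Variables (R : realType) (X : riemannSurface R).
Implicit Types (g : conformalMetric X) (x y : X) (L : R) (A : set X).

Definition hyperbolic g : Prop :=
  forall c z, atlas X c -> crng c z -> gauss_curvature (g c) z = -1.

Definition negatively_curved g : Prop :=
  forall c z, atlas X c -> crng c z -> gauss_curvature (g c) z < 0.

(* joined g x y L: there is a piecewise C^1 curve of g-length L from x to y,
   each C^1 piece of which lies in the domain of some chart. *)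
Inductive joined g x : X -> R -> Prop :=
| joined_refl : joined g x x 0
| joined_step y L (c : chart R X) (gam : R -> plane R) :
    joined g x y L -> atlas X c ->
    (forall t, derivable gam t 1) -> continuous (gam^`())%classic ->
    (forall t, 0 <= t <= 1 -> crng c (gam t)) ->
    cinv c (gam 0) = y ->
    joined g x (cinv c (gam 1))
      (L + \int[lebesgue_measure]_(t in `[0, 1])
             (g c (gam t) * modulus ((gam^`())%classic t))).

Definition riemannian_distance g x y : R := inf [set L | joined g x y L].

Definition complete_metric g : Prop :=
  forall u : nat -> X,
    (forall e : R, 0 < e -> exists N, forall m n, (N <= m)%N -> (N <= n)%N ->
       riemannian_distance g (u m) (u n) < e) ->
    exists x, riemannian_distance g (u n) x @[n --> \oo] --> (0 : R).

(* The outer measure generated by the area elements (g c)^2 dx dy of the charts;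
   on Borel sets (in particular on open sets) it is the Riemannian area. *)
Definition area g A : \bar R :=
  ereal_inf [set a | exists (c : nat -> chart R X) (K : nat -> set (plane R)),
    [/\ forall n, atlas X (c n),
        forall n, measurable (K n : set (measurableTypeR R * measurableTypeR R)),
        forall n, K n `<=` crng (c n),
        A `<=` \bigcup_n (cinv (c n) @` K n) &
        a = (\sum_(0 <= n <oo)
               \int[lebesgue_measure \x lebesgue_measure]_(z in K n)
                  ((g (c n) z) ^+ 2)%:E)%E]].

(* F is an isometry from the open set D of the plane with the metric
   lam^2 |dz|^2 onto the subset U of X. It may reverse orientation. *)
Definition is_isometry (D : set (plane R)) (lam : plane R -> R)
    g (U : set X) (F : plane R -> X) : Prop :=
  [/\ set_bij D U F,
      forall z, D z -> {for z, continuous F},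
      forall c, atlas X c -> smooth_on (D `&` F @^-1` cdom c) (cfun c \o F) &
      forall c z, atlas X c -> D z -> cdom c (F z) ->
        isometric_at lam (g c) (cfun c \o F) z].

End Metrics.

Section Cusps.
Variables (R : realType) (S Sc : riemannSurface R) (iota : S -> Sc).

(* A cusp of S is a point p of Sc outside S. A subset U of S is a neighbourhood
   of the cusp when it becomes one of p in Sc once p is added. *)
Definition cusp_nbhs (p : Sc) (U : set S) : Prop :=
  nbhs p (iota @` U `|` [set p]).

(* Sc is obtained from S by filling in the punctures cusp i of punctured disks,
   iota being the inclusion of S. *)
Definition conformal_compactification (l : nat) (cusp : 'I_l -> Sc) : Prop :=
  [/\ compact [set: Sc],
      holomorphic iota /\ injective iota,
      injective cusp /\ range cusp = ~` range iota &
      exists V : 'I_l -> set S, trivIset setT V /\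
        forall i, cusp_nbhs (cusp i) (V i) /\
          exists psi : plane R -> Sc,
            [/\ set_bij [set z | modulus z < 1]
                  (iota @` V i `|` [set cusp i]) psi,
                holomorphic_on [set z | modulus z < 1] psi &
                psi (0, 0) = cusp i]].

Definition horocyclic_nbhs (g : conformalMetric S) (p : Sc) (U : set S) :
    Prop :=
  cusp_nbhs p U /\
  exists (r : R) (F : plane R -> S), 0 < r < 1 /\
    is_isometry (punctured_disk r) (@punctured_disk_density R) g U F.

Definition horocyclic_nbhs_bigger (g : conformalMetric S)
    (l : nat) (cusp : 'I_l -> Sc) (a : R) (U : 'I_l -> set S) : Prop :=
  [/\ trivIset setT U,
      forall i, horocyclic_nbhs g (cusp i) (U i) &
      forall i, (a%:E < area g (U i))%E].

Definition cusps_bigger (g : conformalMetric S) (l : nat) (cusp : 'I_l -> Sc)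
    (a : R) : Prop :=
  exists U, horocyclic_nbhs_bigger g cusp a U.

Definition coincide_at (g : conformalMetric S) (h : conformalMetric Sc) (x : S) :
    Prop :=
  forall c d, atlas S c -> atlas Sc d -> cdom c x -> cdom d (iota x) ->
    isometric_at (g c) (h d) (cfun d \o iota \o cinv c) (cfun c x).

End Cusps.

(* Main.v *)
(* Near each cusp the metric is [expR (W0 (|z| ^+ 2)) |dz|] on a disk of radius [r]; the area
   of that neighbourhood is [2 pi / |ln r|], so area greater than [2 pi] means that [r > 1/e].
   A rotationally symmetric density [expR (W (|z| ^+ 2))] is negatively curved exactly when
   [x W'(x)] is increasing. For [W0] this quantity is positive for [|z| > 1/e], hence it can
   be replaced, inside [|z| < r], by an increasing function which vanishes at [0] like [eps x];
   the resulting [W] extends smoothly across the cusp and agrees with [W0] near [|z| = r].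
   The holomorphic function theory behind this (Goursat on rectangles, mean value property,
   Cauchy estimates, removable singularities, inverses of injective maps) serves to turn the
   isometry of a horocyclic neighbourhood into a chart of [Sc] centred at the cusp. *)

From HB Require Import structures.
From mathcomp Require Import all_boot all_order all_algebra.
From mathcomp Require Import all_classical all_reals all_analysis.
From mathcomp Require Import measurable_realfun complex ring lra.
Require Import Defs.

Set Implicit Arguments.
Unset Strict Implicit.
Unset Printing Implicit Defensive.

Import Order.TTheory GRing.Theory Num.Theory.
Import numFieldNormedType.Exports.

Local Open Scope classical_set_scope.
Local Open Scope ring_scope.

(** * Complex differentiability *)

(** The constant [2 pi] has a Gauss-Bonnet origin: a density smooth at the cusp has [x W'(x) = 0] at
    [0], so if this quantity increases it must be positive on the rim, and for the hyperbolic metric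
    [x W0'(x) = - 1/2 - 1 / ln x] changes sign exactly at [|z| = 1/e]. Two obstacles shape the rest.
    The isometry onto a horocyclic neighbourhood is a real smooth map that may reverse orientation;
    its Jacobian never vanishes, hence has constant sign on the connected punctured disk, and
    conjugation repairs a negative one. Moreover a horocyclic neighbourhood is tied to its cusp only
    topologically, so the parametrization has to be extended over the cusp, together with a
    holomorphic inverse, before the model metric can be transported. A metric on [Sc] must be given
    in every chart of a maximal atlas. It is therefore written as the pullback of a density under a
    transition map, and its curvature is computable in any chart because the logarithm of the
    modulus of a nonvanishing holomorphic derivative is harmonic. *)

Section ComplexCalculus.
Variable R : realType.
Local Notation C := (R[i]).
Local Notation nc := (@Normc.normc R).
Implicit Types (z w : C) (f g : C -> C) (P Q : C -> Prop).

Lemma nc0 : nc 0 = 0. Proof. exact: Normc.normc0. Qed.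
Lemma nc1 : nc 1 = 1. Proof. exact: Normc.normc1. Qed.
Lemma ncM z w : nc (z * w) = nc z * nc w. Proof. exact: Normc.normcM. Qed.
Lemma ncV z : nc z^-1 = (nc z)^-1. Proof. exact: Normc.normcV. Qed.
Lemma ncN z : nc (- z) = nc z. Proof. exact: normcN. Qed.
Lemma ncD z w : nc (z + w) <= nc z + nc w. Proof. exact: le_normcD. Qed.
Lemma ncB z w : nc (z - w) <= nc z + nc w.
Proof. by rewrite -(ncN w) ncD. Qed.
Lemma ncBC z w : nc (z - w) = nc (w - z).
Proof. by rewrite -ncN opprB. Qed.
Lemma nc_ge0 z : 0 <= nc z.
Proof. by case: z => a b; exact: sqrtr_ge0. Qed.
Lemma nc_eq0 z : (nc z == 0) = (z == 0).
Proof. by apply/eqP/eqP => [/Normc.eq0_normc//|->]; exact: nc0. Qed.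
Lemma nc_gt0 z : (0 < nc z) = (z != 0).
Proof. by rewrite lt_def nc_ge0 nc_eq0 andbT. Qed.
Lemma ncX z n : nc (z ^+ n) = nc z ^+ n.
Proof. by elim: n => [|n IH]; rewrite ?expr0 ?nc1// !exprS ncM IH. Qed.
Lemma nc_tri z w v : nc (z - v) <= nc (z - w) + nc (w - v).
Proof. by rewrite -[z - v](subrKA w) ncD. Qed.
Lemma nc_sub_ge z w : nc z - nc w <= nc (z - w).
Proof. by rewrite lerBlDr -{1}(subrK w z) ncD. Qed.
Lemma nc_real (x : R) : nc (Complex x 0) = `|x|.
Proof. by rewrite /= expr0n addr0 sqrtr_sqr. Qed.
Lemma sqr_nc z : nc z ^+ 2 = complex.Re z ^+ 2 + complex.Im z ^+ 2.
Proof. by case: z => a b /=; rewrite sqr_sqrtr// addr_ge0 ?sqr_ge0. Qed.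
Lemma Re_le_nc z : `|complex.Re z| <= nc z.
Proof.
rewrite -(@ler_pXn2r _ 2)// ?nnegrE ?nc_ge0// sqr_nc real_normK ?num_real//.
by rewrite lerDl sqr_ge0.
Qed.
Lemma Im_le_nc z : `|complex.Im z| <= nc z.
Proof.
rewrite -(@ler_pXn2r _ 2)// ?nnegrE ?nc_ge0// sqr_nc real_normK ?num_real//.
by rewrite lerDr sqr_ge0.
Qed.
Lemma nc_le_ReIm z : nc z <= `|complex.Re z| + `|complex.Im z|.
Proof.
rewrite -(@ler_pXn2r _ 2)// ?nnegrE ?nc_ge0// ?addr_ge0// sqr_nc sqrrD.
rewrite !real_normK ?num_real//.
by rewrite addrAC lerDl mulrn_wge0// mulr_ge0.
Qed.

(** Neighbourhoods are described by real radii, because the norm of [R[i]], and with it the radii of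
    its balls, takes values in [R[i]] itself. *)
Definition nhd z P := exists2 d : R, 0 < d & forall w, nc (w - z) < d -> P w.

Lemma nhdT z P : (forall w, P w) -> nhd z P.
Proof. by move=> h; exists 1. Qed.
Lemma nhdI z P Q : nhd z P -> nhd z Q -> nhd z (fun w => P w /\ Q w).
Proof.
move=> [d d0 hd] [e e0 he]; exists (Num.min d e); first by rewrite lt_min d0.
by move=> w; rewrite lt_min => /andP[? ?]; split; [apply: hd|apply: he].
Qed.
Lemma nhdS z P Q : (forall w, P w -> Q w) -> nhd z P -> nhd z Q.
Proof. by move=> h [d d0 hd]; exists d => // w /hd/h. Qed.
Lemma nhd2 z P Q T : nhd z P -> nhd z Q -> (forall w, P w -> Q w -> T w) ->
  nhd z T.
Proof. by move=> hP hQ h; apply: nhdS (nhdI hP hQ) => w [/h]; apply. Qed.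
Lemma nhd_self z P : nhd z P -> P z.
Proof. by move=> [d d0]; apply; rewrite subrr nc0. Qed.
Lemma nhd_ball z (d : R) : 0 < d -> nhd z (fun w => nc (w - z) < d).
Proof. by move=> d0; exists d. Qed.
Lemma nhd_disc a (r : R) z : nc (z - a) < r -> nhd z (fun w => nc (w - a) < r).
Proof.
move=> h; exists (r - nc (z - a)); first by rewrite subr_gt0.
by move=> w; rewrite ltrBrDr; apply: le_lt_trans; exact: nc_tri.
Qed.
Lemma nhd_neq a z : z != a -> nhd z (fun w => w != a).
Proof.
move=> za; exists (nc (z - a)); first by rewrite nc_gt0 subr_eq0.
move=> w; apply: contraTneq => ->.
by rewrite -leNgt ncBC.
Qed.

Definition ccont f z :=
  forall e : R, 0 < e -> nhd z (fun w => nc (f w - f z) < e).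

Lemma ccont_near f g z : nhd z (fun w => f w = g w) -> ccont f z -> ccont g z.
Proof.
move=> fg cf e e0; have fgz := nhd_self fg.
by apply: nhd2 (cf _ e0) fg _ => w h <-; rewrite -fgz.
Qed.
Lemma ccont_cst (c : C) z : ccont (fun=> c) z.
Proof. by move=> e e0; apply: nhdT => w; rewrite subrr nc0. Qed.
Lemma ccont_id z : ccont id z.
Proof. by move=> e e0; exact: nhd_ball. Qed.
Lemma ccontD f g z : ccont f z -> ccont g z -> ccont (fun w => f w + g w) z.
Proof.
move=> cf cg e e0; have e2 : 0 < e / 2 by rewrite divr_gt0.
apply: nhd2 (cf _ e2) (cg _ e2) _ => w hf hg.
rewrite opprD addrACA (le_lt_trans (ncD _ _))//; lra.
Qed.
Lemma ccontN f z : ccont f z -> ccont (fun w => - f w) z.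
Proof.
move=> cf e e0; apply: nhdS (cf _ e0) => w.
by rewrite -opprD ncN.
Qed.
Lemma ccontB f g z : ccont f z -> ccont g z -> ccont (fun w => f w - g w) z.
Proof. by move=> cf cg; apply: ccontD => //; exact: ccontN. Qed.
Lemma ccont_bound f z (M : R) : ccont f z -> nc (f z) < M ->
  nhd z (fun w => nc (f w) < M).
Proof.
move=> cf hM; have : 0 < M - nc (f z) by rewrite subr_gt0.
move=> /cf; apply: nhdS => w; rewrite ltrBrDr; apply: le_lt_trans.
by rewrite -{1}(subrK (f z) (f w)) ncD.
Qed.
Lemma ccontM f g z : ccont f z -> ccont g z -> ccont (fun w => f w * g w) z.
Proof.
move=> cf cg e e0.
set A := nc (f z) + 1; set B := nc (g z) + 1.
have A0 : 0 < A by rewrite ltr_wpDl ?nc_ge0.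
have B0 : 0 < B by rewrite ltr_wpDl ?nc_ge0.
have hA : nhd z (fun w => nc (f w) < A).
  by apply: ccont_bound => //; rewrite ltrDl.
have eA : 0 < e / 2 / A by rewrite !divr_gt0.
have eB : 0 < e / 2 / B by rewrite !divr_gt0.
apply: nhd2 (nhdI hA (cf _ eB)) (cg _ eA) _ => w [hfA hf] hg.
have -> : f w * g w - f z * g z = f w * (g w - g z) + (f w - f z) * g z by ring.
apply: (le_lt_trans (ncD _ _)); rewrite !ncM.
have h1 : nc (f w) * nc (g w - g z) <= A * (e / 2 / A).
  by rewrite ler_pM ?nc_ge0// ltW.
have h2 : nc (f w - f z) * nc (g z) < e / 2 / B * B.
  apply: (@le_lt_trans _ _ (e / 2 / B * nc (g z))).
    by rewrite ler_wpM2r ?nc_ge0// ltW.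
  by rewrite ltr_pM2l// ltrDl.
rewrite [A * _]mulrC divfK ?gt_eqF// in h1; rewrite divfK ?gt_eqF// in h2; lra.
Qed.
Lemma ccontV f z : ccont f z -> f z != 0 -> ccont (fun w => (f w)^-1) z.
Proof.
move=> cf fz e e0.
have m0 : 0 < nc (f z) by rewrite nc_gt0.
set m := nc (f z) in m0.
have h1 : 0 < m / 2 by rewrite divr_gt0.
have h2 : 0 < e * (m / 2 * m) by rewrite !mulr_gt0// invr_gt0.
apply: nhd2 (cf _ h1) (cf _ h2) _ => w hw hw'.
have fw : m / 2 < nc (f w).
  have := nc_sub_ge (f z) (f z - f w); rewrite subKr ncBC -/m; lra.
have fw0 : f w != 0 by rewrite -nc_gt0; lra.
have -> : (f w)^-1 - (f z)^-1 = (f z - f w) / (f w * f z).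
  by field; rewrite fw0 fz.
rewrite ncM ncV ncM ncBC ltr_pdivrMr; last by rewrite mulr_gt0// nc_gt0.
apply: (lt_le_trans hw'); rewrite ler_pM2l// ler_pM2r// ltW//.
Qed.
Lemma ccont_comp f g z : ccont g z -> ccont f (g z) -> ccont (fun w => f (g w)) z.
Proof. by move=> cg cf e /cf [d d0 h]; apply: nhdS (cg _ d0) => w /h. Qed.
Lemma ccont_nhd f z P : ccont f z -> nhd (f z) P -> nhd z (fun w => P (f w)).
Proof. by move=> cf [d d0 h]; apply: nhdS (cf _ d0) => w /h. Qed.

(* Caratheodory's form of complex differentiability: the difference quotient
   extends continuously to the point. *)
Definition cder f z (c : C) := exists phi : C -> C,
  [/\ phi z = c, ccont phi z & forall w, f w = f z + phi w * (w - z)].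

Definition cdiff f z := exists c, cder f z c.

Lemma cder_near f g z c : nhd z (fun w => f w = g w) -> cder f z c -> cder g z c.
Proof.
move=> fg [phi [pz cp h]].
exists (fun w => if w == z then c else (g w - g z) / (w - z)); split.
- by rewrite eqxx.
- have fgz := nhd_self fg.
  apply: ccont_near cp; apply: nhdS fg => w fgw; case: eqVneq => [->//|wz].
  by rewrite -fgw -fgz h addrC addKr mulfK// subr_eq0.
- move=> w; case: eqVneq => [->|wz]; first by rewrite subrr mulr0 addr0.
  by rewrite divfK ?subr_eq0// addrC subrK.
Qed.
Lemma cdiff_near f g z : nhd z (fun w => f w = g w) -> cdiff f z -> cdiff g z.
Proof. by move=> fg [c /(cder_near fg) h]; exists c. Qed.
Lemma cder_cont f z c : cder f z c -> ccont f z.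
Proof.
move=> [phi [_ cp h]].
apply: (@ccont_near (fun w => f z + phi w * (w - z))).
  by apply: nhdT => w; rewrite -h.
apply: ccontD; first exact: ccont_cst.
by apply: ccontM => //; apply: ccontB; [exact: ccont_id|exact: ccont_cst].
Qed.
Lemma cdiff_cont f z : cdiff f z -> ccont f z.
Proof. by move=> [c /cder_cont]. Qed.
(** The weak inequality also holds at [w = z], so that no point has to be excluded in estimates. *)
Lemma cder_eps f z c : cder f z c <-> (forall e : R, 0 < e ->
  nhd z (fun w => nc (f w - f z - c * (w - z)) <= e * nc (w - z))).
Proof.
split.
  move=> [phi [pz cp h]] e e0; apply: nhdS (cp _ e0) => w hw.
  rewrite h (addrC (f z)) addrK -mulrBl ncM -pz.
  by rewrite ler_wpM2r ?nc_ge0// ltW.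
move=> h.
exists (fun w => if w == z then c else (f w - f z) / (w - z)); split.
- by rewrite eqxx.
- move=> e e0; have e2 : 0 < e / 2 by rewrite divr_gt0.
  apply: nhdS (h _ e2) => w; rewrite eqxx; case: eqVneq => [-> _|wz hw].
    by rewrite subrr nc0.
  have wz0 : 0 < nc (w - z) by rewrite nc_gt0 subr_eq0.
  have -> : (f w - f z) / (w - z) - c = (f w - f z - c * (w - z)) / (w - z).
    by field; rewrite subr_eq0.
  rewrite ncM ncV ltr_pdivrMr//; apply: (le_lt_trans hw); rewrite ltr_pM2r//; lra.
- move=> w; case: eqVneq => [->|wz]; first by rewrite subrr mulr0 addr0.
  by rewrite divfK ?subr_eq0// addrC subrK.
Qed.
Lemma cder_cst (a : C) z : cder (fun=> a) z 0.
Proof. by exists (fun=> 0); split=> [||w]; rewrite ?mul0r ?addr0//; exact: ccont_cst. Qed.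
Lemma cder_id z : cder id z 1.
Proof.
exists (fun=> 1); split=> [||w]//; first exact: ccont_cst.
by rewrite mul1r addrC subrK.
Qed.
Lemma cderD f g z a b : cder f z a -> cder g z b ->
  cder (fun w => f w + g w) z (a + b).
Proof.
move=> [p [<- cp hp]] [q [<- cq hq]].
exists (fun w => p w + q w); split=> [||w]//; first exact: ccontD.
by rewrite hp hq; ring.
Qed.
Lemma cderM f g z a b : cder f z a -> cder g z b ->
  cder (fun w => f w * g w) z (a * g z + f z * b).
Proof.
move=> df dg; have cg := cder_cont dg.
case: df dg => [p [<- cp hp]] [q [<- cq hq]].
exists (fun w => p w * g w + f z * q w); split=> [||w]//.
  by apply: ccontD; apply: ccontM => //; exact: ccont_cst.
by rewrite hp mulrDl [in f z * g w]hq; ring.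
Qed.
Lemma cderZ (k : C) f z a : cder f z a -> cder (fun w => k * f w) z (k * a).
Proof. by move=> /(cderM (cder_cst k z)); rewrite mul0r add0r. Qed.
Lemma cderN f z a : cder f z a -> cder (fun w => - f w) z (- a).
Proof.
move=> /(cderZ (-1)); rewrite mulN1r; apply: cder_near.
by apply: nhdT => w; rewrite mulN1r.
Qed.
Lemma cderB f g z a b : cder f z a -> cder g z b ->
  cder (fun w => f w - g w) z (a - b).
Proof. by move=> df /cderN; exact: cderD. Qed.
Lemma cder_comp f g z a b : cder g z b -> cder f (g z) a ->
  cder (fun w => f (g w)) z (a * b).
Proof.
move=> dg; have cg := cder_cont dg.
case: dg => [q [<- cq hq]] [p [<- cp hp]].
exists (fun w => p (g w) * q w); split=> [||w]//.
  by apply: ccontM => //; exact: ccont_comp.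
by rewrite hp [in X in _ * X]hq; ring.
Qed.
Lemma cderV f z a : cder f z a -> f z != 0 ->
  cder (fun w => (f w)^-1) z (- a / f z ^+ 2).
Proof.
move=> df fz; have cf := cder_cont df.
case: df => [p [<- cp hp]].
have [d d0 hd] : nhd z (fun w => f w != 0).
  by apply: ccont_nhd cf (nhd_neq fz).
apply: (@cder_near (fun w => (f z)^-1 + - p w / (f w * f z) * (w - z))).
  exists d => // w /hd fw.
  have e : p w * (w - z) = f w - f z by rewrite (hp w) (addrC (f z)) addrK.
  have -> : - p w / (f w * f z) * (w - z) = - (p w * (w - z)) / (f w * f z).
    by ring.
  by rewrite e; field; rewrite fw fz.
exists (fun w => - p w / (f w * f z)); split=> [//||w].
- apply: ccontM; first exact: ccontN.
  apply: ccontV; last by rewrite mulf_neq0.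
  by apply: ccontM => //; exact: ccont_cst.
- by rewrite subrr mulr0 addr0.
Qed.
Lemma cder_uniq f z a b : cder f z a -> cder f z b -> a = b.
Proof.
move=> /cder_eps ha /cder_eps hb; apply/eqP; rewrite -subr_eq0 -nc_eq0.
rewrite eq_le nc_ge0 andbT; apply/ler_addgt0Pl => e e0; rewrite addr0.
have e2 : 0 < e / 2 by rewrite divr_gt0.
have [d d0 h] := nhdI (ha _ e2) (hb _ e2).
pose w : C := z + Complex (d / 2) 0.
have wz : w - z = Complex (d / 2) 0 by rewrite /w addrC addKr.
have nw : nc (w - z) = d / 2 by rewrite wz nc_real gtr0_norm// divr_gt0.
have [] := h w; first by rewrite nw; lra.
set u := _ - a * _; set v := _ - b * _ => hu hv.
have -> : a - b = (v - u) / (w - z).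
  by rewrite /u /v; field; rewrite -nc_gt0 nw divr_gt0.
have nw0 : 0 < nc (w - z) by rewrite nw divr_gt0.
rewrite ncM ncV ler_pdivrMr//; apply: (le_trans (ncB _ _)).
by rewrite [leRHS]mulrC [e]splitr mulrDr !(mulrC (nc (w - z))) lerD.
Qed.

Lemma cdiff_cst (a : C) z : cdiff (fun=> a) z. Proof. exists 0; exact: cder_cst. Qed.
Lemma cdiff_id z : cdiff id z. Proof. exists 1; exact: cder_id. Qed.
Lemma cdiffD f g z : cdiff f z -> cdiff g z -> cdiff (fun w => f w + g w) z.
Proof. by move=> [a ha] [b hb]; exists (a + b); exact: cderD. Qed.
Lemma cdiffB f g z : cdiff f z -> cdiff g z -> cdiff (fun w => f w - g w) z.
Proof. by move=> [a ha] [b hb]; exists (a - b); exact: cderB. Qed.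
Lemma cdiffM f g z : cdiff f z -> cdiff g z -> cdiff (fun w => f w * g w) z.
Proof. by move=> [a ha] [b hb]; eexists; exact: cderM ha hb. Qed.
Lemma cdiffV f z : cdiff f z -> f z != 0 -> cdiff (fun w => (f w)^-1) z.
Proof. by move=> [a ha] fz; eexists; exact: cderV ha fz. Qed.
Lemma cdiff_comp f g z : cdiff g z -> cdiff f (g z) -> cdiff (fun w => f (g w)) z.
Proof. by move=> [a ha] [b hb]; eexists; exact: cder_comp ha hb. Qed.

Definition cd f z : C := xget 0 [set c | cder f z c].

Lemma cdP f z : cdiff f z -> cder f z (cd f z).
Proof. by move=> [c hc]; exact: (xgetPex 0 (ex_intro _ c hc)). Qed.
Lemma cdE f z c : cder f z c -> cd f z = c.
Proof. by move=> h; apply: cder_uniq (h); apply: cdP; exists c. Qed.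

End ComplexCalculus.

(** * Integrals of complex valued functions over intervals *)

Section PathIntegral.
Variable R : realType.
Local Notation C := (R[i]).
Local Notation nc := (@Normc.normc R).
Implicit Types (p q : R -> C) (f g : C -> C) (a b t : R).

Lemma rcontP (h : R -> R) t : {for t, continuous h} <->
  (forall e : R, 0 < e -> exists2 d : R, 0 < d &
     forall s, `|s - t| < d -> `|h s - h t| < e).
Proof.
split.
  move=> /cvgrPdist_lt ch e /ch /nbhs_ballP[d /= d0 hd]; exists d => // s st.
  by rewrite distrC; apply: hd; rewrite /ball/= distrC.
move=> ch; apply/cvgrPdist_lt => e /ch [d d0 hd]; apply/nbhs_ballP; exists d => //.
by move=> s; rewrite /ball/= distrC => /hd; rewrite distrC.
Qed.

Definition pcont p t := forall e : R, 0 < e -> exists2 d : R, 0 < d &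
  forall s, `|s - t| < d -> nc (p s - p t) < e.

Lemma pcontP p t : pcont p t <->
  {for t, continuous (fun s => complex.Re (p s))} /\
  {for t, continuous (fun s => complex.Im (p s))}.
Proof.
split=> [cp|[/rcontP cR /rcontP cI] e e0].
  split; apply/rcontP => e /cp [d d0 h]; exists d => // s /h; apply: le_lt_trans.
    by rewrite -raddfB Re_le_nc.
  by rewrite -raddfB Im_le_nc.
have e2 : 0 < e / 2 by rewrite divr_gt0.
have [d d0 h] := cR _ e2; have [d' d'0 h'] := cI _ e2.
exists (Num.min d d'); first by rewrite lt_min d0.
move=> s; rewrite lt_min => /andP[/h hs /h' hs'].
apply: (le_lt_trans (nc_le_ReIm _)); rewrite !raddfB /=; lra.
Qed.

Lemma pcont_comp f p t : pcont p t -> ccont f (p t) -> pcont (fun s => f (p s)) t.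
Proof.
move=> cp cf e /cf [d d0 h]; have [d' d'0 h'] := cp _ d0.
by exists d' => // s /h' /h.
Qed.
Lemma pcontM p q t : pcont p t -> pcont q t -> pcont (fun s => p s * q s) t.
Proof.
move=> /pcontP[pR pI] /pcontP[qR qI]; apply/pcontP.
have hR z w : complex.Re (z * w : C) =
  complex.Re z * complex.Re w - complex.Im z * complex.Im w by case: z; case: w.
have hI z w : complex.Im (z * w : C) =
  complex.Re z * complex.Im w + complex.Im z * complex.Re w by case: z; case: w.
have eR : (fun s => complex.Re (p s * q s)) = (fun s => complex.Re (p s) *
  complex.Re (q s) - complex.Im (p s) * complex.Im (q s)).
  by apply/funext => s.
have eI : (fun s => complex.Im (p s * q s)) = (fun s => complex.Re (p s) *
  complex.Im (q s) + complex.Im (p s) * complex.Re (q s)).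
  by apply/funext => s.
split.
- by rewrite eR; apply: cvgB; exact: cvgM.
- by rewrite eI; apply: cvgD; exact: cvgM.
Qed.
Lemma pcont_cst (c : C) t : pcont (fun=> c) t.
Proof. by move=> e e0; exists 1 => // s _; rewrite subrr nc0. Qed.
Lemma pcontD p q t : pcont p t -> pcont q t -> pcont (fun s => p s + q s) t.
Proof.
move=> cp cq e e0; have e2 : 0 < e / 2 by rewrite divr_gt0.
have [d d0 h] := cp _ e2; have [d' d'0 h'] := cq _ e2.
exists (Num.min d d'); first by rewrite lt_min d0.
move=> s; rewrite lt_min => /andP[/h hs /h' hs'].
rewrite opprD addrACA (le_lt_trans (ncD _ _))//; lra.
Qed.
Lemma pcontB p q t : pcont p t -> pcont q t -> pcont (fun s => p s - q s) t.
Proof.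
move=> cp cq; apply: pcontD => //; apply: (@pcont_comp (fun z => - z)) => //.
exact: ccontN (@ccont_id _ _).
Qed.

Definition pder p t (c : C) := exists phi : R -> C,
  [/\ phi t = c, pcont phi t & forall s, p s = p t + phi s * Complex (s - t) 0].

Lemma pderP p t c : pder p t c <->
  is_derive t 1 (fun s => complex.Re (p s)) (complex.Re c) /\
  is_derive t 1 (fun s => complex.Im (p s)) (complex.Im c).
Proof.
split.
  move=> [phi [<- /pcontP[cR cI] h]]; split; apply/is_derive1_caratheodory.
    exists (fun s => complex.Re (phi s)); split => // s; rewrite h.
    by case: (phi s) => u v; case: (p t) => u' v' /=; ring.
  exists (fun s => complex.Im (phi s)); split => // s; rewrite h.
  by case: (phi s) => u v; case: (p t) => u' v' /=; ring.
case: c => u v [/is_derive1_caratheodory[g [hg cg gt]]].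
move=> /is_derive1_caratheodory[k [hk ck kt]].
exists (fun s => Complex (g s) (k s)); split.
- by rewrite gt kt.
- exact/pcontP.
- move=> s; have := hg s; have := hk s.
  case: (p s) => x y; case: (p t) => x' y' /= h1 h2.
  by congr Complex; [rewrite -[x](subrK x') h2|rewrite -[y](subrK y') h1]; ring.
Qed.

Lemma pder_cont p t c : pder p t c -> pcont p t.
Proof.
move=> /pderP[[d1 _] [d2 _]]; apply/pcontP.
by split; apply/differentiable_continuous/derivable1_diffP.
Qed.
Lemma pder_comp f p t (a c : C) : pder p t c -> cder f (p t) a ->
  pder (fun s => f (p s)) t (a * c).
Proof.
move=> dp; have cp := pder_cont dp.
case: dp => [phi [<- cphi hp]] [psi [<- cpsi hf]].
exists (fun s => psi (p s) * phi s); split=> [//||s].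
  by apply: pcontM => //; exact: pcont_comp.
by rewrite hf [in X in _ * X]hp; ring.
Qed.
Lemma pderD p q t c d : pder p t c -> pder q t d ->
  pder (fun s => p s + q s) t (c + d).
Proof.
move=> [phi [<- cphi hp]] [psi [<- cpsi hq]].
exists (fun s => phi s + psi s); split=> [||s].
- by [].
- exact: pcontD.
- by rewrite hp hq; ring.
Qed.
Lemma pder_line (z v : C) t : pder (fun s => z + v * Complex s 0) t v.
Proof.
exists (fun=> v); split=> [//||s]; first exact: pcont_cst.
rewrite -addrA -mulrDr; congr (_ + v * _).
by apply/eqP; rewrite eq_complex /= addr0 eqxx andbT; apply/eqP; ring.
Qed.
Lemma pderZ (k : C) p t c : pder p t c -> pder (fun s => k * p s) t (k * c).
Proof.
move=> dp; apply: pder_comp dp _.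
by have := cderZ k (@cder_id _ (p t)); rewrite mulr1.
Qed.

(** Complex values admit no mean value equality. The real function [u] is the inner product of [p]
    with [D = p b - p a]: it increases by [|D| ^+ 2], while its derivative is at most [|D|] times
    the modulus of [p']. *)
Lemma path_mvt p p' a b (K : R) : a <= b ->
  (forall t, a <= t <= b -> pder p t (p' t)) ->
  (forall t, a <= t <= b -> nc (p' t) <= K) ->
  nc (p b - p a) <= K * (b - a).
Proof.
move=> ab dp hK.
have [->|D0] := eqVneq (p b - p a) 0.
  rewrite nc0 mulr_ge0 ?subr_ge0//; apply: le_trans (hK a _); last by rewrite lexx.
  exact: nc_ge0.
set D := p b - p a in D0 *.
pose u t := complex.Re D * complex.Re (p t) + complex.Im D * complex.Im (p t).
pose u' t := complex.Re D * complex.Re (p' t) + complex.Im D * complex.Im (p' t).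
have du t : a <= t <= b -> is_derive t 1 u (u' t).
  move=> /dp/pderP[h1 h2].
  have h3 := @is_deriveZ _ _ _ (fun s => complex.Re (p s)) (complex.Re D) t 1 _ h1.
  have h4 := @is_deriveZ _ _ _ (fun s => complex.Im (p s)) (complex.Im D) t 1 _ h2.
  exact: is_deriveD h3 h4.
have [] := @MVT_segment R u u' a b ab.
- by move=> x; rewrite in_itv/= => /andP[? ?]; apply: du; rewrite !ltW.
- apply: derivable_within_continuous => x; rewrite in_itv/= => /du.
  by case.
move=> c; rewrite in_itv/= => cab hu.
have e1 : u b - u a = nc D ^+ 2.
  rewrite sqr_nc /u; have -> : D = p b - p a by [].
  by case: (p b) => ? ?; case: (p a) => ? ? /=; ring.
have e2 : u' c <= nc D * nc (p' c).
  have -> : u' c = complex.Re (Complex (complex.Re D) (- complex.Im D) * p' c).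
    by rewrite /u'; case: (p' c) => ? ? /=; ring.
  apply: le_trans (ler_norm _) (le_trans (Re_le_nc _) _).
  by rewrite ncM /= sqrrN; case: (D).
have D1 : 0 < nc D by rewrite nc_gt0.
rewrite -(ler_pM2l D1) -expr2 -e1 hu mulrA ler_wpM2r ?subr_ge0//.
by apply: (le_trans e2); rewrite ler_pM2l// hK.
Qed.

Lemma primitive_exists p a b : a <= b ->
  (forall t, a <= t <= b -> pcont p t) ->
  exists P, forall t, a <= t <= b -> pder P t (p t).
Proof.
move=> ab cp.
have prim (h : R -> R) : (forall t, a <= t <= b -> {for t, continuous h}) ->
    exists H : R -> R, forall t, a <= t <= b -> is_derive t 1 H (h t).
  move=> ch.
  (* Composition with the clamp onto [[a, b]] makes [h] continuous on the whole line, which yields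
     two-sided derivatives at both ends. *)
  pose cl : R -> R := (fun=> a) \max ((fun=> b) \min id).
  have cl_in t : a <= cl t <= b.
    by rewrite /cl /= le_max lexx/= ge_max ab/= ge_min lexx.
  have cl_id t : a <= t <= b -> cl t = t.
    move=> /andP[h1 h2]; rewrite /cl /= (min_idPr _)//; exact/max_idPr.
  have ccl : continuous cl.
    move=> t; apply: continuous_max; first exact: cst_continuous.
    by apply: continuous_min; [exact: cst_continuous|move=> ?].
  have chc : continuous (h \o cl).
    by move=> t; apply: continuous_comp; [exact: ccl|exact: ch].
  (* The lower limit [a - 1] keeps [t = a] inside the range of the fundamental theorem. *)
  exists (fun x => \int[lebesgue_measure]_(t in [set` Interval (BLeft (a - 1)) (BRight x)]) (h \o cl) t).
  move=> t tab; rewrite -[h t]/(h t) -{2}(cl_id t tab).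
  have [||||d1 d2] := @continuous_FTC1 R (h \o cl) (BLeft (a - 1)) t (t + 1).
  - by rewrite ltrDl.
  - apply: continuous_compact_integrable; first exact: segment_compact.
    exact: continuous_subspaceT.
  - by move: tab => /andP[ta _]; rewrite /= lte_fin; lra.
  - exact: chc.
  by rewrite -[h (cl t)]/((h \o cl) t) -d2 derive1E; exact: derivableP.
have [H1 h1] := prim (fun s => complex.Re (p s)) (fun t tab => proj1 (iffLR (pcontP p t) (cp t tab))).
have [H2 h2] := prim (fun s => complex.Im (p s)) (fun t tab => proj2 (iffLR (pcontP p t) (cp t tab))).
exists (fun t => Complex (H1 t) (H2 t)) => t tab; apply/pderP; split => /=.
- exact: h1.
- exact: h2.
Qed.

Lemma primitive_unique p P Q a b : a <= b ->
  (forall t, a <= t <= b -> pder P t (p t)) ->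
  (forall t, a <= t <= b -> pder Q t (p t)) -> P b - P a = Q b - Q a.
Proof.
move=> ab hP hQ; apply/eqP; rewrite -subr_eq0 -nc_eq0 eq_le nc_ge0 andbT.
have := @path_mvt (fun t => P t + -1 * Q t) (fun=> 0) a b 0 ab.
rewrite mul0r; have -> : P b - P a - (Q b - Q a) = P b + -1 * Q b - (P a + -1 * Q a).
  by ring.
apply => [t tab|t tab]; last by rewrite nc0.
have -> : 0 = p t + -1 * p t by ring.
by apply: pderD; [exact: hP|apply: pderZ; exact: hQ].
Qed.

(** The increment of any primitive: [primitive_unique] makes it independent of the choice, and by
    [primitive_exists] the default [0] does not occur for continuous [p] and [a <= b]. *)
Definition cint p a b : C := xget 0 [set v | exists P,
  (forall t, a <= t <= b -> pder P t (p t)) /\ v = P b - P a].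

Lemma cintE p P a b : a <= b -> (forall t, a <= t <= b -> pder P t (p t)) ->
  cint p a b = P b - P a.
Proof.
move=> ab hP; rewrite /cint; case: xgetP => [v _ [Q [hQ ->]]|/(_ (P b - P a))[]].
  exact: primitive_unique hQ hP.
by exists P.
Qed.

Lemma cint_split p a m b : a <= m -> m <= b ->
  (forall t, a <= t <= b -> pcont p t) ->
  cint p a b = cint p a m + cint p m b.
Proof.
move=> am mb /(primitive_exists (le_trans am mb))[P hP].
rewrite (cintE (le_trans am mb) hP) (@cintE p P a m)// ?(@cintE p P m b)//.
- by ring.
- by move=> t /andP[h1 h2]; apply: hP; rewrite h2 (le_trans am h1).
- by move=> t /andP[h1 h2]; apply: hP; rewrite h1 (le_trans h2 mb).
Qed.

Lemma cint_bound p a b (K : R) : a <= b -> (forall t, a <= t <= b -> pcont p t) ->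
  (forall t, a <= t <= b -> nc (p t) <= K) -> nc (cint p a b) <= K * (b - a).
Proof.
move=> ab cp hK; have [P hP] := primitive_exists ab cp.
by rewrite (cintE ab hP); exact: path_mvt hP hK.
Qed.

Lemma cint_cst (k : C) a b : a <= b -> cint (fun=> k) a b = k * Complex (b - a) 0.
Proof.
move=> ab; rewrite (@cintE _ (fun s => 0 + k * Complex s 0))//.
  by rewrite !add0r -mulrBr; congr (_ * _); apply/eqP; rewrite eq_complex /= subr0 !eqxx.
by move=> t _; exact: pder_line.
Qed.

Lemma cintB p q a b : a <= b -> (forall t, a <= t <= b -> pcont p t) ->
  (forall t, a <= t <= b -> pcont q t) ->
  cint (fun t => p t - q t) a b = cint p a b - cint q a b.
Proof.
move=> ab /(primitive_exists ab)[P hP] /(primitive_exists ab)[Q hQ].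
rewrite (cintE ab hP) (cintE ab hQ) (@cintE _ (fun t => P t + -1 * Q t))//.
  by ring.
move=> t tab; have -> : p t - q t = p t + -1 * q t by ring.
by apply: pderD; [exact: hP|apply: pderZ; exact: hQ].
Qed.

Lemma cintZ (k : C) p a b : a <= b -> (forall t, a <= t <= b -> pcont p t) ->
  cint (fun t => k * p t) a b = k * cint p a b.
Proof.
move=> ab /(primitive_exists ab)[P hP].
rewrite (cintE ab hP) (@cintE _ (fun t => k * P t)) ?mulrBr//.
by move=> t tab; apply: pderZ; exact: hP.
Qed.

End PathIntegral.

(** * Cauchy's theorem on rectangles *)

Section Goursat.
Variable R : realType.
Local Notation C := (R[i]).
Local Notation nc := (@Normc.normc R).
Local Notation I := (Complex 0 1 : R[i]).
Implicit Types (f g F : C -> C) (x y a b w h : R).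

Lemma pder_hline x y : pder (fun s => Complex s y : C) x 1.
Proof.
exists (fun=> 1); split=> [//||s]; first exact: pcont_cst.
by apply/eqP; rewrite eq_complex /=; apply/andP; split; apply/eqP; ring.
Qed.
Lemma pder_vline x y : pder (fun s => Complex x s : C) y I.
Proof.
exists (fun=> I); split=> [//||s]; first exact: pcont_cst.
by apply/eqP; rewrite eq_complex /=; apply/andP; split; apply/eqP; ring.
Qed.

Definition in_rect x w y h (z : C) :=
  x <= complex.Re z <= x + w /\ y <= complex.Im z <= y + h.

Lemma in_rect_sub x w y h x' w' y' h' z : x <= x' -> x' + w' <= x + w ->
  y <= y' -> y' + h' <= y + h -> in_rect x' w' y' h' z -> in_rect x w y h z.
Proof. by move=> ? ? ? ? [/andP[? ?] /andP[? ?]]; split; lra. Qed.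

(** The integral of [f dz] counterclockwise along the boundary of the rectangle; the factor [I] is
    the direction of the vertical sides. *)
Definition rint f x w y h : C :=
  cint (fun s => f (Complex s y)) x (x + w)
  - cint (fun s => f (Complex s (y + h))) x (x + w)
  + I * (cint (fun s => f (Complex (x + w) s)) y (y + h)
         - cint (fun s => f (Complex x s)) y (y + h)).

Lemma rint_primitive F f x w y h : 0 <= w -> 0 <= h ->
  (forall z, in_rect x w y h z -> cder F z (f z)) -> rint f x w y h = 0.
Proof.
move=> w0 h0 dF; have xw : x <= x + w by rewrite lerDl.
have yh : y <= y + h by rewrite lerDl.
have hor y' : y <= y' <= y + h -> cint (fun s => f (Complex s y')) x (x + w) =
    F (Complex (x + w) y') - F (Complex x y').
  move=> hy; rewrite (@cintE _ _ (fun s => F (Complex s y')))// => t tx.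
  by rewrite -[f _]mulr1; apply: pder_comp (pder_hline _ _) _; exact: dF.
have ver x' : x <= x' <= x + w -> cint (fun s => f (Complex x' s)) y (y + h) =
    - I * (F (Complex x' (y + h)) - F (Complex x' y)).
  move=> hx; rewrite (@cintE _ _ (fun s => - I * F (Complex x' s))) ?mulrBr// => t tx.
  have -> : f (Complex x' t) = - I * (f (Complex x' t) * I).
    by case: (f _) => u v; apply/eqP; rewrite eq_complex /=; apply/andP; split;
      apply/eqP; ring.
  by apply: pderZ; apply: pder_comp (pder_vline _ _) _; exact: dF.
rewrite /rint !hor ?lexx ?yh// !ver ?lexx ?xw//.
rewrite -mulrBr mulrA mulrN -expr2 -[I]/('i%C) sqr_i opprK mul1r; ring.
Qed.

Section Continuous.
Variables (f : C -> C) (x w y h : R).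
Hypotheses (w0 : 0 <= w) (h0 : 0 <= h).
Hypothesis cf : forall z, in_rect x w y h z -> ccont f z.

Lemma rect_hcont y' : y <= y' <= y + h ->
  forall t, x <= t <= x + w -> pcont (fun s => f (Complex s y')) t.
Proof.
move=> hy t tx; apply: pcont_comp; first exact: pder_cont (pder_hline _ _).
exact: cf.
Qed.
Lemma rect_vcont x' : x <= x' <= x + w ->
  forall t, y <= t <= y + h -> pcont (fun s => f (Complex x' s)) t.
Proof.
move=> hy t tx; apply: pcont_comp; first exact: pder_cont (pder_vline _ _).
exact: cf.
Qed.

Lemma rint_bound (K : R) : (forall z, in_rect x w y h z -> nc (f z) <= K) ->
  nc (rint f x w y h) <= K * (2 * (w + h)).
Proof.
move=> hK; have xw : x <= x + w by rewrite lerDl.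
have yh : y <= y + h by rewrite lerDl.
have bh y' : y <= y' <= y + h ->
    nc (cint (fun s => f (Complex s y')) x (x + w)) <= K * w.
  move=> hy; have hK' t : x <= t <= x + w -> nc (f (Complex t y')) <= K.
    by move=> tx; apply: hK.
  by have := cint_bound xw (rect_hcont hy) hK'; rewrite (addrC x) addrK.
have bv x' : x <= x' <= x + w ->
    nc (cint (fun s => f (Complex x' s)) y (y + h)) <= K * h.
  move=> hx; have hK' t : y <= t <= y + h -> nc (f (Complex x' t)) <= K.
    by move=> tx; apply: hK.
  by have := cint_bound yh (rect_vcont hx) hK'; rewrite (addrC y) addrK.
have nI : nc I = 1 by rewrite /= expr0n add0r expr1n sqrtr1.
have h1 := bh y; have h2 := bh (y + h); have h3 := bv x; have h4 := bv (x + w).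
rewrite !lexx ?xw ?yh /= in h1 h2 h3 h4.
apply: (le_trans (ncD _ _)); rewrite ncM nI mul1r.
apply: le_trans (lerD (ncB _ _) (ncB _ _)) _.
have := h1 isT; have := h2 isT; have := h3 isT; have := h4 isT; lra.
Qed.

(** The inner sides of the four quarters are traversed twice, in opposite directions. *)
Lemma rint_split : rint f x w y h =
  rint f x (w / 2) y (h / 2) + rint f (x + w / 2) (w / 2) y (h / 2)
  + (rint f x (w / 2) (y + h / 2) (h / 2)
     + rint f (x + w / 2) (w / 2) (y + h / 2) (h / 2)).
Proof.
have w0' := w0; have h0' := h0.
have ew : x + w / 2 + w / 2 = x + w by lra.
have eh : y + h / 2 + h / 2 = y + h by lra.
have h1 : x <= x + w / 2 by lra.
have h2 : x + w / 2 <= x + w by lra.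
have h3 : y <= y + h / 2 by lra.
have h4 : y + h / 2 <= y + h by lra.
have h13 := le_trans h1 h2; have h24 := le_trans h3 h4.
rewrite /rint ew eh.
rewrite (cint_split h1 h2 (@rect_hcont y _)) ?lexx ?h24//.
rewrite (cint_split h1 h2 (@rect_hcont (y + h) _)) ?lexx ?h24//.
rewrite (cint_split h3 h4 (@rect_vcont x _)) ?lexx ?h13//.
rewrite (cint_split h3 h4 (@rect_vcont (x + w) _)) ?lexx ?h13//.
ring.
Qed.
End Continuous.

Lemma rintB f g x w y h : 0 <= w -> 0 <= h ->
  (forall z, in_rect x w y h z -> ccont f z) ->
  (forall z, in_rect x w y h z -> ccont g z) ->
  rint (fun z => f z - g z) x w y h = rint f x w y h - rint g x w y h.
Proof.
move=> w0 h0 cf cg; have xw : x <= x + w by rewrite lerDl.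
have yh : y <= y + h by rewrite lerDl.
rewrite /rint !cintB//; first by ring.
all: move=> t ht; do ?[by apply: (rect_hcont cf); rewrite ?lexx ?yh];
  do ?[by apply: (rect_hcont cg); rewrite ?lexx ?yh];
  do ?[by apply: (rect_vcont cf); rewrite ?lexx ?xw];
  by apply: (rect_vcont cg); rewrite ?lexx ?xw.
Qed.

Lemma half_pow_small (D d : R) : 0 <= D -> 0 < d -> exists n : nat, D / 2 ^+ n < d.
Proof.
move=> D0 d0; exists (Num.bound (D / d)).
rewrite ltr_pdivrMr ?exprn_gt0// -ltr_pdivrMl// mulrC.
apply: lt_trans (archi_boundP _) _; first by rewrite divr_ge0// ltW.
by rewrite -natrX ltr_nat ltn_expl.
Qed.

(** Bisection for an arbitrary property [bad a b n] of the rectangle with lower left corner [(a, b)]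
    and sides [w / 2 ^+ n], [h / 2 ^+ n]. In each coordinate the left ends never decrease and the
    right ends never increase, so the supremum of the left ends lies in every interval. *)
Lemma nested_rects (bad : R -> R -> nat -> Prop) x w y h : 0 <= w -> 0 <= h ->
  bad x y 0 ->
  (forall a b n, bad a b n -> exists a' b', [/\ bad a' b' n.+1,
     a' = a \/ a' = a + w / 2 ^+ n.+1 & b' = b \/ b' = b + h / 2 ^+ n.+1]) ->
  exists z : C, forall n, exists a b, bad a b n /\
    in_rect a (w / 2 ^+ n) b (h / 2 ^+ n) z.
Proof.
move=> w0 h0 bad0 bads.
pose T := (R * R)%type.
pose next (n : nat) (s s' : T) := [/\ bad s'.1 s'.2 n.+1,
  s'.1 = s.1 \/ s'.1 = s.1 + w / 2 ^+ n.+1 & s'.2 = s.2 \/ s'.2 = s.2 + h / 2 ^+ n.+1].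
pose st := fix st n : T := if n is m.+1 then xget (st m) [set s | next m (st m) s] else (x, y).
have stb n : bad (st n).1 (st n).2 n.
  elim: n => [//|n IH] /=; case: xgetP => [s _ []//|].
  have [a' [b' hab]] := bads _ _ _ IH; by move=> /(_ (a', b'))[].
have stn n : next n (st n) (st n.+1).
  rewrite /=; case: xgetP => [s _ //|].
  have [a' [b' hab]] := bads _ _ _ (stb n); by move=> /(_ (a', b'))[].
have lim (u : nat -> R) (v c : R) : 0 <= v -> u 0%N = c ->
    (forall n, u n.+1 = u n \/ u n.+1 = u n + v / 2 ^+ n.+1) ->
    exists l, forall n, u n <= l <= u n + v / 2 ^+ n.
  move=> v0 u0 us.
  have half n : v / 2 ^+ n = v / 2 ^+ n.+1 + v / 2 ^+ n.+1.
    by rewrite exprS invfM; field; rewrite expf_neq0.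
  have vn n : 0 <= v / 2 ^+ n by rewrite divr_ge0// exprn_ge0.
  have up n : u n <= u n.+1 by case: (us n) => ->; rewrite ?lerDl.
  have dn n : u n.+1 + v / 2 ^+ n.+1 <= u n + v / 2 ^+ n.
    by have := vn n.+1; rewrite (half n); case: (us n) => ->; lra.
  have upm n m : u n <= u (n + m)%N.
    by elim: m => [|m IH]; rewrite ?addn0// addnS (le_trans IH).
  have dnm n m : u (n + m)%N + v / 2 ^+ (n + m)%N <= u n + v / 2 ^+ n.
    by elim: m => [|m IH]; rewrite ?addn0// addnS (le_trans (dn _)).
  have uv n m : u n <= u m + v / 2 ^+ m.
    case: (leqP n m) => [nm|/ltnW nm].
      by rewrite -(subnKC nm) (le_trans (upm n (m - n)%N))// lerDl.
    rewrite -[in leLHS](subnKC nm) (le_trans _ (dnm m (n - m)%N))// lerDl//.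
  have hs : has_sup (range u).
    by split; [exists (u 0%N), 0%N|exists (u 0%N + v / 2 ^+ 0) => _ [n _ <-]].
  exists (sup (range u)) => n; apply/andP; split.
    by apply: ub_le_sup; [case: hs|exists n].
  by apply: ge_sup; [case: hs|move=> _ [m _ <-]].
have [lx hx] := lim (fun n => (st n).1) w x w0 erefl (fun n => let: And3 _ p _ := stn n in p).
have [ly hy] := lim (fun n => (st n).2) h y h0 erefl (fun n => let: And3 _ _ p := stn n in p).
exists (Complex lx ly) => n; exists (st n).1, (st n).2.
by split.
Qed.

(** If the integral were nonzero, some quarter would always keep a fourth of it, leaving
    [A / 4 ^+ n] on rectangles shrinking to a point [z]. Differentiability at [z] bounds it there by
    [e] times the square of the size, which is also of order [1 / 4 ^+ n], with [e] as small as
    desired. *)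
Theorem goursat f x w y h : 0 <= w -> 0 <= h ->
  (forall z, in_rect x w y h z -> cdiff f z) -> rint f x w y h = 0.
Proof.
move=> w0 h0 df; apply/eqP; rewrite -nc_eq0 eq_le nc_ge0 andbT leNgt; apply/negP.
set A := nc (rint f x w y h) => A0.
pose bad a b n := [/\ x <= a, a + w / 2 ^+ n <= x + w, y <= b,
  b + h / 2 ^+ n <= y + h & A / 4 ^+ n <= nc (rint f a (w / 2 ^+ n) b (h / 2 ^+ n))].
have [|a b n [h1 h2 h3 h4 hb]|z hz] := @nested_rects bad x w y h w0 h0.
- by rewrite /bad expr0 !divr1 !lexx.
- have ew : w / 2 ^+ n.+1 = w / 2 ^+ n / 2 by rewrite exprSr invfM mulrA.
  have eh : h / 2 ^+ n.+1 = h / 2 ^+ n / 2 by rewrite exprSr invfM mulrA.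
  have e4 : A / 4 ^+ n.+1 = A / 4 ^+ n / 4 by rewrite exprSr invfM mulrA.
  have wn0 : 0 <= w / 2 ^+ n by rewrite divr_ge0// exprn_ge0.
  have hn0 : 0 <= h / 2 ^+ n by rewrite divr_ge0// exprn_ge0.
  move: hb; rewrite rint_split//; last first.
    by move=> z /(in_rect_sub h1 h2 h3 h4)/df/cdiff_cont.
  rewrite /bad ew eh e4.
  move: (w / _) (h / _) (A / _) h2 h4 wn0 hn0 => W H B h2 h4 W0 H0 hB.
  have : nc (rint f a (W / 2) b (H / 2)) >= B / 4 \/
      nc (rint f (a + W / 2) (W / 2) b (H / 2)) >= B / 4 \/
      nc (rint f a (W / 2) (b + H / 2) (H / 2)) >= B / 4 \/
      nc (rint f (a + W / 2) (W / 2) (b + H / 2) (H / 2)) >= B / 4.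
    apply: contrapT => /not_orP[/negP c1 /not_orP[/negP c2 /not_orP[/negP c3 /negP c4]]].
    rewrite -!ltNge in c1 c2 c3 c4.
    have := le_trans hB (le_trans (ncD _ _) (lerD (ncD _ _) (ncD _ _))); lra.
  case=> [|[|[|]]] hq.
  - by exists a, b; split; [split=> //; lra|left|left].
  - by exists (a + W / 2), b; split; [split=> //; lra|right|left].
  - by exists a, (b + H / 2); split; [split=> //; lra|left|right].
  - by exists (a + W / 2), (b + H / 2); split; [split=> //; lra|right|right].
have zr : in_rect x w y h z.
  have [a' [b' [[h1 h2 h3 h4 _]]]] := hz 0%N; exact: in_rect_sub.
have [c /cder_eps hc] := df z zr.
have D0 : 0 <= w + h by rewrite addr_ge0.
(* This [e] makes [e * (2 * D ^+ 2)] smaller than [A]; the summand [1] covers the case [D = 0]. *)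
set D := w + h in D0; set e := A / (2 * D ^+ 2 + 1).
have D1 : 0 < 2 * D ^+ 2 + 1 by rewrite ltr_wpDl// mulr_ge0// sqr_ge0.
have e0 : 0 < e by rewrite divr_gt0.
have [d d0 hd] := hc _ e0; have [n hn] := half_pow_small D0 d0.
have [a [b [[h1 h2 h3 h4 hA] zQ]]] := hz n.
move: hA; apply/negP; rewrite -ltNge.
set W := w / 2 ^+ n in h2 zQ *; set H := h / 2 ^+ n in h4 zQ *.
have W0 : 0 <= W by rewrite divr_ge0// exprn_ge0.
have H0 : 0 <= H by rewrite divr_ge0// exprn_ge0.
have eWH : W + H = D / 2 ^+ n by rewrite -mulrDl.
have dist v : in_rect a W b H v -> nc (v - z) <= W + H.
  case: zQ => [zx zy] [vx vy]; apply: (le_trans (nc_le_ReIm _)).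
  by rewrite !raddfB lerD// ler_norml; lra.
pose aff v := f z + c * (v - z).
have daff v : cder aff v c.
  have := cderD (cder_cst (f z) v) (cderZ c (cderB (@cder_id _ v) (cder_cst z v))).
  by rewrite add0r subr0 mulr1.
have cf v : in_rect a W b H v -> ccont f v.
  by move=> /(in_rect_sub h1 h2 h3 h4)/df/cdiff_cont.
have ca v : in_rect a W b H v -> ccont aff v by move=> _; exact: cder_cont (daff v).
(* The affine approximation has a primitive, so subtracting it does not change the integral. *)
have -> : rint f a W b H = rint (fun v => f v - aff v) a W b H.
  rewrite rintB// (@rint_primitive (fun v => f z * v + c / 2 * ((v - z) * (v - z))) aff)//.
    by rewrite subr0.
  move=> v _; have dz := cderB (@cder_id _ v) (cder_cst z v).
  have := cderD (cderZ (f z) (@cder_id _ v)) (cderZ (c / 2) (cderM dz dz)).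
  by congr cder; rewrite /aff; field.
apply: (@le_lt_trans _ _ (e * (W + H) * (2 * (W + H)))).
  apply: rint_bound => // v vQ.
    by apply: ccontB; [exact: cf|exact: ca].
  rewrite /aff opprD addrA; apply: le_trans (hd v _) _.
    by apply: le_lt_trans (dist _ vQ) _; rewrite eWH.
  by rewrite ler_wpM2l ?dist// ltW.
rewrite eWH; have -> : e * (D / 2 ^+ n) * (2 * (D / 2 ^+ n)) = e * (2 * D ^+ 2) / 4 ^+ n.
  have -> : (4 : R) = 2 * 2 by ring.
  by rewrite exprMn; field; rewrite expf_neq0.
rewrite ltr_pM2r ?invr_gt0 ?exprn_gt0// /e mulrAC ltr_pdivrMr// ltr_pM2l//.
by rewrite ltrDl.
Qed.
End Goursat.

(** * The complex exponential and the mean value property *)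

Section MeanValue.
Variable R : realType.
Local Notation C := (R[i]).
Local Notation nc := (@Normc.normc R).
Implicit Types (f g k : C -> C) (x y : R) (z w a : C).

Definition cis (t : R) : C := Complex (cos t) (sin t).
Definition cexp z : C := Complex (expR (complex.Re z)) 0 * cis (complex.Im z).

Lemma nc_cis t : nc (cis t) = 1.
Proof. by rewrite /= cos2Dsin2 sqrtr1. Qed.
Lemma nc_cexp z : nc (cexp z) = expR (complex.Re z).
Proof. by rewrite ncM nc_real nc_cis mulr1 gtr0_norm// expR_gt0. Qed.
Lemma cexp_neq0 z : cexp z != 0.
Proof. by rewrite -nc_gt0 nc_cexp expR_gt0. Qed.
Lemma cisD s t : cis (s + t) = cis s * cis t.
Proof.
by rewrite /cis sinD cosD; apply/eqP; rewrite eq_complex /= eqxx /= addrC.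
Qed.
Lemma cexpD z w : cexp (z + w) = cexp z * cexp w.
Proof.
rewrite /cexp !raddfD /= expRD cisD.
have -> : Complex (expR (complex.Re z) * expR (complex.Re w)) 0 =
  Complex (expR (complex.Re z)) 0 * Complex (expR (complex.Re w)) 0 :> C.
  by apply/eqP; rewrite eq_complex /=; apply/andP; split; apply/eqP; ring.
by rewrite mulrACA.
Qed.
Lemma cexp0 : cexp 0 = 1.
Proof.
rewrite /cexp /= expR0 /cis cos0 sin0.
by apply/eqP; rewrite eq_complex /=; apply/andP; split; apply/eqP; ring.
Qed.

Lemma cder_cexp0 : cder cexp 0 1.
Proof.
have [E [hE cE E0]] := iffLR (is_derive1_caratheodory _ _ _) (is_derive_expR (0 : R)).
have [K [hK cK K0]] := iffLR (is_derive1_caratheodory _ _ _) (is_derive_cos (0 : R)).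
have [S [hS cS S0]] := iffLR (is_derive1_caratheodory _ _ _) (is_derive_sin (0 : R)).
apply/cder_eps => e e0.
rewrite expR0 in hE E0; rewrite cos0 in hK S0; rewrite sin0 oppr0 in K0.
rewrite sin0 in hS.
(* The error terms below add up to at most [6 * e'] times the modulus of [w]; the bound [e' <= 1]
   serves to get [expR x <= 2]. *)
set e' := Num.min 1 (e / 10).
have e'0 : 0 < e' by rewrite lt_min ltr01 divr_gt0.
have e'1 : e' <= 1 by rewrite ge_min lexx.
have e'e : e' <= e / 10 by rewrite ge_min lexx orbT.
have [d1 d10 h1] := iffLR (rcontP _ _) cE _ e'0.
have [d2 d20 h2] := iffLR (rcontP _ _) cK _ e'0.
have [d3 d30 h3] := iffLR (rcontP _ _) cS _ e'0.
have cexpR : {for 0, continuous (@expR R)} by exact: continuous_expR.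
have [d4 d40 h4] := iffLR (rcontP _ _) cexpR _ e'0.
exists (Num.min (Num.min d1 d2) (Num.min d3 d4)).
  by rewrite !lt_min d10 d20 d30 d40.
move=> w; rewrite subr0 !lt_min => /andP[/andP[w1 w2] /andP[w3 w4]].
rewrite cexp0 mul1r.
case: w w1 w2 w3 w4 => x y w1 w2 w3 w4.
have hx : `|x| <= nc (Complex x y) := Re_le_nc (Complex x y).
have hy : `|y| <= nc (Complex x y) := Im_le_nc (Complex x y).
have n0 : 0 <= nc (Complex x y) := nc_ge0 (Complex x y).
set N := nc (Complex x y) in w1 w2 w3 w4 hx hy n0 *.
have hE' := hE x; have hK' := hK y; have hS' := hS y.
rewrite !subr0 in hE' hK' hS'.
have b1 : `|E x - 1| < e' by rewrite -E0 h1// subr0 (le_lt_trans hx).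
have b2 : `|K y| < e' by rewrite -[K y]subr0 -K0 h2// subr0 (le_lt_trans hy).
have b3 : `|S y - 1| < e' by rewrite -S0 h3// subr0 (le_lt_trans hy).
have b4 : `|expR x - 1| < e' by rewrite -expR0 h4// subr0 (le_lt_trans hx).
have -> : cexp (Complex x y) - 1 - Complex x y =
  Complex (x * (E x - 1) + y * (expR x * K y)) (y * (expR x * (S y - 1) + (expR x - 1))).
  apply/eqP; rewrite eq_complex /=; apply/andP; split; apply/eqP.
    have -> : cos y = 1 + K y * y by rewrite -hK' addrC subrK.
    have -> : x * (E x - 1) = E x * x - x by ring.
    by rewrite -hE'; ring.
  by rewrite hS'; ring.
have ex2 : `|expR x| <= 2.
  by have := ler_normB (expR x - 1) (- 1); rewrite opprK subrK normrN1; lra.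
have p0 : 0 <= `|x| by [].
have q0 : 0 <= `|y| by [].
apply: (le_trans (nc_le_ReIm _)) => /=.
apply: le_trans (lerD (ler_normD _ _) (lexx _)) _.
rewrite !normrM.
have c1 : `|x| * `|E x - 1| <= N * e' by rewrite ler_pM// ltW.
have c2 : `|y| * (`|expR x| * `|K y|) <= N * (2 * e').
  by rewrite ler_pM// ?mulr_ge0// ler_pM// ltW.
have c3 : `|y| * `|expR x * (S y - 1) + (expR x - 1)| <= N * (3 * e').
  rewrite ler_pM//; apply: (le_trans (ler_normD _ _)); rewrite normrM.
  have : `|expR x| * `|S y - 1| <= 2 * e' by rewrite ler_pM// ltW.
  lra.
have : N * e' <= N * (e / 10) by rewrite ler_wpM2l.
have := mulr_ge0 n0 (ltW e0).
lra.
Qed.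

Lemma cder_cexp z : cder cexp z (cexp z).
Proof.
have h := cderB (@cder_id _ z) (cder_cst z z); rewrite subr0 in h.
have h' : cder cexp (z - z) 1 by rewrite subrr; exact: cder_cexp0.
have := cderZ (cexp z) (cder_comp h h'); rewrite !mulr1; apply: cder_near.
by apply: nhdT => w; rewrite -cexpD (addrC z) subrK.
Qed.

Lemma cis2pi t : cis (t + 2 * pi) = cis t.
Proof. by rewrite /cis cosD sinD !mulr_natl cos2pi sin2pi !mulr1 !mulr0 subr0 addr0. Qed.

Lemma pder_cis t : exists c, pder cis t c.
Proof. by exists (Complex (- sin t) (cos t)); apply/pderP; split;
  [exact: is_derive_cos|exact: is_derive_sin]. Qed.

Definition circ a (r : R) (t : R) : C := a + Complex r 0 * cis t.

Lemma pcont_circ a r t : pcont (circ a r) t.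
Proof.
have [c hc] := pder_cis t.
apply: pcontD; first exact: pcont_cst.
by apply: pcontM; [exact: pcont_cst|exact: pder_cont hc].
Qed.
Lemma nc_circ a r t : 0 <= r -> nc (circ a r t - a) = r.
Proof. by move=> r0; rewrite /circ addrC addKr ncM nc_cis mulr1 nc_real ger0_norm. Qed.
Lemma circ_cexp a r t : 0 < r -> circ a r t = a + cexp (Complex (ln r) t).
Proof. by move=> r0; rewrite /cexp /= lnK. Qed.

(** The map [a + cexp z] wraps a rectangle of height [2 pi] around an annulus, and by periodicity
    the horizontal sides cancel in [goursat]: the integral over a circle does not depend on its
    radius, which then tends to [0]. At the centre only continuity is asked, since the lemma is
    meant for difference quotients. *)
Lemma mean_value k a (r0 r : R) : 0 < r < r0 ->
  (forall z, nc (z - a) < r0 -> ccont k z) ->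
  (forall z, nc (z - a) < r0 -> z != a -> cdiff k z) ->
  cint (fun t => k (circ a r t)) 0 (2 * pi) = k a * Complex (2 * pi) 0.
Proof.
move=> /andP[rp rr0] ck dk.
have p2 : 0 <= 2 * pi :> R by rewrite mulr_ge0// pi_ge0.
have cc s t : 0 < s < r0 -> pcont (fun t => k (circ a s t)) t.
  move=> /andP[s0 sr]; apply: pcont_comp (pcont_circ _ _ _) _.
  by apply: ck; rewrite nc_circ// ltW.
have same s : 0 < s <= r -> cint (fun t => k (circ a r t)) 0 (2 * pi) =
    cint (fun t => k (circ a s t)) 0 (2 * pi).
  move=> /andP[s0 sr].
  have w0 : 0 <= ln r - ln s by rewrite subr_ge0 ler_ln.
  have := @goursat R (fun z => k (a + cexp z)) (ln s) (ln r - ln s) 0 (2 * pi) w0 p2 _.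
  rewrite /rint add0r (addrC (ln s)) subrK => H.
  have : forall z, in_rect (ln s) (ln r - ln s) 0 (2 * pi) z ->
      cdiff (fun z => k (a + cexp z)) z.
    move=> z [/andP[_ hz] _]; apply: cdiff_comp.
      by apply: cdiffD (cdiff_cst _ _) _; exists (cexp z); exact: cder_cexp.
    apply: dk; last first.
      apply/eqP => e; have := cexp_neq0 z.
      by rewrite -(addKr a (cexp z)) e addNr eqxx.
    rewrite (addrC a) addrK nc_cexp (le_lt_trans _ rr0)// -(lnK rp) ler_expR.
    by move: hz; rewrite (addrC (ln s)) subrK.
  move=> /H.
  have -> : (fun s0 : R => k (a + cexp (Complex s0 (2 * pi)))) =
      (fun s0 : R => k (a + cexp (Complex s0 0))).
    by apply/funext => u; rewrite /cexp /= -{1}[2 * pi]add0r cis2pi.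
  rewrite subrr add0r => /eqP; rewrite mulf_eq0 => /orP[|].
    by rewrite eq_complex /= oner_eq0 andbF.
  rewrite subr_eq0 => /eqP.
  under [fun s : R => k (a + cexp (Complex (ln r) s))]eq_fun do rewrite -circ_cexp//.
  by under [fun s0 : R => k (a + cexp (Complex (ln s) s0))]eq_fun do rewrite -circ_cexp//.
apply/eqP; rewrite -subr_eq0 -nc_eq0 eq_le nc_ge0 andbT; apply/ler_addgt0Pl => e e0.
rewrite addr0; have e1 : 0 < e / (2 * pi + 1) by rewrite divr_gt0// ltr_wpDl.
have ca : ccont k a by apply: ck; rewrite subrr nc0 (lt_trans rp).
have [d d0 hd] := ca _ e1.
set s := Num.min r (d / 2).
have s0 : 0 < s by rewrite lt_min rp divr_gt0.
have sr : s <= r by rewrite ge_min lexx.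
have sd : s < d by rewrite gt_min; apply/orP; right; lra.
rewrite (same s) ?s0//.
have -> : k a * Complex (2 * pi) 0 = cint (fun=> k a) 0 (2 * pi).
  by rewrite cint_cst// subr0.
have hc t : 0 <= t <= 2 * pi -> pcont (fun t => k (circ a s t)) t.
  by move=> _; apply: cc; rewrite s0 (le_lt_trans sr).
rewrite -(cintB p2 hc); last by move=> t _; exact: pcont_cst.
apply: le_trans (@cint_bound _ _ _ _ (e / (2 * pi + 1)) _ _ _) _ => //.
- move=> t ht; apply: pcontB; last exact: pcont_cst.
  exact: hc.
- by move=> t _; apply/ltW/hd; rewrite nc_circ// ltW.
- rewrite subr0 mulrAC ler_pdivrMr ?ler_pM2l//; lra.
Qed.

Lemma centre_bound k a (r0 r M : R) : 0 < r < r0 ->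
  (forall z, nc (z - a) < r0 -> ccont k z) ->
  (forall z, nc (z - a) < r0 -> z != a -> cdiff k z) ->
  (forall t, 0 <= t <= 2 * pi -> nc (k (circ a r t)) <= M) -> nc (k a) <= M.
Proof.
move=> hr ck dk hM; have := mean_value hr ck dk.
have p2 : 0 < 2 * pi :> R by rewrite mulr_gt0// pi_gt0.
case/andP: hr => r_gt0 rr0.
have cc t : 0 <= t <= 2 * pi -> pcont (fun t => k (circ a r t)) t.
  move=> _; apply: pcont_comp (pcont_circ _ _ _) _.
  by apply: ck; rewrite nc_circ// ltW.
have := cint_bound (ltW p2) cc hM.
move=> + e; rewrite e ncM nc_real subr0 gtr0_norm// ler_pM2r//.
Qed.
End MeanValue.

(** * Cauchy estimates and differentiability of the derivative *)

Section Holomorphic.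
Variable R : realType.
Local Notation C := (R[i]).
Local Notation nc := (@Normc.normc R).
Implicit Types (f g k : C -> C) (z w a : C) (r M K : R).

Definition hol_on f a r := forall z, nc (z - a) < r -> cdiff f z.

Lemma hol_on_sub f a r b r' : nc (b - a) + r' <= r -> hol_on f a r -> hol_on f b r'.
Proof.
move=> h hf z hz; apply: hf; apply: le_lt_trans (nc_tri z b a) _.
by apply: lt_le_trans h; rewrite addrC ltrD2l.
Qed.

Lemma seg_mvt f (f' : C -> C) z w K :
  (forall t : R, 0 <= t <= 1 -> cder f (z + (w - z) * Complex t 0)
     (f' (z + (w - z) * Complex t 0)) /\ nc (f' (z + (w - z) * Complex t 0)) <= K) ->
  nc (f w - f z) <= K * nc (w - z).
Proof.
move=> H; pose p t := f (z + (w - z) * Complex t 0).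
have := @path_mvt R p (fun t => f' (z + (w - z) * Complex t 0) * (w - z)) 0 1
  (K * nc (w - z)) ler01.
have -> : p 1 - p 0 = f w - f z.
  rewrite /p -[Complex 1 0]/(1 : C) -[Complex 0 0]/(0 : C) mulr1 mulr0 addr0.
  by rewrite addrCA subrr addr0.
rewrite subr0 mulr1; apply => t /H[h1 h2].
  by apply: pder_comp h1; exact: pder_line.
by rewrite ncM ler_wpM2r ?nc_ge0.
Qed.

Lemma seg_disc a r z w (t : R) : nc (z - a) < r -> nc (w - a) < r -> 0 <= t <= 1 ->
  nc (z + (w - z) * Complex t 0 - a) < r.
Proof.
move=> hz hw /andP[t0 t1].
have -> : z + (w - z) * Complex t 0 - a =
    (z - a) * Complex (1 - t) 0 + (w - a) * Complex t 0.
  have -> : Complex (1 - t) 0 = 1 - Complex t 0 :> C.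
    by apply/eqP; rewrite eq_complex /= subr0 !eqxx.
  by ring.
apply: (le_lt_trans (ncD _ _)); rewrite !ncM !nc_real !ger0_norm// ?subr_ge0//.
have [->|tn] := eqVneq t 0; first by rewrite subr0 mulr1 mulr0 addr0.
have tp : 0 < t by rewrite lt_def tn.
have h1 : nc (w - a) * t < r * t by rewrite ltr_pM2r.
have h2 : nc (z - a) * (1 - t) <= r * (1 - t).
  by rewrite ler_wpM2r ?subr_ge0// ltW.
lra.
Qed.

Lemma disc_lip f a r K z w : hol_on f a r ->
  (forall v, nc (v - a) < r -> nc (cd f v) <= K) ->
  nc (z - a) < r -> nc (w - a) < r -> nc (f w - f z) <= K * nc (w - z).
Proof.
move=> hf hK hz hw; apply: (@seg_mvt _ (cd f)) => t ht.
have hv := seg_disc hz hw ht; split; [exact/cdP/hf|exact: hK].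
Qed.

(** Continuous at [a] and differentiable elsewhere when [f] is holomorphic, it fits [mean_value],
    which then expresses the derivative of [f] at [a] as an average over a circle. *)
Definition slope f a w := if w == a then cd f a else (f w - f a) / (w - a).

Lemma slopeE f a w : f w = f a + slope f a w * (w - a).
Proof.
rewrite /slope; case: eqVneq => [->|wa]; first by rewrite subrr mulr0 addr0.
by rewrite divfK ?subr_eq0// addrC subrK.
Qed.
Lemma slope_cont f a : cdiff f a -> ccont (slope f a) a.
Proof.
move=> df; have ha : cder f a (slope f a a) by rewrite /slope eqxx; exact: cdP.
move: ha => [phi [pa cp h]]; apply: ccont_near cp; apply: nhdT => w.
have [->|wa] := eqVneq w a; first by [].
by rewrite /slope (negbTE wa) h (addrC (f a)) addrK mulfK// subr_eq0.
Qed.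
Lemma slope_cdiff f a z : cdiff f z -> z != a -> cdiff (slope f a) z.
Proof.
move=> df za; apply: (@cdiff_near _ (fun w => (f w - f a) * (w - a)^-1)).
  by apply: nhdS (nhd_neq za) => w /negbTE wa; rewrite /slope wa.
apply: cdiffM; first exact: cdiffB df (cdiff_cst _ _).
apply: cdiffV; last by rewrite subr_eq0.
exact: cdiffB (cdiff_id _) (cdiff_cst _ _).
Qed.

(** This is [centre_bound] for the slope; the factor [2] comes from the difference [f z - f a] in
    its numerator. *)
Lemma cauchy_estimate f a r0 r M : 0 < r < r0 -> hol_on f a r0 ->
  (forall z, nc (z - a) < r0 -> nc (f z) <= M) -> nc (cd f a) <= 2 * M / r.
Proof.
move=> hr hf hM; have /andP[rp rr0] := hr.
have r0p := lt_trans rp rr0.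
have -> : cd f a = slope f a a by rewrite /slope eqxx.
have da : nc (a - a) < r0 by rewrite subrr nc0.
apply: (@centre_bound _ _ _ r0 r) => //.
- move=> z hz; have [->|za] := eqVneq z a; first exact/slope_cont/hf.
  by apply/cdiff_cont/slope_cdiff => //; exact: hf.
- by move=> z hz za; apply: slope_cdiff => //; exact: hf.
- move=> t _; have nt := nc_circ a t (ltW rp).
  have ta : circ a r t != a.
    by rewrite -subr_eq0 -nc_eq0 nt gt_eqF.
  rewrite /slope (negbTE ta) ncM ncV nt ler_pM2r ?invr_gt0//.
  apply: (le_trans (ncB _ _)); have := hM a da.
  have := hM (circ a r t); rewrite nt => /(_ rr0); lra.
Qed.

Lemma hol_bounded f a r : 0 < r -> cdiff f a ->
  exists M r1, [/\ 0 < r1, r1 <= r, 0 < M & forall z, nc (z - a) < r1 -> nc (f z) <= M].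
Proof.
move=> r0 /cdiff_cont cf.
have [d d0 hd] := ccont_bound cf (ltr_pwDr ltr01 (lexx (nc (f a)))).
exists (nc (f a) + 1), (Num.min r d); split.
- by rewrite lt_min r0.
- by rewrite ge_min lexx.
- by rewrite ltr_wpDl ?nc_ge0.
- by move=> z; rewrite lt_min => /andP[_ /hd/ltW].
Qed.

(** Since the derivative is bounded, [f (v + h) - f v] is at most [L] times the modulus of [h]; the
    Cauchy estimate for this function of [v] then bounds the increment of the derivative. The
    successive radii [r1 / 2], [r1 / 8], [r1 / 16] make room for these steps. *)
Lemma cd_lip f a r : 0 < r -> hol_on f a r -> exists L s, [/\ 0 < s, s <= r, 0 < L &
  forall z w, nc (z - a) < s -> nc (w - a) < s -> nc (cd f w - cd f z) <= L * nc (w - z)].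
Proof.
move=> r0 hf.
have dfa : cdiff f a by apply: hf; rewrite subrr nc0.
have [M [r1 [r10 r1r M0 hM]]] := hol_bounded r0 dfa.
set L := 2 * M / (r1 / 4).
have L0 : 0 < L by rewrite !divr_gt0 ?mulr_gt0.
have hf1 : hol_on f a r1 by move=> z hz; apply: hf; exact: lt_le_trans hz r1r.
have hL z : nc (z - a) < r1 / 2 -> nc (cd f z) <= L.
  move=> hz; apply: (@cauchy_estimate _ _ (r1 / 2)); first lra.
    by apply: hol_on_sub hf1; lra.
  move=> w hw; apply: hM; have := nc_tri w z a; lra.
have lip z w : nc (z - a) < r1 / 2 -> nc (w - a) < r1 / 2 ->
    nc (f w - f z) <= L * nc (w - z).
  by apply: disc_lip => // v hv; apply: hf1; lra.
exists (2 * L / (r1 / 16)), (r1 / 16); split; [lra|lra|by rewrite !divr_gt0// mulr_gt0|].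
move=> z w hz hw; set h := w - z.
have nh : nc h <= r1 / 8 by have := nc_tri w a z; rewrite -(ncBC z a); lra.
pose fh v := f (v + h) - f v.
have hs v : nc (v - z) < r1 / 8 -> nc (v - a) < r1 / 4 /\ nc (v + h - a) < r1 / 2.
  move=> hv; have := nc_tri v z a; have := ncD (v - a) h.
  have -> : v - a + h = v + h - a by ring.
  by split; lra.
have dfh v : nc (v - z) < r1 / 8 -> cder fh v (cd f (v + h) - cd f v).
  move=> /hs[h1 h2]; apply: cderB; last by apply/cdP/hf1; lra.
  rewrite -[cd f (v + h)]mulr1; apply: (@cder_comp _ f (fun v => v + h)).
    by have := cderD (@cder_id _ v) (cder_cst h v); rewrite addr0.
  by apply/cdP/hf1; lra.
have -> : cd f w - cd f z = cd fh z.
  rewrite (cdE (dfh z _)); first by rewrite /h (addrC z) subrK.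
  by rewrite subrr nc0; lra.
have -> : 2 * L / (r1 / 16) * nc h = 2 * (L * nc h) / (r1 / 16) by ring.
apply: (@cauchy_estimate _ _ (r1 / 8)); first lra.
- by move=> v /dfh; exists (cd f (v + h) - cd f v).
- move=> v /hs[h1 h2]; rewrite /fh.
  have := @lip v (v + h); rewrite (addrC v h) addrK; apply; first lra.
  by rewrite addrC.
Qed.

(** By [mean_value], [cd f w] is an average of difference quotients over a circle of fixed radius
    that moves with its centre [w], and one differentiates under the integral sign. The error is a
    difference of two first-order Taylor remainders of [f], both quadratic in [h] because [cd f] is
    Lipschitz. *)
Theorem cd_cdiff f a r : 0 < r -> hol_on f a r -> cdiff (cd f) a.
Proof.
move=> r0 hf; have [L [s [s0 sr L0 lip]]] := cd_lip r0 hf.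
have hfs : hol_on f a s by move=> z hz; apply: hf; exact: lt_le_trans hz sr.
have cdc z : nc (z - a) < s -> ccont (cd f) z.
  move=> hz e e0; have [d d0 hd] := nhd_disc hz.
  exists (Num.min d (e / L)); first by rewrite lt_min d0 divr_gt0.
  move=> w; rewrite lt_min => /andP[/hd hw]; rewrite ltr_pdivlMr// mulrC.
  by apply: le_lt_trans; exact: lip.
have taylor z h : nc (z - a) < s -> nc (z + h - a) < s ->
    nc (f (z + h) - f z - cd f z * h) <= L * nc h ^+ 2.
  move=> hz hw.
  pose e v := f v - cd f z * v.
  have := @seg_mvt e (fun v => cd f v - cd f z) z (z + h) (L * nc h).
  have -> : e (z + h) - e z = f (z + h) - f z - cd f z * h by rewrite /e; ring.
  rewrite (addrC z h) addrK -mulrA -expr2; apply => t ht.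
  have hv := @seg_disc a s z (z + h) t hz hw ht.
  rewrite (addrC z h) addrK in hv; split.
    apply: cderB; first by apply/cdP/hfs.
    by have := cderZ (cd f z) (@cder_id _ (z + h * Complex t 0)); rewrite mulr1.
  apply: le_trans (lip _ _ hz hv) _; rewrite ler_pM2l// (addrC z) addrK ncM nc_real.
  by rewrite ler_piMr ?nc_ge0// ger0_norm; move: ht => /andP[].
set rho := s / 4; have rho0 : 0 < rho by rewrite divr_gt0.
have p2 : 0 < 2 * pi :> R by rewrite mulr_gt0// pi_gt0.
pose P z t := slope f z (circ z rho t).
pose Q t := (cd f (circ a rho t) - cd f a) / (circ a rho t - a).
have slope_c z w : nc (z - a) < s -> nc (w - a) < s -> ccont (slope f z) w.
  move=> hz hw; have [->|wz] := eqVneq w z; first by apply/slope_cont/hfs.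
  by apply/cdiff_cont/slope_cdiff => //; exact: hfs.
have PI z : nc (z - a) < s / 2 -> cint (P z) 0 (2 * pi) = cd f z * Complex (2 * pi) 0.
  move=> hz; rewrite (@mean_value _ (slope f z) z (s / 2)).
  - by rewrite /slope eqxx.
  - by rewrite rho0 /rho; lra.
  - by move=> w hw; apply: slope_c; [|have := nc_tri w z a]; lra.
  - move=> w hw wz; apply: slope_cdiff => //; apply: hfs.
    by have := nc_tri w z a; lra.
have cP z t : nc (z - a) < s / 2 -> pcont (P z) t.
  move=> hz; apply: pcont_comp (pcont_circ _ _ _) _; apply: slope_c; first lra.
  have := nc_tri (circ z rho t) z a; rewrite (nc_circ _ _ (ltW rho0)) /rho; lra.
have cn t : circ a rho t - a != 0 by rewrite -nc_eq0 (nc_circ _ _ (ltW rho0)) gt_eqF.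
have cQ t : pcont Q t.
  apply: (pcont_comp (f := fun w => (cd f w - cd f a) / (w - a)) (pcont_circ a rho t)).
  apply: ccontM.
    apply: ccontB; last exact: ccont_cst.
    by apply: cdc; rewrite (nc_circ _ _ (ltW rho0)) /rho; lra.
  apply: (@ccontV _ (fun w => w - a)) (cn t).
  by apply: ccontB; [exact: ccont_id|exact: ccont_cst].
pose c := cint Q 0 (2 * pi) / Complex (2 * pi) 0.
have n2pi : Complex (2 * pi) 0 != 0 :> C.
  by rewrite -nc_eq0 nc_real gtr0_norm// gt_eqF.
have da : nc (a - a) < s / 2 by rewrite subrr nc0; lra.
exists c; apply/cder_eps => e e0.
have e1 : 0 < e * rho / (2 * L) by rewrite divr_gt0// mulr_gt0.
exists (Num.min (s / 4) (e * rho / (2 * L))); first by rewrite lt_min e1 andbT; lra.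
move=> w; rewrite lt_min => /andP[w1 w2].
set h := w - a in w1 w2 *; have ew : w = a + h by rewrite /h addrC subrK.
have hw : nc (w - a) < s / 2 by rewrite -/h; lra.
suff : nc (cint (fun t => P w t - P a t - h * Q t) 0 (2 * pi)) <=
    2 * (L * nc h ^+ 2) / rho * (2 * pi - 0).
  have h1 t : 0 <= t <= 2 * pi -> pcont (P w) t by move=> _; exact: cP.
  have h2 t : 0 <= t <= 2 * pi -> pcont (P a) t by move=> _; exact: cP.
  have h3 t : 0 <= t <= 2 * pi -> pcont Q t by move=> _; exact: cQ.
  have h4 t : 0 <= t <= 2 * pi -> pcont (fun t => P w t - P a t) t.
    by move=> ht; apply: pcontB; [exact: h1|exact: h2].
  have h5 t : 0 <= t <= 2 * pi -> pcont (fun t => h * Q t) t.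
    by move=> ht; apply: pcontM; [exact: pcont_cst|exact: h3].
  rewrite (cintB (ltW p2) h4 h5) (cintB (ltW p2) h1 h2) (cintZ _ (ltW p2) h3) !PI//.
  have -> : cint Q 0 (2 * pi) = c * Complex (2 * pi) 0 by rewrite /c divfK.
  have -> : cd f w * Complex (2 * pi) 0 - cd f a * Complex (2 * pi) 0 -
      h * (c * Complex (2 * pi) 0) = (cd f w - cd f a - c * h) * Complex (2 * pi) 0 by ring.
  rewrite ncM nc_real gtr0_norm// subr0 ler_pM2r// => /le_trans; apply.
  rewrite expr2 !mulrA mulrAC ler_wpM2r ?nc_ge0//.
  rewrite ler_pdivrMr// mulrC -ler_pdivlMr ?mulr_gt0//.
  by move/ltW: w2; rewrite mulrA.
apply: cint_bound => [||t _]; first exact: ltW.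
  move=> t _; apply: pcontB; first by apply: pcontB; exact: cP.
  by apply: pcontM; [exact: pcont_cst|exact: cQ].
set u := circ a rho t - a.
have u0 : u != 0 := cn t.
have nu : nc u = rho by rewrite nc_circ// ltW.
have eu : circ a rho t = a + u by rewrite /u addrC subrK.
have ecw : circ w rho t = w + u by rewrite /u /circ; ring.
(* The circles about [w] and [a] are compared at equal angles, so the same [u] divides all terms. *)
have -> : P w t - P a t - h * Q t =
   (f (a + u + h) - f (a + u) - cd f (a + u) * h - (f (a + h) - f a - cd f a * h)) / u.
  rewrite /P /Q /slope eu ecw.
  have -> : (w + u == w) = false by rewrite -subr_eq0 addrC addKr; exact/negbTE.
  have -> : (a + u == a) = false by rewrite -subr_eq0 addrC addKr; exact/negbTE.
  by rewrite ew (addrAC a h u); field.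
rewrite ncM ncV nu ler_pM2r ?invr_gt0//; apply: (le_trans (ncB _ _)).
have t1 : nc (a + u - a) < s by rewrite addrC addKr nu /rho; lra.
have t2 : nc (a + u + h - a) < s.
  have -> : a + u + h - a = u + h by ring.
  have := ncD u h; rewrite nu /rho; lra.
have t3 : nc (a - a) < s by rewrite subrr nc0.
have t4 : nc (a + h - a) < s by rewrite addrC addKr; lra.
have := taylor _ _ t1 t2; have := taylor _ _ t3 t4; lra.
Qed.
End Holomorphic.

(** * Removable singularities, zeros and open mappings *)

Section LocalTheory.
Variable R : realType.
Local Notation C := (R[i]).
Local Notation nc := (@Normc.normc R).
Implicit Types (f g k : C -> C) (z w a : C) (r M K : R).

Lemma hol_self f a r : 0 < r -> hol_on f a r -> cdiff f a.
Proof. by move=> r0; apply; rewrite subrr nc0. Qed.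

(** Only the centre is in question, where the derivative has to be half of that of [cd f]. The
    derivative of the auxiliary [E] is the first-order remainder of [cd f], and its increment from
    [a] to [w] is [w - a] times the first-order remainder of the slope. *)
Lemma slope_hol f a r : 0 < r -> hol_on f a r -> hol_on (slope f a) a r.
Proof.
move=> r0 hf z hz; have [->|za] := eqVneq z a; last by apply: slope_cdiff => //; exact: hf.
have [c hc] := cd_cdiff r0 hf; have [c' hc'] : exists c', c = 2 * c'.
  by exists (c / 2); rewrite mulrC divfK.
rewrite hc' in hc.
exists c'; apply/cder_eps => e e0.
have [d d0 hd] := iffLR (cder_eps _ _ _) hc _ e0.
exists (Num.min r d); first by rewrite lt_min r0.
move=> w; rewrite lt_min => /andP[wr wd].
have [->|wa] := eqVneq w a; first by rewrite !subrr mulr0 subr0 nc0 mulr0.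
have wa0 : 0 < nc (w - a) by rewrite nc_gt0 subr_eq0.
pose E v := f v - cd f a * v - c' * ((v - a) * (v - a)).
have aa : nc (a - a) < Num.min r d by rewrite subrr nc0 lt_min r0.
have := @seg_mvt R E (fun v => cd f v - cd f a - 2 * c' * (v - a)) a w (e * nc (w - a)).
have -> : E w - E a = (slope f a w - slope f a a - c' * (w - a)) * (w - a).
  rewrite /E (slopeE f a w) [slope f a a]/slope eqxx; ring.
rewrite ncM ler_pM2r//; apply => t ht.
have hv : nc (a + (w - a) * Complex t 0 - a) < Num.min r d.
  by apply: seg_disc => //; rewrite lt_min wr.
have hv' : nc (a + (w - a) * Complex t 0 - a) <= nc (w - a).
  rewrite addrC addKr ncM nc_real ler_piMr ?nc_ge0// ger0_norm//; by move: ht => /andP[].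
move: hv; rewrite lt_min => /andP[hvr hvd]; move: (a + _) hv' hvr hvd => v hv' hvr hvd.
split; last by apply: le_trans (hd _ hvd) _; rewrite ler_pM2l.
have dv := cderB (@cder_id _ v) (cder_cst a v).
have h1 := cderB (cdP (hf _ hvr)) (cderZ (cd f a) (@cder_id _ v)).
have := cderB h1 (cderZ c' (cderM dv dv)).
by congr cder; ring.
Qed.

(** The product of [f z] with the square of [z - a] is differentiable also at [a], with value and
    derivative [0], so taking [slope] twice divides the square out again. *)
Theorem removable_singularity f a r M : 0 < r ->
  (forall z, nc (z - a) < r -> z != a -> cdiff f z) ->
  (forall z, nc (z - a) < r -> z != a -> nc (f z) <= M) ->
  exists2 g, hol_on g a r & forall z, z != a -> nc (z - a) < r -> g z = f z.
Proof.
move=> r0 hf hM; pose G z := (z - a) * (z - a) * f z.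
have dz z : cdiff (fun z => z - a) z by apply: cdiffB; [exact: cdiff_id|exact: cdiff_cst].
have M0 : 0 <= `|M| + 1 by rewrite addr_ge0.
have Ga : G a = 0 by rewrite /G subrr !mul0r.
have dGa : cder G a 0.
  apply/cder_eps => e e0; exists (Num.min r (e / (`|M| + 1))).
    by rewrite lt_min r0 divr_gt0// ltr_wpDl.
  move=> z; rewrite lt_min => /andP[zr ze]; rewrite mul0r subr0 Ga subr0 /G.
  have [->|za] := eqVneq z a; first by rewrite subrr !mul0r nc0 mulr0.
  rewrite !ncM mulrAC ler_wpM2r ?nc_ge0//.
  move: ze; rewrite ltr_pdivlMr ?ltr_wpDl// => /ltW; apply: le_trans.
  rewrite ler_wpM2l ?nc_ge0// (le_trans (hM _ zr za))// (le_trans (ler_norm _))//.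
  by rewrite lerDl.
have hG : hol_on G a r.
  move=> z hz; have [->|za] := eqVneq z a; first by exists 0.
  by apply: cdiffM; [exact: cdiffM|exact: hf].
have hG1 := slope_hol r0 hG; have hG2 := slope_hol r0 hG1.
exists (slope (slope G a) a) => // z za hz.
have G1a : slope G a a = 0 by rewrite /slope eqxx (cdE dGa).
rewrite {1}/slope (negbTE za) G1a subr0 /slope (negbTE za) Ga subr0 /G.
by field; rewrite subr_eq0.
Qed.

Lemma small_zero (x A : R) : 0 <= A -> (forall n : nat, x <= A / 2 ^+ n) -> x <= 0.
Proof.
move=> A0 h; rewrite leNgt; apply/negP => x0.
by have [n hn] := half_pow_small A0 x0; have := h n; rewrite leNgt hn.
Qed.

(** If the zero is not isolated, then [f] is divisible by every power of [w - a]. The cofactors are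
    bounded by their values on a circle, and this forces [f] to vanish near [a]. *)
Theorem isolated_zeros f a r : 0 < r -> hol_on f a r -> f a = 0 ->
  nhd a (fun w => f w = 0) \/ nhd a (fun w => w != a -> f w != 0).
Proof.
move=> r0 hf fa; have [?|iso] := pselect (nhd a (fun w => w != a -> f w != 0)).
  by right.
left.
have fac (n : nat) : exists2 g, hol_on g a r & forall w, f w = (w - a) ^+ n * g w.
  elim: n => [|n [g hg fg]]; first by exists f => // w; rewrite expr0 mul1r.
  have ga : g a = 0.
    apply: contrapT => /eqP ga; apply: iso.
    have cg := cdiff_cont (hol_self r0 hg).
    apply: nhdS (ccont_nhd cg (nhd_neq ga)) => w gw wa.
    by rewrite fg mulf_neq0// expf_neq0// subr_eq0.
  exists (slope g a); first exact: slope_hol.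
  by move=> w; rewrite fg [in LHS](slopeE g a w) ga add0r exprSr mulrA -mulrA
    (mulrC (slope _ _ _)) mulrA.
have [M [r1 [r10 r1r M0 hM]]] := hol_bounded r0 (hol_self r0 hf).
(* For [z] within [r1 / 8] of [a], the circle of radius [r1 / 2] about [z] stays at distance at
   least [3 * r1 / 8] from [a]. The quotient [1/3] of the two distances, raised to the power [n], is
   below [1 / 2 ^+ n]. *)
exists (r1 / 8); first by rewrite divr_gt0.
move=> z hz; apply/eqP; rewrite -nc_eq0 eq_le nc_ge0 andbT.
apply: (@small_zero _ M) => [|n]; first exact: ltW.
have [g hg fg] := fac n.
have s0 : 0 < 3 * r1 / 8 by rewrite divr_gt0// mulr_gt0.
have r12 : 0 < r1 / 2 < 3 * r1 / 4 by lra.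
have hgz : hol_on g z (3 * r1 / 4) by apply: hol_on_sub hg; lra.
have gz : nc (g z) <= M / (3 * r1 / 8) ^+ n.
  apply: (@centre_bound _ g z (3 * r1 / 4) (r1 / 2)) => //.
  - by move=> w /hgz/cdiff_cont.
  - by move=> w /hgz.
  - move=> t _; have r20 : 0 <= r1 / 2 by lra.
    have nt := nc_circ z t r20; set w := circ _ _ _ in nt *.
    have w1 : nc (w - a) < r1 by have := nc_tri w z a; lra.
    have w2 : 3 * r1 / 8 <= nc (w - a).
      by have := nc_tri w a z; rewrite (ncBC a); lra.
    rewrite ler_pdivlMr ?exprn_gt0//; apply: le_trans (hM _ w1).
    by rewrite fg ncM ncX mulrC ler_wpM2r ?nc_ge0// lerXn2r// nnegrE ?nc_ge0// ltW.
rewrite fg ncM ncX.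
apply: (@le_trans _ _ ((r1 / 8) ^+ n * (M / (3 * r1 / 8) ^+ n))).
  rewrite ler_pM ?exprn_ge0 ?nc_ge0// lerXn2r// ?nnegrE ?nc_ge0//; lra.
rewrite mulrCA ler_pM2l// -expr_div_n.
have -> : r1 / 8 / (3 * r1 / 8) = 3^-1 by field; rewrite gt_eqF.
by rewrite -exprVn lerXn2r// ?nnegrE ?invr_ge0// lef_pV2 ?posrE// ler_nat.
Qed.

Lemma circ_dist_cont f a (c : C) r : (forall t, ccont f (circ a r t)) ->
  forall t : R, {for t, continuous (fun t => nc (f (circ a r t) - c))}.
Proof.
move=> cf t; apply/rcontP => e e0.
have [d d0 hd] := pcont_comp (pcont_circ a r t) (cf t) e0.
exists d => // s /hd hs; apply: le_lt_trans hs.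
rewrite ler_norml; apply/andP; split.
  rewrite lerNl opprB; apply: le_trans (nc_sub_ge _ _) _.
  by rewrite opprB addrA subrK ncBC.
by apply: le_trans (nc_sub_ge _ _) _; rewrite opprB addrA subrK.
Qed.

(** If some [w] near [f a] were omitted, [1 / (f - w)] would be holomorphic and larger at [a] than
    on a circle where [f - f a] has modulus at least [m], against [centre_bound]. *)
Theorem open_mapping f a r : 0 < r -> hol_on f a r ->
  (forall z, nc (z - a) < r -> f z = f a -> z = a) ->
  nhd (f a) (fun w => exists2 z, nc (z - a) < r & f z = w).
Proof.
move=> r0 hf inj.
have r20 : 0 <= r / 2 by rewrite divr_ge0// ltW.
have cr t : nc (circ a (r / 2) t - a) < r by rewrite nc_circ//; lra.
have p2 : 0 <= 2 * pi :> R by rewrite mulr_ge0// pi_ge0.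
have [|t0 _ tmin] := @EVT_min R (fun t => nc (f (circ a (r / 2) t) - f a)) 0 (2 * pi) p2.
  apply: continuous_subspaceT; apply: circ_dist_cont => t.
  exact/cdiff_cont/hf.
set m := nc _ in tmin.
have m0 : 0 < m.
  rewrite nc_gt0 subr_eq0; apply/eqP => /(inj _ (cr _)) /eqP.
  by rewrite -subr_eq0 -nc_eq0 nc_circ// mulf_eq0 invr_eq0 pnatr_eq0 orbF gt_eqF.
exists (m / 2); first by rewrite divr_gt0.
move=> w hw; apply: contrapT => nw.
have fw z : nc (z - a) < r -> f z - w != 0.
  by move=> hz; rewrite subr_eq0; apply/eqP => e; apply: nw; exists z.
pose k z := (f z - w)^-1.
have hk : hol_on k a r.
  move=> z hz; apply: cdiffV; last exact: fw.
  by apply: cdiffB; [exact: hf|exact: cdiff_cst].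
have da : nc (a - a) < r by rewrite subrr nc0.
have : nc (k a) <= 2 / m.
  apply: (@centre_bound _ k a r (r / 2)).
  - lra.
  - by move=> z /hk/cdiff_cont.
  - by move=> z /hk.
  - move=> t; have := tmin t; rewrite in_itv /= => tm /tm{}tm.
    rewrite /k ncV -[2 / m]invrK invf_div lef_pV2 ?posrE ?nc_gt0 ?fw//; last lra.
    have := nc_tri (f (circ a (r / 2) t)) w (f a); lra.
rewrite /k ncV ler_pdivlMr// => h.
have fa0 : 0 < nc (f a - w) by rewrite nc_gt0 fw.
move: h; rewrite mulrC ler_pdivrMr//; move: hw; rewrite ncBC; lra.
Qed.

(** The maximum over a circle is attained, so the strict inequality survives the passage to the
    centre. *)
Lemma strict_max f a r M : 0 < r -> hol_on f a r ->
  (forall z, nc (z - a) < r -> z != a -> nc (f z) < M) -> nc (f a) < M.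
Proof.
move=> r0 hf hM.
have r20 : 0 <= r / 2 by rewrite divr_ge0// ltW.
have cr t : nc (circ a (r / 2) t - a) < r by rewrite nc_circ//; lra.
have p2 : 0 <= 2 * pi :> R by rewrite mulr_ge0// pi_ge0.
have [|t0 _ tmax] := @EVT_max R (fun t => nc (f (circ a (r / 2) t) - 0)) 0 (2 * pi) p2.
  apply: continuous_subspaceT; apply: circ_dist_cont => t.
  exact/cdiff_cont/hf.
apply: le_lt_trans (hM _ (cr t0) _).
  apply: (@centre_bound _ f a r (r / 2)).
  - lra.
  - by move=> z /hf/cdiff_cont.
  - by move=> z /hf.
  - by move=> t; have := tmax t; rewrite in_itv /= !subr0 => tm /tm.
by rewrite -subr_eq0 -nc_eq0 nc_circ// mulf_eq0 invr_eq0 pnatr_eq0 orbF gt_eqF.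
Qed.

(** * Inverses of injective holomorphic maps *)

Section Inverse.
Variables (D : C -> Prop) (f g : C -> C).
Hypothesis D_open : forall z, D z -> nhd z D.
Hypothesis f_diff : forall z, D z -> cdiff f z.
Hypothesis fK : forall z, D z -> g (f z) = z.

Let f_inj z w : D z -> D w -> f z = f w -> z = w.
Proof. by move=> hz hw e; rewrite -(fK hz) e fK. Qed.

Lemma inj_hol_open P a : D a -> nhd a P ->
  nhd (f a) (fun w => exists z, [/\ D z, P z & f z = w]).
Proof.
move=> Da hP; have [r r0 hr] := nhdI (D_open Da) hP.
have ha : nc (a - a) < r by rewrite subrr nc0.
have := @open_mapping f a r r0.
have hf : hol_on f a r by move=> z /hr[/f_diff].
move=> /(_ hf) H; apply: nhdS (H _) => [w [z /hr[Dz Pz] fz]|z /hr[Dz _]].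
  by exists z.
exact: f_inj.
Qed.

Lemma inj_hol_inv_cont a : D a -> ccont g (f a).
Proof.
move=> Da e e0; apply: nhdS (inj_hol_open Da (nhd_ball a e0)) => w [z [Dz Pz <-]].
by rewrite !fK.
Qed.

(** The Caratheodory factor of the inverse is the reciprocal of that of [f], composed with [g];
    continuity of [g] makes it continuous. *)
Lemma inv_cder a c : D a -> cder f a c -> c != 0 -> cder g (f a) c^-1.
Proof.
move=> Da [phi [<- cp h]] c0.
have cg := inj_hol_inv_cont Da.
have gfa := fK Da.
apply: (@cder_near _ (fun w => g (f a) + (phi (g w))^-1 * (w - f a))).
  have hn : nhd (f a) (fun w => phi (g w) != 0).
    apply: (@ccont_nhd _ g (f a) (fun z => phi z != 0)) cg _.
    by rewrite gfa; exact: (@ccont_nhd _ phi a (fun z => z != 0)) cp (nhd_neq c0).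
  apply: nhd2 (inj_hol_open Da (nhdT a (P := fun=> True) (fun=> I))) hn _.
  move=> w [z [Dz _ <-]]; rewrite !fK// => pz.
  by rewrite (h z) (addrC (f a)) addrK mulrA mulVf// mul1r addrC subrK.
exists (fun w => (phi (g w))^-1); split.
- by rewrite gfa.
- apply: (@ccontV _ (fun w => phi (g w))); last by rewrite gfa.
  by apply: (ccont_comp cg); rewrite gfa.
- by move=> w; rewrite subrr mulr0 addr0.
Qed.

(** Suppose the derivative vanishes at [a]. If it vanishes near [a], then [f] is constant there,
    against injectivity. Otherwise the zero is isolated, the inverse is differentiable off [f a] and
    bounded, hence extends holomorphically, and the chain rule at [a] reads [0 = 1]. *)
Theorem inj_hol_cd_neq0 a : D a -> cd f a != 0.
Proof.
move=> Da; apply/eqP => f0.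
have [r r0 hr] := D_open Da.
have hf : hol_on f a r by move=> z /hr/f_diff.
have hf' : hol_on (cd f) a (r / 2).
  move=> z hz; apply: (@cd_cdiff _ f z (r / 2)); first lra.
  by apply: hol_on_sub hf; lra.
have r2 : 0 < r / 2 by lra.
case: (isolated_zeros r2 hf' f0) => [[d d0 hd]|iso].
  pose s := Num.min r d; have s0 : 0 < s by rewrite lt_min r0.
  pose w := a + Complex (s / 2) 0.
  have wa : nc (w - a) = s / 2 by rewrite /w addrC addKr nc_real ger0_norm// divr_ge0// ltW.
  have hfs : hol_on f a s by move=> z; rewrite lt_min => /andP[/hf].
  have ws : nc (w - a) < s by rewrite wa; lra.
  have aa : nc (a - a) < s by rewrite subrr nc0.
  have := @disc_lip _ f a s 0 a w hfs _ aa ws.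
  rewrite mul0r => H; have : nc (f w - f a) = 0.
    apply/eqP; rewrite eq_le nc_ge0 andbT; apply: H => v.
    by rewrite lt_min => /andP[_ /hd ->]; rewrite nc0.
  move/eqP; rewrite nc_eq0 subr_eq0 => /eqP /f_inj wa'.
  have sr : s <= r by rewrite /s ge_min lexx.
  have Dw : D w by apply: hr; rewrite wa; lra.
  have := wa; rewrite (wa' Dw Da) subrr nc0.
  by move=> /eqP; rewrite eq_sym gt_eqF// divr_gt0.
have cg := inj_hol_inv_cont Da.
have gfa := fK Da.
have := inj_hol_open Da (nhdI iso (nhd_ball a r2)).
have gb : nhd (f a) (fun w => nc (g w) < nc a + 1).
  by apply: ccont_bound => //; rewrite gfa ltrDl.
move=> hn; have [d d0 hd] := nhdI hn gb.
have [||G hG Gg] := @removable_singularity g (f a) d (nc a + 1) d0.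
- move=> w /hd[[z [Dz [nz _] <-]] _] fza.
  have za : z != a by apply: contraNneq fza => ->.
  exists (cd f z)^-1; apply: inv_cder => //; last exact: nz.
  exact/cdP/f_diff.
- by move=> w /hd[_ /ltW].
(* The extension theorem says nothing about the value at [f a]; it is recovered from the continuity
   of [g] there. *)
have Gfa : G (f a) = a.
  apply/eqP; rewrite -subr_eq0 -nc_eq0 eq_le nc_ge0 andbT.
  apply/ler_addgt0Pl => e e0; rewrite addr0.
  have e2 : 0 < e / 2 by rewrite divr_gt0.
  have [s s0 hs] := nhdI (cdiff_cont (hol_self d0 hG) e2) (cg _ e2).
  pose m := Num.min s d; have m0 : 0 < m by rewrite lt_min s0.
  pose w := f a + Complex (m / 2) 0.
  have wa : nc (w - f a) = m / 2.
    by rewrite /w addrC addKr nc_real ger0_norm// divr_ge0// ltW.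
  have wm : nc (w - f a) < m by rewrite wa; lra.
  have wn : w != f a by rewrite -subr_eq0 -nc_eq0 wa gt_eqF//; lra.
  move: (wm); rewrite lt_min => /andP[ws wd].
  have [h1 h2] := hs w ws.
  rewrite gfa -(Gg w wn wd) in h2.
  apply: le_trans (nc_tri _ (G w) _) _; rewrite (ncBC (G (f a))); lra.
have GK : nhd a (fun z => G (f z) = z).
  apply: nhd2 (D_open Da) (ccont_nhd (cdiff_cont (f_diff Da)) (nhd_ball (f a) d0)) _.
  move=> z Dz hz; have [fza|fza] := eqVneq (f z) (f a).
    by rewrite fza Gfa; apply: f_inj.
  by rewrite Gg// fK.
have h1 := cder_comp (cdP (f_diff Da)) (cdP (hol_self d0 hG)).
have := cder_uniq (cder_near GK h1) (@cder_id _ a).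
by rewrite f0 mulr0 => /eqP; rewrite eq_sym oner_eq0.
Qed.

Lemma inj_hol_inv_cdiff a : D a -> cdiff g (f a).
Proof.
move=> Da; exists (cd f a)^-1; apply: inv_cder (inj_hol_cd_neq0 Da) => //.
exact/cdP/f_diff.
Qed.
End Inverse.
End LocalTheory.

(** * The plane and its complex structure *)

Section PlaneBridge.
Variable R : realType.
Local Notation C := (R[i]).
Local Notation nc := (@Normc.normc R).
Local Notation tc := (@to_complex R).
Local Notation oc := (@of_complex R).
Implicit Types (f : plane R -> plane R) (z v : plane R) (c : C).

Definition fC f : C -> C := tc \o f \o oc.

Lemma ocK : cancel oc tc. Proof. by case. Qed.
Lemma tcK : cancel tc oc. Proof. by case. Qed.
Lemma tcB z (w : plane R) : tc (z - w) = tc z - tc w. Proof. by case: z; case: w. Qed.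
Lemma tcD z (w : plane R) : tc (z + w) = tc z + tc w. Proof. by case: z; case: w. Qed.
Lemma tc_inj : injective tc. Proof. exact: can_inj tcK. Qed.
Lemma modulusE z : modulus z = nc (tc z). Proof. by []. Qed.
Lemma fCE f z : fC f (tc z) = tc (f z). Proof. by rewrite /fC /= tcK. Qed.

Lemma nbhs_nhd z (P : set (plane R)) : nbhs z P <-> nhd (tc z) (fun w => P (oc w)).
Proof.
split.
  move=> /nbhs_ballP[d /= d0 hd]; exists d => // w hw; apply: hd.
  split; rewrite /ball /= distrC.
    by apply: le_lt_trans hw; have := Re_le_nc (w - tc z); rewrite raddfB.
  by apply: le_lt_trans hw; have := Im_le_nc (w - tc z); rewrite raddfB.
move=> [d d0 hd]; apply/nbhs_ballP; exists (d / 2) => /=; first by rewrite divr_gt0.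
move=> w [/= h1 h2]; rewrite -[w]tcK; apply: hd.
apply: le_lt_trans (nc_le_ReIm _) _; rewrite !raddfB /=.
rewrite (distrC w.1) (distrC w.2); rewrite /ball /= in h1 h2; lra.
Qed.

Lemma open_nhd (A : set (plane R)) z : open A -> A z ->
  nhd (tc z) (fun w => A (oc w)).
Proof. by move=> oA Az; apply/nbhs_nhd; exact: open_nbhs_nbhs. Qed.

Lemma continuous_ccont f z : {for z, continuous f} <-> ccont (fC f) (tc z).
Proof.
split.
  move=> cf e e0.
  have : nbhs (f z) [set y | nc (tc y - tc (f z)) < e].
    by apply/nbhs_nhd; exists e => // w; rewrite -[w in X in X -> _]ocK.
  move=> /cf/nbhs_nhd; apply: nhdS => w.
  by rewrite fCE.
move=> cf P /= /nbhs_nhd[d d0 hd]; apply/nbhs_nhd.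
apply: nhdS (cf _ d0) => w; rewrite fCE => /hd /=.
by rewrite /fC /= tcK.
Qed.

Lemma continuous_into (T : topologicalType) (h : plane R -> T) z :
  {for z, continuous h} -> forall P : set T, nbhs (h z) P ->
  nhd (tc z) (fun w => P (h (oc w))).
Proof. by move=> ch P /ch/nbhs_nhd. Qed.

(** In the order of [R[i]] comparable elements have equal imaginary parts; this turns radii of balls
    in [R[i]] into real numbers. *)
Lemma complex_gt0 (e : C) : 0 < e -> e = Complex (complex.Re e) 0 /\ 0 < complex.Re e.
Proof. by case: e => a b; rewrite ltcE /= => /andP[/eqP <- ?]. Qed.

Lemma holomorphic_cdiff f z : holomorphic_at f z <-> cdiff (fC f) (tc z).
Proof.
rewrite /holomorphic_at -/(fC f); move: (fC f) (tc z) => F a.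
split.
- rewrite /derivable => /cvg_ex[l hl]; exists l; apply/cder_eps => e e0.
  have eC : 0 < Complex e 0 :> C by rewrite ltcE /= eqxx.
  move/cvgrPdist_lt: hl => /(_ _ eC); rewrite /dnbhs /within /=.
  move=> /nbhs_ballP[d /= d0 hd]; have [dE dp] := complex_gt0 d0.
  exists (complex.Re d) => // w hw.
  have [->|wa] := eqVneq w a; first by rewrite !subrr mulr0 subr0 nc0 mulr0.
  have h0 : w - a != 0 by rewrite subr_eq0.
  have := hd (w - a); rewrite /ball /= sub0r normrN => /(_ _ h0).
  have -> : (w - a) *: (1 : C^o) + a = w by rewrite /GRing.scale /= mulr1 subrK.
  rewrite dE !normc_def !ltcR -/(nc (w - a)).
  have nE (u : C) : Num.sqrt (complex.Re u ^+ 2 + complex.Im u ^+ 2) = nc u by case: u.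
  rewrite !nE => /(_ hw) => hh.
  have -> : F w - F a - l * (w - a) = - ((l - (w - a)^-1 *: (F w - F a : C^o)) * (w - a)).
    by rewrite /GRing.scale /=; field.
  by rewrite ncN ncM ler_wpM2r ?nc_ge0// ltW.
- move=> [l hl]; apply/cvg_ex; exists l; apply/cvgrPdist_lt => e /complex_gt0[-> e0].
  have e2 : 0 < complex.Re e / 2 by rewrite divr_gt0.
  have [d d0 hd] := iffLR (cder_eps _ _ _) hl _ e2.
  rewrite /dnbhs /within /=; apply/nbhs_ballP; exists (Complex d 0) => /=.
    by rewrite ltcE /= eqxx.
  move=> h; rewrite /ball /= sub0r normrN => hh h0.
  have nE (u : C) : Num.sqrt (complex.Re u ^+ 2 + complex.Im u ^+ 2) = nc u by case: u.
  have -> : h *: (1 : C^o) + a = h + a by rewrite /GRing.scale /= mulr1.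
  move: hh; rewrite !normc_def !ltcR !nE => hh.
  have := hd (h + a); rewrite addrK => /(_ hh).
  have h00 : 0 < nc h by rewrite nc_gt0.
  have -> : F (h + a) - F a - l * h = - ((l - h^-1 *: (F (h + a) - F a : C^o)) * h).
    by rewrite /GRing.scale /=; field.
  rewrite ncN ncM ler_pM2r// => /le_lt_trans; apply; lra.
Qed.

Definition cmulp c v : plane R := oc (c * tc v).
Lemma cmulp_linear c : linear (cmulp c).
Proof.
by move=> k u v; rewrite /cmulp; case: c u v => a b [? ?] [? ?] /=;
  congr pair; rewrite /= /GRing.scale /=; ring.
Qed.
HB.instance Definition _ c := GRing.isLinear.Build R (plane R) (plane R) *:%R
  (cmulp c) (@cmulp_linear c).

Lemma ccont_cmulp c : continuous (cmulp c).
Proof.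
move=> v; apply/continuous_ccont; apply: (@ccont_near _ (fun w => c * w)).
  by apply: nhdT => w; rewrite /fC /cmulp /= !ocK.
by apply: ccontM; [exact: ccont_cst|exact: ccont_id].
Qed.

Lemma norm_le_nc v : `|v| <= nc (tc v).
Proof. by rewrite prod_normE ge_max; apply/andP; split; [exact: (Re_le_nc (tc v))|exact: (Im_le_nc (tc v))]. Qed.
Lemma nc_le_norm v : nc (tc v) <= 2 * `|v|.
Proof.
apply: le_trans (nc_le_ReIm _) _; rewrite prod_normE.
have : `|v.1| <= Num.max `|v.1| `|v.2| by rewrite le_max lexx.
have : `|v.2| <= Num.max `|v.1| `|v.2| by rewrite le_max lexx orbT.
rewrite /=; lra.
Qed.

Lemma cder_is_diff f z c : cder (fC f) (tc z) c -> is_diff z f (cmulp c).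
Proof.
move=> hf.
have hexp : f \o shift z = cst (f z) + cmulp c +o_ (0 : plane R) id.
  apply/eqaddoP => e e0.
  have e2 : 0 < e / 2 by rewrite divr_gt0.
  have [d d0 hd] := iffLR (cder_eps _ _ _) hf _ e2.
  apply/nbhs_nhd; exists d => // w hw.
  have := hd (tc (oc w + z)); rewrite tcD ocK addrK.
  have hw' : nc w < d by rewrite -[w]subr0.
  move=> /(_ hw') h.
  rewrite -[(_ - _) _]/(f (oc w + z) - (f z + cmulp c (oc w))).
  apply: le_trans (norm_le_nc _) _; rewrite tcB tcD /cmulp !ocK opprD addrA.
  have -> : tc (f (oc w + z)) = fC f (w + tc z) by rewrite -[w in RHS]ocK -tcD fCE.
  rewrite -fCE; apply: le_trans h _.
  by have := nc_le_norm (oc w); rewrite ocK => h; rewrite mulrAC ler_pdivrMr// -mulrA (mulrC _ 2) ler_pM2l.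
have dE : 'd f z = cmulp c :> (_ -> _) := diff_unique (@ccont_cmulp c) hexp.
apply: DiffDef => //; apply/diff_locallyP; rewrite dE; split => //.
exact: ccont_cmulp.
Qed.

Lemma cder_differentiable f z c : cder (fC f) (tc z) c -> differentiable f z.
Proof. by move=> /cder_is_diff[]. Qed.
Lemma cder_diffE f z c v : cder (fC f) (tc z) c -> 'd f z v = oc (c * tc v).
Proof. by move=> /cder_is_diff[_ ->]. Qed.

Lemma diff_cder f z c : differentiable f z -> (forall v, 'd f z v = oc (c * tc v)) ->
  cder (fC f) (tc z) c.
Proof.
move=> df dE; apply/cder_eps => e e0.
have := diff_locally df => /eqaddoP H.
have e2 : 0 < e / 2 by rewrite divr_gt0.
have /nbhs_nhd[d d0 hd] := H _ e2.
exists d => // w hw; have hw' : nc (w - tc z - tc 0) < d by rewrite -[tc 0]/(0 : C) subr0.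
have := hd (w - tc z) hw'; rewrite -[(_ - _) _]/(f (oc (w - tc z) + z) - (f z + 'd f z (oc (w - tc z)))).
rewrite dE ocK.
have -> : oc (w - tc z) + z = oc w.
  by apply: tc_inj; rewrite tcD !ocK subrK.
set X := _ - _ => h.
have -> : fC f w - fC f (tc z) - c * (w - tc z) = tc X.
  by rewrite /X tcB tcD ocK fCE opprD addrA.
apply: le_trans (nc_le_norm _) _.
have := norm_le_nc (oc (w - tc z)); rewrite ocK => h'.
have := nc_ge0 (w - tc z).
have : e / 2 * `|oc (w - tc z)| <= e / 2 * nc (w - tc z) by rewrite ler_pM2l.
lra.
Qed.

(** A complex linear differential multiplies all lengths by the same factor [nc c], so the condition
    on all vectors collapses to one equation. *)
Lemma isometric_cder lam mu f z c : cder (fC f) (tc z) c ->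
  isometric_at lam mu f z <-> mu (f z) * nc c = lam z.
Proof.
move=> hf; have hE v : modulus ('d f z v) = nc c * modulus v.
  by rewrite (cder_diffE _ hf) modulusE ocK ncM.
split=> [[_ /(_ (1, 0))]|e].
  rewrite hE; have -> : modulus (1 : R, 0 : R) = 1 by exact: nc1.
  by rewrite !mulr1.
by split=> [|v]; [exact: cder_differentiable hf|rewrite hE mulrA e].
Qed.

End PlaneBridge.

(** * Charts *)

Section Parametrization.
Variables (R : realType) (X : riemannSurface R) (D : set (plane R)).
Variable (Phi : plane R -> X).
Local Notation C := (R[i]).
Local Notation tc := (@to_complex R).
Local Notation oc := (@of_complex R).
Hypothesis D_open : open D.
Hypothesis Phi_inj : forall z w, D z -> D w -> Phi z = Phi w -> z = w.
Hypothesis Phi_cont : forall z, D z -> {for z, continuous Phi}.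
Hypothesis Phi_hol : forall c z, atlas X c -> D z -> cdom c (Phi z) ->
  holomorphic_at (cfun c \o Phi) z.

Let Psi x : plane R := xget (0, 0) [set z | D z /\ Phi z = x].

Let PsiK z : D z -> Psi (Phi z) = z.
Proof.
move=> Dz; rewrite /Psi; case: xgetP => [w _ [Dw /Phi_inj]|/(_ z)[]//].
by apply.
Qed.

Let dom (c : chart R X) (w : C) : Prop := D (oc w) /\ cdom c (Phi (oc w)).

Let dom_open c w : dom c w -> nhd w (dom c).
Proof.
move=> [Dw cw]; rewrite -[w]ocK; apply: nhdI; first exact: open_nhd.
apply: continuous_into; first exact: Phi_cont.
by apply: open_nbhs_nbhs; split => //; exact: cdom_open.
Qed.
Let dom_diff c w : atlas X c -> dom c w -> cdiff (fC (cfun c \o Phi)) w.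
Proof.
by move=> ac [Dw cw]; rewrite -[w]ocK; apply/holomorphic_cdiff; exact: Phi_hol.
Qed.
Let dom_K c w : dom c w -> fC (Psi \o cinv c) (fC (cfun c \o Phi) w) = w.
Proof. by move=> [Dw cw]; rewrite /fC /= tcK cfunK// PsiK// ocK. Qed.

Let param_inv c z : atlas X c -> D z -> cdom c (Phi z) ->
  nbhs (cfun c (Phi z)) [set u | exists y,
    [/\ D y, cdom c (Phi y) & cfun c (Phi y) = u]] /\
  cdiff (fC (Psi \o cinv c)) (tc (cfun c (Phi z))).
Proof.
move=> ac Dz cz.
have dz : dom c (tc z) by rewrite /dom tcK.
split; last first.
  rewrite -(fCE (cfun c \o Phi)).
  exact: (inj_hol_inv_cdiff (@dom_open c) (fun w => dom_diff ac) (@dom_K c)).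
apply/nbhs_nhd; rewrite -(fCE (cfun c \o Phi)).
have := inj_hol_open (@dom_open c) (fun w => dom_diff ac) (@dom_K c) dz
  (nhdT (tc z) (P := fun=> True) (fun=> Logic.I)).
apply: nhdS => w [v [[Dv cv] _ <-]]; exists (oc v); split => //.
by rewrite /fC /= tcK.
Qed.

Let img_nbhs z : D z -> nbhs (Phi z) (Phi @` D).
Proof.
move=> Dz; have [c ac cz] := atlas_cover (Phi z).
have [hn _] := param_inv ac Dz cz.
have hc : nbhs (Phi z) (cdom c).
  by apply: open_nbhs_nbhs; split => //; exact: cdom_open.
apply: filterS (filterI hc (cfun_continuous cz hn)) => x [cx [y [Dy cy e]]].
by exists y => //; rewrite -(cfunK cy) e cfunK.
Qed.

Let Psi_cont x : (Phi @` D) x -> {for x, continuous Psi}.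
Proof.
move=> [z Dz <-]; have [c ac cz] := atlas_cover (Phi z).
have [_ /cdiff_cont /continuous_ccont h] := param_inv ac Dz cz.
move=> P hP; have hc : nbhs (Phi z) (cdom c).
  by apply: open_nbhs_nbhs; split => //; exact: cdom_open.
have hP' : nbhs ((Psi \o cinv c) (cfun c (Phi z))) P by rewrite /= cfunK.
apply: filterS (filterI hc (cfun_continuous cz (h _ hP'))) => y [cy] /=.
by rewrite cfunK.
Qed.

(** The inverse of an injective holomorphic map is holomorphic by [inj_hol_inv_cdiff]. Hence the
    transitions to and from every chart are holomorphic, and maximality of the atlas admits the new
    chart. *)
Lemma chart_of_param : exists A : chart R X,
  [/\ atlas X A, crng A = D, cinv A = Phi & cdom A = Phi @` D].
Proof.
have img_open : open (Phi @` D).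
  by rewrite openE => _ [z Dz <-]; exact: img_nbhs.
have PsiD x : (Phi @` D) x -> D (Psi x) by move=> [z Dz <-]; rewrite PsiK.
have PhiD z : D z -> (Phi @` D) (Phi z) by exists z.
have PsiK' x : (Phi @` D) x -> Phi (Psi x) = x by move=> [z Dz <-]; rewrite PsiK.
exists (Chart img_open D_open PsiD PhiD PsiK' PsiK Psi_cont Phi_cont); split => //.
apply: atlas_maximal => d ad; split => z /=; first by move=> Dz cz; exact: Phi_hol.
move=> dz [y Dy e]; have cy : cdom d (Phi y) by rewrite e; exact: cinv_cdom.
have [_ h] := param_inv ad Dy cy.
by apply/holomorphic_cdiff; move: h; rewrite e cinvK.
Qed.
End Parametrization.

(** * Charts transported along the inclusion of [S] *)

Section Pullback.
Variables (R : realType) (S Sc : riemannSurface R) (iota : S -> Sc).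
Local Notation tc := (@to_complex R).
Local Notation oc := (@of_complex R).
Hypothesis iota_hol : holomorphic iota.
Hypothesis iota_inj : injective iota.
Hypothesis iota_open : open (range iota).

Lemma push_chart (d : chart R S) : atlas S d -> exists A : chart R Sc,
  [/\ atlas Sc A, crng A = crng d, cinv A = iota \o cinv d &
      cdom A = iota @` cdom d].
Proof.
move=> ad; have [||||A [aA A1 A2 A3]] := @chart_of_param R Sc (crng d) (iota \o cinv d).
- exact: crng_open.
- by move=> z w hz hw /iota_inj e; rewrite -(cinvK hz) e cinvK.
- move=> z hz; apply: continuous_comp; first exact: cinv_continuous.
  exact: iota_hol.1.
- by move=> c z ac hz cz; exact: iota_hol.2.
exists A; split => //; rewrite A3; apply/seteqP; split => x [y hy <-].
  by exists (cinv d y) => //; exact: cinv_cdom.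
by exists (cfun d y); rewrite /= ?cfunK//; exact: cfun_crng.
Qed.

(** The restriction of [c] to [S]. Values are compared only inside the domains, as they are
    arbitrary outside. *)
Definition is_pullback (c : chart R Sc) (c' : chart R S) :=
  [/\ atlas S c',
      crng c' = crng c `&` [set z | range iota (cinv c z)],
      cdom c' = iota @^-1` cdom c,
      forall x, cdom c (iota x) -> cfun c' x = cfun c (iota x) &
      forall z, crng c' z -> iota (cinv c' z) = cinv c z].

(** The inverse of [iota] composed with [cinv c] is a parametrization to which [chart_of_param]
    applies; the argument in [S] supplies its default value. *)
Lemma pull_chart (c : chart R Sc) : S -> atlas Sc c ->
  exists c', is_pullback c c'.
Proof.
move=> x0 ac.
pose D := crng c `&` [set z | range iota (cinv c z)].
pose Phi z : S := if pselect (range iota (cinv c z)) is left h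
  then projT1 (cid2 h) else x0.
have PhiE z : D z -> iota (Phi z) = cinv c z.
  move=> [_ /= h]; rewrite /Phi; case: pselect => // h'.
  by case: cid2.
have D_open : open D.
  rewrite openE => z [hz rz]; apply: filterI.
    by apply: open_nbhs_nbhs; split => //; exact: crng_open.
  by apply: (cinv_continuous hz); exact: open_nbhs_nbhs.
(* In the chart [A] pushed forward from [d], the map [Phi] is a transition map. *)
have loc z : D z -> forall d, atlas S d -> cdom d (Phi z) -> exists A,
    [/\ atlas Sc A, nbhs z [set w | D w /\ Phi w = cinv d (cfun A (cinv c w))],
    crng d (cfun A (cinv c z)) & holomorphic_at (cfun A \o cinv c) z].
  move=> Dz d ad dz; have [A [aA A1 A2 A3]] := push_chart ad.
  have Az : cdom A (cinv c z) by rewrite A3 -(PhiE z Dz); exists (Phi z).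
  exists A; split => //.
  - have hA : nbhs z (cdom A \o cinv c).
      apply: (cinv_continuous (proj1 Dz)); apply: open_nbhs_nbhs; split => //.
      exact: cdom_open.
    have hD : nbhs z D by apply: open_nbhs_nbhs; split.
    apply: filterS (filterI hD hA) => w [Dw /= Aw]; split => //.
    apply: iota_inj; rewrite PhiE//.
    by have := cfunK Aw; rewrite A2 /= => ->.
  - by rewrite -A1; exact: cfun_crng.
  - by apply: atlas_holomorphic => //; exact: (proj1 Dz).
have [||||c' [ac' c1 c2 c3]] := @chart_of_param R S D Phi.
- exact: D_open.
- move=> z w Dz Dw e; have := PhiE z Dz; rewrite e PhiE// => e'.
  by rewrite -(cinvK (proj1 Dz)) -e' cinvK//; exact: (proj1 Dw).
- move=> z Dz; have [d ad dz] := atlas_cover (Phi z).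
  have [A [aA hn dA hA]] := loc z Dz d ad dz.
  have cA : {for z, continuous (cfun A \o cinv c)}.
    by apply/continuous_ccont/cdiff_cont/holomorphic_cdiff.
  move=> P hP; have hP' : nbhs (cinv d (cfun A (cinv c z))) P.
    by have [_ <-] := nbhs_singleton hn.
  have := cA _ (cinv_continuous dA hP').
  move=> /(filterI hn); apply: filterS => w [[_ /= e] h].
  by rewrite /= e.
- move=> d z ad Dz dz; have [A [aA hn dA hA]] := loc z Dz d ad dz.
  have hA' := iffLR (holomorphic_cdiff _ _) hA.
  apply/holomorphic_cdiff; apply: cdiff_near (hA').
  have cA : {for z, continuous (cfun A \o cinv c)}.
    exact/continuous_ccont/cdiff_cont.
  have hd : nbhs z [set w | crng d (cfun A (cinv c w))].
    by apply: cA; apply: open_nbhs_nbhs; split => //; exact: crng_open.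
  have hnd := iffLR (nbhs_nhd _ _) (filterI hn hd).
  apply: (nhdS _ (hnd _)) => w [[_ /= e] dw].
  by rewrite /fC /= e cinvK.
exists c'; split => //.
- rewrite c3; apply/seteqP; split => x.
    by move=> [z Dz <-]; rewrite /= PhiE//; apply: cinv_cdom; exact: (proj1 Dz).
  move=> /= cx; have Dx : D (cfun c (iota x)).
    by split; [exact: cfun_crng|rewrite /= cfunK//; exists x].
  by exists (cfun c (iota x)) => //; apply: iota_inj; rewrite PhiE// cfunK.
- move=> x cx; have Dx : D (cfun c (iota x)).
    by split; [exact: cfun_crng|rewrite /= cfunK//; exists x].
  have e : Phi (cfun c (iota x)) = x by apply: iota_inj; rewrite PhiE// cfunK.
  rewrite -{1}e -c2 cinvK// c1//.
- by move=> z; rewrite c1 c2 => /PhiE.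
Qed.
End Pullback.

(** * Horocyclic neighbourhoods *)

Section Orientation.
Variable R : realType.
Local Notation nc := (@Normc.normc R).
Local Notation tc := (@to_complex R).
Local Notation oc := (@of_complex R).

Definition conjp (z : plane R) : plane R := (z.1, - z.2).
Lemma conjp_linear : linear conjp.
Proof.
by move=> k [? ?] [? ?]; congr pair; rewrite /= /GRing.scale /=; ring.
Qed.
HB.instance Definition _ := GRing.isLinear.Build R (plane R) (plane R) *:%R
  conjp conjp_linear.
Lemma conjpK : involutive conjp.
Proof. by case=> a b; rewrite /conjp /= opprK. Qed.
Lemma modulus_conjp z : modulus (conjp z) = modulus z.
Proof. by rewrite /modulus /= sqrrN. Qed.
Lemma continuous_conjp : continuous conjp.
Proof.
move=> z; apply/continuous_ccont => e e0; exists e => // w hw.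
have -> : fC conjp w - fC conjp (tc z) = conjc (w - tc z).
  by case: w {hw} => a b; case: z => x y; apply/eqP; rewrite eq_complex /=;
    apply/andP; split; apply/eqP; ring.
by case: (w - tc z) hw => a b /=; rewrite sqrrN.
Qed.

Definition jac (f : plane R -> plane R) z : R :=
  ('D_(1, 0) f z).1 * ('D_(0, 1) f z).2 - ('D_(1, 0) f z).2 * ('D_(0, 1) f z).1.

Lemma diff_basis (f : plane R -> plane R) z v : differentiable f z ->
  'd f z v = v.1 *: 'D_(1, 0) f z + v.2 *: 'D_(0, 1) f z.
Proof.
move=> df; rewrite !deriveE// -!linearZ -linearD; congr ('d f z _).
by case: v => a b; congr pair; rewrite /= /GRing.scale /=; ring.
Qed.

Lemma conformal_basis (a1 a2 b1 b2 k : R) :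
  (forall x y, (x * a1 + y * b1) ^+ 2 + (x * a2 + y * b2) ^+ 2 =
     k ^+ 2 * (x ^+ 2 + y ^+ 2)) ->
  [/\ a1 ^+ 2 + a2 ^+ 2 = k ^+ 2, b1 ^+ 2 + b2 ^+ 2 = k ^+ 2 &
    a1 * b1 + a2 * b2 = 0].
Proof.
move=> sq; have e1 : a1 ^+ 2 + a2 ^+ 2 = k ^+ 2 by have := sq 1 0; lra.
have e2 : b1 ^+ 2 + b2 ^+ 2 = k ^+ 2 by have := sq 0 1; lra.
by split => //; have := sq 1 1; lra.
Qed.

(** Two orthogonal plane vectors of equal length differ by a quarter turn, whose sense is the sign
    of the determinant: this separates complex multiplication from its conjugate. *)
Lemma conformal_identities (a1 a2 b1 b2 m : R) : m != 0 ->
  a1 ^+ 2 + a2 ^+ 2 = m -> b1 ^+ 2 + b2 ^+ 2 = m -> a1 * b1 + a2 * b2 = 0 ->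
  [/\ (a1 * b2 - a2 * b1) ^+ 2 = m ^+ 2,
    a1 * b2 - a2 * b1 = m -> b1 = - a2 /\ b2 = a1 &
    - (a1 * b2 - a2 * b1) = m -> b1 = a2 /\ b2 = - a1].
Proof.
move=> m0 e1 e2 e3.
have f1 : m * b1 = a1 * (a1 * b1 + a2 * b2) - a2 * (a1 * b2 - a2 * b1).
  by rewrite -e1; ring.
have f2 : m * b2 = a2 * (a1 * b1 + a2 * b2) + a1 * (a1 * b2 - a2 * b1).
  by rewrite -e1; ring.
rewrite e3 in f1 f2; split.
- have -> : (a1 * b2 - a2 * b1) ^+ 2 = (a1 ^+ 2 + a2 ^+ 2) * (b1 ^+ 2 + b2 ^+ 2)
    - (a1 * b1 + a2 * b2) ^+ 2 by ring.
  by rewrite e1 e2 e3 expr0n subr0 expr2.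
- move=> e; rewrite e in f1 f2.
  by split; apply: (mulfI m0); [rewrite f1|rewrite f2]; ring.
- move/(canRL (@opprK _)) => e; rewrite e in f1 f2.
  by split; apply: (mulfI m0); [rewrite f1|rewrite f2]; ring.
Qed.

Lemma cmul_basis (a b : plane R) v : b.1 = - a.2 -> b.2 = a.1 ->
  v.1 *: a + v.2 *: b = oc (tc a * tc v).
Proof.
case: a b v => [a1 a2] [b1 b2] [x y] /= -> ->.
by congr pair; rewrite /= /GRing.scale /=; ring.
Qed.

Lemma cmul_conj_basis (a b : plane R) v : b.1 = a.2 -> b.2 = - a.1 ->
  (conjp v).1 *: a + (conjp v).2 *: b = oc (tc a * tc v).
Proof.
case: a b v => [a1 a2] [b1 b2] [x y] /= -> ->.
by congr pair; rewrite /= /GRing.scale /=; ring.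
Qed.

Section Conformal.
Variables (lam mu : plane R -> R) (f : plane R -> plane R) (z : plane R).
Hypothesis lam0 : 0 < lam z.
Hypothesis mu0 : 0 < mu (f z).
Hypothesis iso : isometric_at lam mu f z.

Let A := 'D_(1, 0) f z.
Let B := 'D_(0, 1) f z.
Let df : differentiable f z := iso.1.
Let k := lam z / mu (f z).
Let k0 : 0 < k. Proof. exact: divr_gt0. Qed.
Let sq v : (v.1 * A.1 + v.2 * B.1) ^+ 2 + (v.1 * A.2 + v.2 * B.2) ^+ 2 =
  k ^+ 2 * (v.1 ^+ 2 + v.2 ^+ 2).
Proof.
have hv : modulus ('d f z v) = k * modulus v.
  by apply: (mulfI (lt0r_neq0 mu0)); rewrite iso.2 /k mulrA mulrCA divff ?mulr1// gt_eqF.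
have : modulus ('d f z v) ^+ 2 = k ^+ 2 * modulus v ^+ 2 by rewrite hv exprMn.
by rewrite /modulus !sqr_sqrtr ?addr_ge0 ?sqr_ge0// diff_basis.
Qed.
Let rel : [/\ A.1 ^+ 2 + A.2 ^+ 2 = k ^+ 2, B.1 ^+ 2 + B.2 ^+ 2 = k ^+ 2 &
  A.1 * B.1 + A.2 * B.2 = 0].
Proof.
by apply: conformal_basis => x y; exact: (sq (x, y)).
Qed.
Let jacE : jac f z = A.1 * B.2 - A.2 * B.1. Proof. by []. Qed.
Let k2 : k ^+ 2 != 0. Proof. by rewrite sqrf_eq0 gt_eqF. Qed.
Let ids := let: And3 e1 e2 e3 := rel in conformal_identities k2 e1 e2 e3.

Lemma jac_neq0 : jac f z != 0.
Proof.
have [e _ _] := ids; rewrite -jacE in e.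
by rewrite -sqrf_eq0 e !sqrf_eq0 gt_eqF.
Qed.

Lemma conformal_pos : 0 < jac f z -> cdiff (fC f) (tc z).
Proof.
move=> jp; have [e e' _] := ids; rewrite -jacE in e e'.
have [|b1 b2] := e'.
  by apply/eqP; rewrite -(@eqrXn2 _ 2) ?e ?ltW// exprn_gt0.
exists (tc A); apply: diff_cder => // v.
by rewrite diff_basis// -/A -/B cmul_basis.
Qed.

Lemma conformal_neg : jac f z < 0 -> exists2 c,
  cder (fC (f \o conjp)) (tc (conjp z)) c & mu (f z) * nc c = lam z.
Proof.
move=> jn; have [e _ e'] := ids; rewrite -jacE in e e'.
have [|b1 b2] := e'.
  by apply/eqP; rewrite -(@eqrXn2 _ 2) ?sqrrN ?e ?oppr_ge0 ?ltW// exprn_gt0.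
have dc : differentiable conjp (conjp z) := linear_differentiable _ continuous_conjp.
have df' : differentiable f (conjp (conjp z)) by rewrite conjpK.
exists (tc A).
  apply: diff_cder => [|v]; first exact: differentiable_comp.
  have h := diff_comp dc df'.
  have h' := congr1 (fun T : plane R -> plane R => T v) (diff_lin (conjp z) continuous_conjp).
  apply: (etrans (congr1 (fun T : plane R -> plane R => T v) h)).
  apply: (etrans (congr1 ('d f (conjp (conjp z))) h')).
  apply: (etrans (congr1 (fun y => 'd f y (conjp v)) (conjpK z))).
  apply: (etrans (diff_basis _ df)); exact: cmul_conj_basis.
have [e1 _ _] := rel.
have -> : nc (tc A) = k by rewrite -modulusE /modulus e1 sqrtr_sqr gtr0_norm.
by rewrite /k mulrC divfK// gt_eqF.
Qed.

Lemma jac_cdiff : cdiff (fC f) (tc z) -> 0 < jac f z.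
Proof.
move=> [c hc]; rewrite lt_def jac_neq0 /= /jac !deriveE// !(cder_diffE _ hc).
case: (c) => a b; rewrite [X in 0 <= X](_ : _ = a ^+ 2 + b ^+ 2).
  by rewrite addr_ge0 ?sqr_ge0.
by rewrite /=; ring.
Qed.
End Conformal.

(** The indicator function of [P] is locally constant, so its derivative is [0] everywhere and it is
    constant on the line. *)
Lemma locally_constant (P : R -> Prop) :
  (forall t, exists2 d : R, 0 < d & forall s, `|s - t| < d -> (P s <-> P t)) ->
  forall s t, P s -> P t.
Proof.
move=> lc s t Ps; pose phi u : R := if pselect (P u) then 1 else 0.
suff : phi s = phi t.
  rewrite /phi; case: (pselect (P s)) => [h|//]; case: (pselect (P t)) => [//|h' e].
  by move/eqP: e; rewrite /= oner_eq0.
apply: is_derive_0_is_cst => u; have [d d0 hd] := lc u.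
apply: (@near_eq_is_derive _ _ _ (cst (phi u))) => //.
apply/nbhs_ballP; exists d => //= v; rewrite /ball /= distrC => /hd Pv.
by rewrite /phi; case: pselect => h; case: pselect => h' //; exfalso; tauto.
Qed.

Lemma punctured_disk_open (r : R) : open (@punctured_disk R r).
Proof.
rewrite openE => z /= /andP[z0 zr]; apply/nbhs_nhd.
have h0 : tc z != 0 by rewrite -nc_gt0.
have zr' : nc (tc z - 0) < r by rewrite subr0.
apply: nhd2 (nhd_neq h0) (nhd_disc zr') _ => w w0; rewrite subr0 => wr.
by rewrite /punctured_disk /= !modulusE !ocK nc_gt0 w0.
Qed.

Lemma sign_stable (h : plane R -> R) z : {for z, continuous h} -> h z != 0 ->
  nbhs z [set w | (0 < h w) = (0 < h z)].
Proof.
move=> ch; case: (ltgtP 0 (h z)) => // hz _.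
  have : \forall w \near z, 0 < h w by apply: (cvgr_gt _ ch).
  by apply: filterS => w hw; rewrite /= hw.
have : \forall w \near z, h w < 0 by apply: (cvgr_lt _ ch).
by apply: filterS => w hw; rewrite /= ltNge (ltW hw).
Qed.

Section Isometry.
Variables (S : riemannSurface R) (g : conformalMetric S) (U : set S) (r : R).
Local Notation D := (punctured_disk r).
Local Notation lam := (@punctured_disk_density R).
Hypothesis r01 : 0 < r < 1.

Lemma lam_gt0 z : D z -> 0 < lam z.
Proof.
move=> /= /andP[z0 zr]; have l0 : ln (modulus z) < 0.
  by rewrite ln_lt0// z0 (lt_trans zr)//; case/andP: r01.
by rewrite invr_gt0 normr_gt0 mulf_eq0 negb_or gt_eqF// lt_eqF.
Qed.

Section Map.
Variable F : plane R -> S.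
Hypothesis F_iso : is_isometry D lam g U F.

Definition hol_pt z := forall c, atlas S c -> cdom c (F z) ->
  cdiff (fC (cfun c \o F)) (tc z).

Lemma hol_pt1 z c : D z -> atlas S c -> cdom c (F z) ->
  cdiff (fC (cfun c \o F)) (tc z) -> hol_pt z.
Proof.
move=> Dz ac cz hc d ad dz.
have dz' : cdom d (cinv c (cfun c (F z))) by rewrite cfunK.
have ht := iffLR (holomorphic_cdiff _ _) (atlas_holomorphic ac ad (cfun_crng cz) dz').
have ht' : cdiff (fC (cfun d \o cinv c)) (fC (cfun c \o F) (tc z)) by rewrite fCE.
apply: cdiff_near (cdiff_comp hc ht').
have [_ Fc _ _] := F_iso.
have : nhd (tc z) (fun w => cdom c (F (oc w))).
  by apply: (continuous_into (Fc _ Dz)); apply: open_nbhs_nbhs; split => //; exact: cdom_open.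
by apply: nhdS => w cw; rewrite /fC /= tcK cfunK.
Qed.

(** In a fixed chart, [hol_pt] amounts to positivity of the Jacobian, which is continuous and does
    not vanish, hence keeps its sign near [z]. *)
Lemma hol_pt_local z : D z -> nbhs z [set w | hol_pt w <-> hol_pt z].
Proof.
move=> Dz; have [_ Fc Fs Fi] := F_iso.
have [c ac cz] := atlas_cover (F z).
set f := cfun c \o F.
have iso w : D w -> cdom c (F w) -> 0 < lam w /\ 0 < g c (f w).
  by move=> Dw cw; split; [exact: lam_gt0|apply: dens_gt0 => //; exact: cfun_crng].
have hiff w : D w -> cdom c (F w) -> hol_pt w <-> 0 < jac f w.
  move=> Dw cw; have [l0 m0] := iso w Dw cw; have hi := Fi c w ac Dw cw.
  split; first by move=> /(_ c ac cw); exact: (jac_cdiff l0 m0 hi).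
  by move=> /(conformal_pos l0 m0 hi); exact: hol_pt1.
have hN : nbhs z (D `&` F @^-1` cdom c).
  apply: filterI; first by apply: open_nbhs_nbhs; split => //; exact: punctured_disk_open.
  by apply: (Fc _ Dz); apply: open_nbhs_nbhs; split => //; exact: cdom_open.
have Nz : (D `&` F @^-1` cdom c) z by [].
have cj : {for z, continuous (jac f)}.
  have d1 : {for z, continuous ('D_(1, 0) f)}.
    exact: differentiable_continuous (Fs c ac [:: (1, 0)] z Nz).
  have d2 : {for z, continuous ('D_(0, 1) f)}.
    exact: differentiable_continuous (Fs c ac [:: (0, 1)] z Nz).
  have gen (h1 h2 : plane R -> plane R) : {for z, continuous h1} ->
      {for z, continuous h2} ->
      {for z, continuous (fun w => (h1 w).1 * (h2 w).2 - (h1 w).2 * (h2 w).1)}.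
    move=> k1 k2.
    have a1 : {for z, continuous (fun w => (h1 w).1)}.
      by apply: continuous_comp k1 _; exact: cvg_fst.
    have a2 : {for z, continuous (fun w => (h1 w).2)}.
      by apply: continuous_comp k1 _; exact: cvg_snd.
    have b1 : {for z, continuous (fun w => (h2 w).1)}.
      by apply: continuous_comp k2 _; exact: cvg_fst.
    have b2 : {for z, continuous (fun w => (h2 w).2)}.
      by apply: continuous_comp k2 _; exact: cvg_snd.
    exact: cvgB (cvgM a1 b2) (cvgM a2 b1).
  exact: gen d1 d2.
have [l0 m0] := iso z Dz cz.
have jz := jac_neq0 l0 m0 (Fi c z ac Dz cz).
have hs := sign_stable cj jz.
apply: filterS (filterI hN hs) => w [[Dw cw] /= e].
apply: iff_trans (hiff w Dw cw) (iff_trans _ (iff_sym (hiff z Dz cz))).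
exact: (eq_ind _ (fun b : bool => 0 < jac f w <-> b) (iff_refl _) _ e).
Qed.

Lemma hol_pt_segment z w : D z -> (forall t : R, 0 <= t <= 1 -> D (z + t *: (w - z))) ->
  hol_pt z -> hol_pt w.
Proof.
move=> Dz Dt hz.
(* The clamp onto [[0, 1]] extends the segment to a path over the whole line, as [locally_constant]
   asks. *)
pose cl : R -> R := (fun=> 0) \max ((fun=> 1) \min id).
have cl_in t : 0 <= cl t <= 1 by rewrite /cl /= le_max lexx/= ge_max ler01/= ge_min lexx.
have cl0 : cl 0 = 0 by rewrite /cl /= (min_idPr ler01) maxxx.
have cl1 : cl 1 = 1 by rewrite /cl /= minxx; exact: max_idPr ler01.
have ccl : continuous cl.
  move=> t; apply: continuous_max; first exact: cst_continuous.
  by apply: continuous_min; [exact: cst_continuous|move=> ?].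
pose gam t := z + cl t *: (w - z).
have cgam : continuous gam.
  move=> t; apply: cvgD; first exact: cvg_cst.
  by apply: cvgZ; [exact: ccl|exact: cvg_cst].
have := @locally_constant (hol_pt \o gam) _ 0 1.
have ew : z + (w - z) = w by rewrite addrC subrK.
rewrite /= /gam cl0 cl1 scale0r addr0 scale1r ew; apply => // t.
have := cgam t _ (hol_pt_local (Dt _ (cl_in t))).
move=> /nbhs_ballP[d /= d0 hd]; exists d => // s; rewrite distrC.
exact: hd.
Qed.
End Map.

(** The punctured disk is not convex, but its part in an open half plane bounded by a line through
    [0] is. *)
Lemma halfdisk_segment (a b : R) (z w : plane R) : D z -> D w ->
  0 < a * z.1 + b * z.2 -> 0 < a * w.1 + b * w.2 ->
  forall t : R, 0 <= t <= 1 -> D (z + t *: (w - z)).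
Proof.
move=> /= /andP[z0 zr] /andP[w0 wr] hz hw t t01; apply/andP; split; last first.
  rewrite !modulusE in zr wr *; have := @seg_disc _ 0 r (tc z) (tc w) t.
  rewrite !subr0 => /(_ zr wr t01); congr (nc _ < _).
  by case: (z) (w) => [? ?] [? ?]; apply/eqP; rewrite eq_complex /= /GRing.scale /=;
    apply/andP; split; apply/eqP; ring.
rewrite modulusE nc_gt0; apply/eqP => e.
have e0 : z + t *: (w - z) = 0 by apply: tc_inj; rewrite e.
have : 0 < a * (z + t *: (w - z)).1 + b * (z + t *: (w - z)).2.
  have -> : a * (z + t *: (w - z)).1 + b * (z + t *: (w - z)).2 =
    (1 - t) * (a * z.1 + b * z.2) + t * (a * w.1 + b * w.2).
    by case: (z) (w) => [? ?] [? ?]; rewrite /= /GRing.scale /=; ring.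
  have [->|tn] := eqVneq t 0; first by rewrite mul0r addr0 subr0 mul1r.
  case/andP: t01 => t0 t1; have t10 : 0 <= 1 - t by rewrite subr_ge0.
  by apply: (ltr_wpDl (mulr_ge0 t10 (ltW hz))); rewrite mulr_gt0// lt_def tn.
by rewrite e0 /= !mulr0 addr0 ltxx.
Qed.

Lemma hol_pt_all F : is_isometry D lam g U F ->
  forall z w, D z -> D w -> hol_pt F z -> hol_pt F w.
Proof.
move=> Fi; have r0 : 0 < r by case/andP: r01.
have half a b z w : D z -> D w -> 0 < a * z.1 + b * z.2 ->
    0 < a * w.1 + b * w.2 -> hol_pt F z -> hol_pt F w.
  by move=> Dz Dw h1 h2; apply: hol_pt_segment => //; exact: halfdisk_segment h1 h2.
(* Every point lies in one of the four open half planes cut by the axes. The right and upper ones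
   contain [(q, q)]; the left one meets the upper one at [(- q, q)], the lower one meets the right
   one at [(q, - q)]. *)
pose q := r / 4; have q0 : 0 < q by rewrite divr_gt0.
have Dq (x y : R) : `|x| = q -> `|y| = q -> D (x, y).
  move=> hx hy; rewrite -[D _]/(is_true (0 < nc (Complex x y) < r)).
  rewrite nc_gt0; apply/andP; split.
    apply/eqP => e; have x0 : x = 0 := congr1 (@complex.Re R) e.
    by move: q0; rewrite -hx x0 normr0 ltxx.
  apply: le_lt_trans (nc_le_ReIm (Complex x y)) _.
  rewrite -[complex.Re _]/x -[complex.Im _]/y hx hy /q; lra.
have nq : `|q| = q by rewrite gtr0_norm.
have nq' : `|- q| = q by rewrite normrN.
have q1 := Dq _ _ nq nq; have q2 := Dq _ _ nq' nq; have q3 := Dq _ _ nq nq'.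
suff key : forall z, D z -> hol_pt F z <-> hol_pt F (q, q).
  by move=> z w Dz Dw /(key z Dz) /(key w Dw).
have st a b z w : D z -> D w -> 0 < a * z.1 + b * z.2 -> 0 < a * w.1 + b * w.2 ->
    hol_pt F z <-> hol_pt F w.
  by move=> Dz Dw h1 h2; split; apply: (half a b).
move=> z Dz; case: (ltgtP z.1 0) => z1.
- apply: iff_trans (st (-1) 0 z (- q, q) Dz q2 _ _) _; rewrite /=; try lra.
  by apply: (st 0 1) => //=; lra.
- by apply: (st 1 0) => //=; lra.
- case: (ltgtP z.2 0) => z2.
  + apply: iff_trans (st 0 (-1) z (q, - q) Dz q3 _ _) _; rewrite /=; try lra.
    by apply: (st 1 0) => //=; lra.
  + by apply: (st 0 1) => //=; lra.
  + case/andP: Dz; rewrite modulusE nc_gt0 => z0 _; case/eqP: z0.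
    by apply/eqP; rewrite eq_complex /= z1 z2 !eqxx.
Qed.

(* Precomposing an orientation reversing isometry with complex conjugation makes it
   holomorphic. *)
Theorem holomorphic_isometry F : is_isometry D lam g U F -> exists F',
  [/\ set_bij D U F', forall z, D z -> {for z, continuous F'},
    forall c z, atlas S c -> D z -> cdom c (F' z) -> holomorphic_at (cfun c \o F') z &
    forall c z, atlas S c -> D z -> cdom c (F' z) ->
      isometric_at lam (g c) (cfun c \o F') z].
Proof.
move=> Fi; have [Fb Fc Fs Fiso] := Fi.
case: (pselect (exists2 z, D z & hol_pt F z)) => [[z0 Dz0 hz0]|nh].
  exists F; split => // c z ac Dz cz; apply/holomorphic_cdiff.
  exact: (hol_pt_all Fi Dz0 Dz hz0).
have Dconj z : D z -> D (conjp z).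
  by rewrite -[D (conjp z)]/(is_true (0 < modulus (conjp z) < r)) modulus_conjp.
have key c z : atlas S c -> D z -> cdom c (F (conjp z)) -> exists2 k,
    cder (fC (cfun c \o F \o conjp)) (tc z) k &
    g c (cfun c (F (conjp z))) * nc k = lam z.
  move=> ac Dz cz; have Dc := Dconj z Dz.
  have l0 := lam_gt0 Dc.
  have m0 : 0 < g c ((cfun c \o F) (conjp z)) by apply: dens_gt0 => //; exact: cfun_crng.
  have hi := Fiso c _ ac Dc cz.
  have jn : jac (cfun c \o F) (conjp z) < 0.
    have := jac_neq0 l0 m0 hi; rewrite neq_lt => /orP[//|jp].
    case: nh; exists (conjp z) => //.
    exact: (hol_pt1 Fi Dc ac cz (conformal_pos l0 m0 hi jp)).
  have [k hk ek] := conformal_neg l0 m0 hi jn; exists k.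
    by move: hk; rewrite conjpK.
  by rewrite ek /punctured_disk_density modulus_conjp.
exists (F \o conjp); split.
- case: Fb => h1 h2 h3; split.
  + by move=> z /Dconj /h1.
  + move=> z w; rewrite !inE => /Dconj Dz /Dconj Dw /= e.
    by apply: (can_inj conjpK); apply: h2; rewrite ?inE.
  + by move=> x /h3[z /Dconj Dz <-]; exists (conjp z) => //=; rewrite conjpK.
- move=> z /Dconj Dz; apply: continuous_comp; first exact: continuous_conjp.
  exact: Fc.
- by move=> c z ac Dz cz; apply/holomorphic_cdiff; have [k hk _] := key c z ac Dz cz; exists k.
- move=> c z ac Dz cz; have [k hk ek] := key c z ac Dz cz.
  exact/(isometric_cder _ _ hk).
Qed.
End Isometry.
End Orientation.

(** * Extending a punctured disk chart over the cusp *)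

Section CuspChart.
Variables (R : realType) (S Sc : riemannSurface R) (iota : S -> Sc).
Local Notation C := (R[i]).
Local Notation nc := (@Normc.normc R).
Local Notation tc := (@to_complex R).
Local Notation oc := (@of_complex R).
Hypothesis iota_hol : holomorphic iota.
Hypothesis iota_inj : injective iota.

Lemma punctured_diskE (r : R) z : punctured_disk r z = (0 < nc (tc z) < r) :> Prop.
Proof. by []. Qed.

Definition disk (r : R) : set (plane R) := [set z | modulus z < r].

Lemma disk_open r : open (disk r).
Proof.
rewrite openE => z zr; apply/nbhs_nhd.
have zr' : nc (tc z - 0) < r by rewrite subr0.
by apply: nhdS (nhd_disc zr') => w; rewrite subr0 /disk /= modulusE ocK.
Qed.

Lemma disk_punctured r z : disk r z -> z <> (0, 0) -> punctured_disk r z.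
Proof.
move=> zr z0; apply/andP; split => //; rewrite modulusE nc_gt0; apply/eqP => e.
by apply: z0; apply: tc_inj; rewrite e.
Qed.

Lemma punctured_neq0 (r : R) z : punctured_disk r z -> z <> (0, 0).
Proof.
move=> /andP[z0 _] e; move: z0; rewrite e modulusE.
by rewrite -[tc _]/(0 : C) nc0 ltxx.
Qed.

Variables (p : Sc) (r : R) (A' : chart R Sc) (F : plane R -> Sc).
Hypothesis r_gt0 : 0 < r.
Hypothesis A'_atlas : atlas Sc A'.
Hypothesis A'_crng : crng A' = punctured_disk r.
Hypothesis A'_cinv : cinv A' = F.
Hypothesis p_notin : ~ cdom A' p.
Hypothesis p_nbhs : nbhs p (cdom A' `|` [set p]).

Let Phi w := if w == (0, 0) then p else F w.
Let Phi0 : Phi (0, 0) = p. Proof. by rewrite /Phi eqxx. Qed.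
Let PhiE w : punctured_disk r w -> Phi w = F w.
Proof. by move=> /punctured_neq0 /eqP/negbTE h; rewrite /Phi h. Qed.
Let F_dom w : punctured_disk r w -> cdom A' (F w).
Proof. by rewrite -A'_crng -A'_cinv; exact: cinv_cdom. Qed.
Let FK w : punctured_disk r w -> cfun A' (F w) = w.
Proof. by rewrite -A'_crng -A'_cinv; exact: cinvK. Qed.

Let Phi_near w : punctured_disk r w -> nbhs w [set v | Phi v = F v].
Proof.
move=> Dw; have : nbhs w (punctured_disk r).
  by apply: open_nbhs_nbhs; split => //; exact: punctured_disk_open.
by apply: filterS => v; exact: PhiE.
Qed.

Section AtCusp.
Variable c : chart R Sc.
Hypothesis c_atlas : atlas Sc c.
Hypothesis c_p : cdom c p.

Let z0 := cfun c p.
Let f (w : C) : C := if w == tc z0 then 0 else tc (cfun A' (cinv c (oc w))).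
Let near_cusp (w : C) := [/\ crng c (oc w) & w != tc z0 -> cdom A' (cinv c (oc w))].

Let near_open : nhd (tc z0) near_cusp.
Proof.
have c0 : crng c z0 by exact: cfun_crng.
have n1 := open_nhd (@crng_open _ _ c) c0.
have ip : cinv c z0 = p by rewrite cfunK.
have : nbhs (cinv c z0) (cdom A' `|` [set p]) by rewrite ip.
move=> /(continuous_into (cinv_continuous c0)) n2.
apply: nhd2 n1 n2 _ => w cw h; split => // wz; case: h => //= e.
by case/eqP: wz; rewrite /z0 -e cinvK// ocK.
Qed.

Let f_diff w : w != tc z0 -> near_cusp w ->
  cdiff (fun w => tc (cfun A' (cinv c (oc w)))) w.
Proof.
move=> wz [cw /(_ wz) Aw]; have := atlas_holomorphic c_atlas A'_atlas cw Aw.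
by move/holomorphic_cdiff; rewrite ocK.
Qed.

Let f_small w : w != tc z0 -> near_cusp w ->
  0 < nc (tc (cfun A' (cinv c (oc w)))) < r.
Proof.
move=> wz [cw /(_ wz) Aw]; have := cfun_crng Aw.
by rewrite A'_crng.
Qed.

(* Removable singularity; the value at the cusp has modulus less than [r] by the
   maximum principle, and is not in the punctured disk because [cinv A'] is
   continuous there whereas [p] is not in its image. *)
Let f_hol : exists2 d : R, 0 < d & hol_on f (tc z0) d /\
  forall w, nc (w - tc z0) < d -> near_cusp w.
Proof.
have [d d0 hd] := near_open; exists d => //; split => //.
pose f0 w : C := tc (cfun A' (cinv c (oc w))).
have [||G hG Gf] := @removable_singularity R f0 (tc z0) d r d0.
- by move=> w /hd hw wz; exact: f_diff.
- by move=> w /hd hw wz; have /andP[_ /ltW] := f_small wz hw.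
have Glt : nc (G (tc z0)) < r.
  apply: (strict_max d0 hG) => w hw wz; rewrite (Gf w wz hw).
  by have /andP[_] := f_small wz (hd _ hw).
have G0 : G (tc z0) = 0.
  apply/eqP; apply: contrapT => /negP Gn.
  set u := oc (G (tc z0)).
  have Du : punctured_disk r u by rewrite punctured_diskE ocK nc_gt0 Gn.
  have pu : p != F u by apply/eqP => e; apply: p_notin; rewrite e; exact: F_dom.
  have := rs_hausdorff (r := Sc); rewrite open_hausdorff => /(_ _ _ pu).
  move=> [[P Q] /= [pP uQ] [oP oQ /eqP PQ]].
  rewrite !inE in pP uQ.
  have c0 : crng c z0 by exact: cfun_crng.
  have ip : cinv c z0 = p by rewrite cfunK.
  have n1 : nhd (tc z0) (fun w => P (cinv c (oc w))).
    apply: (continuous_into (cinv_continuous c0)).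
    by rewrite ip; exact: open_nbhs_nbhs.
  have Fc : {for u, continuous F} by rewrite -A'_cinv; apply: cinv_continuous; rewrite A'_crng.
  have n2 : nhd (G (tc z0)) (fun w => Q (F (oc w))).
    rewrite -[G _]ocK; apply: (continuous_into Fc); exact: open_nbhs_nbhs.
  have n3 := ccont_nhd (cdiff_cont (hol_self d0 hG)) n2.
  have [e e0 he] := nhdI n1 n3.
  pose m := Num.min d e; have m0 : 0 < m by rewrite lt_min d0.
  pose w := tc z0 + Complex (m / 2) 0.
  have wn : nc (w - tc z0) = m / 2.
    by rewrite /w addrC addKr nc_real ger0_norm// divr_ge0// ltW.
  have wz : w != tc z0 by rewrite -subr_eq0 -nc_eq0 wn gt_eqF// divr_gt0.
  have : nc (w - tc z0) < m by rewrite wn; lra.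
  rewrite lt_min => /andP[wd we].
  have [hP hQ] := he _ we.
  rewrite (Gf w wz wd) /f0 tcK -A'_cinv cfunK in hQ; last by case: (hd _ wd) => _ /(_ wz).
  have : (P `&` Q) (cinv c (oc w)) by [].
  by rewrite PQ.
move=> w hw; have [->|wz] := eqVneq w (tc z0).
  apply: cdiff_near (hol_self d0 hG); exists d => // v hv.
  by rewrite /f; case: eqVneq => [->//|vz]; rewrite Gf.
apply: cdiff_near (f_diff wz (hd _ hw)); apply: nhdS (nhd_neq wz) => v vz.
by rewrite /f (negbTE vz).
Qed.

Let inv_f w : near_cusp w -> fC (cfun c \o Phi) (f w) = w.
Proof.
move=> hw; rewrite /f; case: eqVneq => [->|wz].
  by rewrite /fC /= -[oc 0]/(0, 0) Phi0.
have /andP[h1 h2] := f_small wz hw; case: hw => cw /(_ wz) Aw.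
rewrite /fC /= tcK PhiE.
  by rewrite -A'_cinv cfunK// cinvK// ocK.
exact/andP.
Qed.

(** Holomorphy of [Phi] at [0] is not checked directly: read in the chart [c], [Phi] is the inverse
    of the injective holomorphic map [f], so the theory of inverses applies. *)
Let f_inv_at_cusp : nhd 0 (fun v => exists w, [/\ near_cusp w, f w = v & Phi (oc v) = cinv c (oc w)]) /\
  cdiff (fC (cfun c \o Phi)) 0.
Proof.
have [d d0 [hf hd]] := f_hol.
pose D (w : C) := nc (w - tc z0) < d.
have D_open w : D w -> nhd w D by exact: nhd_disc.
have DK w : D w -> fC (cfun c \o Phi) (f w) = w by move=> /hd; exact: inv_f.
have Dz : D (tc z0) by rewrite /D subrr nc0.
have f0 : f (tc z0) = 0 by rewrite /f eqxx.
split; last by have := inj_hol_inv_cdiff D_open hf DK Dz; rewrite f0.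
have := inj_hol_open D_open hf DK Dz (nhdT (tc z0) (P := fun=> True) (fun=> Logic.I)).
rewrite f0; apply: nhdS => v [w [Dw _ <-]]; exists w; split => //; first exact: hd.
have [cw Aw] := hd _ Dw; rewrite /f; case: eqVneq => [->|wz].
  by rewrite -[oc 0]/(0, 0) Phi0 tcK cfunK.
have /andP[h1 h2] := f_small wz (hd _ Dw).
rewrite tcK PhiE; first by rewrite -A'_cinv cfunK//; exact: Aw.
exact/andP.
Qed.

Lemma cusp_param_hol : holomorphic_at (cfun c \o Phi) (0, 0).
Proof. by apply/holomorphic_cdiff; exact: f_inv_at_cusp.2. Qed.

Lemma cusp_param_cont : {for (0, 0), continuous Phi}.
Proof.
have [hn /cdiff_cont] := f_inv_at_cusp; rewrite -[0 : C]/(tc (0, 0)).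
move=> /continuous_ccont ch P; rewrite Phi0 => hP.
have ip : cinv c (cfun c p) = p by rewrite cfunK.
have hP' : nbhs (cinv c ((cfun c \o Phi) (0, 0))) P by rewrite /= Phi0 ip.
have c0 : crng c ((cfun c \o Phi) (0, 0)) by rewrite /= Phi0; exact: cfun_crng.
have := ch _ (cinv_continuous c0 hP') => /nbhs_nhd h1.
apply/nbhs_nhd; apply: nhd2 hn h1 _ => v [w [[cw _] _ e]] /=.
by rewrite e cinvK// => h; rewrite e.
Qed.
End AtCusp.

Theorem cusp_disk_chart : exists B : chart R Sc,
  [/\ atlas Sc B, crng B = disk r, cdom B = cdom A' `|` [set p],
      cinv B (0, 0) = p & forall w, punctured_disk r w -> cinv B w = F w].
Proof.
have [||||B [aB B1 B2 B3]] := @chart_of_param R Sc (disk r) Phi.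
- exact: disk_open.
- move=> z w Dz Dw; rewrite /Phi; case: eqVneq => [->|z0]; case: eqVneq => [->|w0] //.
  + by move=> e; case: p_notin; rewrite e; apply: F_dom; apply: disk_punctured => //; exact/eqP.
  + by move=> e; case: p_notin; rewrite -e; apply: F_dom; apply: disk_punctured => //; exact/eqP.
  + move=> e; have h1 := disk_punctured Dz (elimN eqP z0).
    have h2 := disk_punctured Dw (elimN eqP w0).
    by rewrite -(FK h1) e FK.
- move=> z Dz; have [->|/eqP z0] := eqVneq z (0, 0).
    by have [c ac cp] := atlas_cover p; exact: cusp_param_cont ac cp.
  have Pz := disk_punctured Dz z0.
  have cF : {for z, continuous F} by rewrite -A'_cinv; apply: cinv_continuous; rewrite A'_crng.
  move=> P; rewrite (PhiE Pz) => /cF; move: (Phi_near Pz) => h1 h2.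
  by apply: filterS (filterI h1 h2) => v [/= -> ].
- move=> c z ac Dz; have [->|/eqP z0] := eqVneq z (0, 0).
    by rewrite Phi0 => cp; exact: cusp_param_hol.
  have Pz := disk_punctured Dz z0; rewrite (PhiE Pz) => cz.
  have := atlas_holomorphic A'_atlas ac (z := z); rewrite A'_crng A'_cinv.
  move=> /(_ Pz cz) /holomorphic_cdiff h; apply/holomorphic_cdiff; apply: cdiff_near h.
  have /nbhs_nhd := Phi_near Pz; apply: nhdS => w /= e.
  by rewrite /fC /= e.
exists B; split => //.
- rewrite B3; apply/seteqP; split => x.
    move=> [w Dw <-]; rewrite /Phi; case: eqVneq => [_|/eqP w0]; first by right.
    by left; apply: F_dom; exact: disk_punctured.
  move=> [Ax|->]; last first.
    by exists (0, 0) => //; rewrite -[disk _ _]/(is_true (nc 0 < r)) nc0.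
  have := cfun_crng Ax; rewrite A'_crng => Px; exists (cfun A' x).
    by case/andP: Px.
  by rewrite (PhiE Px) -A'_cinv cfunK.
- by rewrite B2.
- by move=> w; rewrite B2; exact: PhiE.
Qed.
End CuspChart.

(** * Hyperbolic area of a strip *)

Section StripIntegral.
Variable R : realType.
Local Notation mu := (@lebesgue_measure R).

Lemma integral_invsqr (L : R) : 0 < L ->
  (\int[mu]_(s in `]L, +oo[) ((s ^+ 2)^-1)%:E = (L^-1)%:E)%E.
Proof.
move=> L0.
have cinv (x : R) : L <= x -> {for x, continuous (fun s : R => (s ^+ 2)^-1)}.
  move=> Lx; apply: cvgV; first by rewrite sqrf_eq0 gt_eqF// (lt_le_trans L0).
  exact: exprn_continuous.
rewrite integral_itv_obnd_cbnd; last first.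
  apply/measurable_EFinP; apply: open_continuous_measurable_fun.
    exact: interval_open.
  by move=> x; rewrite inE /= in_itv /= andbT => /ltW/cinv.
rewrite (@ge0_continuous_FTC2y _ (fun s => (s ^+ 2)^-1) (fun s => - s^-1) L 0).
- by rewrite -EFinB sub0r opprK.
- by move=> x _; rewrite invr_ge0 sqr_ge0.
- by apply: continuous_in_subspaceT => x; rewrite inE /= in_itv /= andbT => /cinv.
- rewrite -[X in _ --> X]oppr0; apply: cvgN; apply/(@gtr0_cvgV0 _ _ _ _ id).
    exact: nbhs_pinfty_gt.
  exact: cvg_id.
- by move=> x Lx; apply: derivableN; apply: derivableV => //; rewrite gt_eqF// (lt_trans L0).
- apply: cvgN; apply: cvgV; first by rewrite gt_eqF.
  exact: cvg_at_right_filter cvg_id.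
- move=> x; rewrite in_itv /= andbT => Lx.
  have x0 : x != 0 by rewrite gt_eqF// (lt_trans L0).
  rewrite derive1E deriveN; last exact: derivableV.
  rewrite deriveV// derive_id.
  by rewrite scaleNr opprK /GRing.scale /= mulr1.
Qed.

(** The integrand is the area element of the cusp in logarithmic coordinates; Tonelli separates the
    variables. *)
Lemma integral_strip (L : R) (J : set (measurableTypeR R)) : 0 < L -> measurable J ->
  (\int[mu \x mu]_(z in ([set` `]L, +oo[%R] : set (measurableTypeR R)) `*` J) ((z.1 ^+ 2)^-1)%:E
   = mu J * (L^-1)%:E)%E.
Proof.
move=> L0 mJ.
set I : set (measurableTypeR R) := [set` `]L, +oo[%R].
have mI : measurable I by exact: measurable_itv.
pose ff (z : measurableTypeR R * measurableTypeR R) : \bar R :=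
  ((((fun s => (s ^+ 2)^-1) \_ I) z.1) * \1_J z.2)%:E.
have h0 (x : R) : 0 <= ((fun s : R => (s ^+ 2)^-1) \_ I) x.
  by rewrite patchE; case: ifP => // _; rewrite invr_ge0 sqr_ge0.
have mh : measurable_fun setT ((fun s : R => (s ^+ 2)^-1) \_ I).
  apply/(measurable_restrictT _ mI) => //.
  apply: open_continuous_measurable_fun; first exact: interval_open.
  move=> x; rewrite inE /I /= in_itv /= andbT => Lx.
  apply: cvgV; first by rewrite sqrf_eq0 gt_eqF// (lt_trans L0).
  exact: exprn_continuous.
rewrite integral_mkcond (_ : _ \_ _ = ff); last first.
  apply/funext => -[x y]; rewrite /ff !patchE /= indicE.
  have -> : ((x, y) \in I `*` J) = (x \in I) && (y \in J).
    by rewrite in_setX.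
  by case: (x \in I); case: (y \in J); rewrite /= ?mulr1 ?mulr0 ?mul0r.
have mff : measurable_fun setT ff.
  apply/measurable_EFinP; apply: measurable_funM.
    exact: measurableT_comp.
  by apply: measurableT_comp => //; exact: measurable_indic.
have ff0 z : (0 <= ff z)%E by rewrite lee_fin mulr_ge0.
rewrite (fubini_tonelli1 _ mff ff0).
under eq_integral => x _.
  rewrite /fubini_F /ff /=.
  under eq_integral do rewrite EFinM.
  rewrite ge0_integralZl ?lee_fin//; last first.
    by apply/measurable_EFinP; exact: measurable_indic.
  rewrite integral_indic// setIT muleC.
  over.
rewrite ge0_integralZl//; last first.
- by move=> x _; rewrite lee_fin; exact: h0.
- exact/measurable_EFinP.
congr (_ * _)%E; rewrite -(integral_invsqr L0) [RHS]integral_mkcond.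
by apply: eq_integral => x _; rewrite !patchE; case: ifP.
Qed.
End StripIntegral.

(** * Area of a horocyclic neighbourhood *)

Section HorocyclicArea.
Variable R : realType.
Local Notation C := (R[i]).
Local Notation nc := (@Normc.normc R).
Local Notation tc := (@to_complex R).
Local Notation oc := (@of_complex R).
Local Notation lam := (@punctured_disk_density R).
Local Notation mu := (@lebesgue_measure R).

Lemma cos_eq1_small (x : R) : `|x| < 2 * pi -> cos x = 1 -> x = 0.
Proof.
wlog x0 : x / 0 <= x.
  move=> H; have [/H//|/ltW xn] := leP 0 x.
  move=> h1 h2; apply/eqP; rewrite -oppr_eq0; apply/eqP; apply: H.
  - by rewrite oppr_ge0.
  - by rewrite normrN.
  - by rewrite cosN.
rewrite ger0_norm// => x2 c1; apply/eqP; move: x0; rewrite le_eqVlt eq_sym.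
case/orP => // x0; exfalso.
have s0 : 0 < sin (x / 2) by apply: sin_gt0_pi; apply/andP; split; lra.
have := cos_mulr2n (x / 2); have -> : (x / 2) *+ 2 = x by rewrite mulr2n; lra.
rewrite c1.
have := cos2Dsin2 (x / 2); have : 0 < sin (x / 2) ^+ 2 by rewrite exprn_gt0.
lra.
Qed.

Lemma cis_inj (s t : R) : `|s - t| < 2 * pi -> cis s = cis t -> s = t.
Proof.
move=> h e; apply/eqP; rewrite -subr_eq0; apply/eqP/cos_eq1_small => //.
rewrite cosB; case: e => -> ->; rewrite -!expr2; exact: cos2Dsin2.
Qed.

(** The angle is written [- t] to match [horo_exp], which turns clockwise as [v.2] grows. *)
Lemma polar (z : C) : z != 0 -> exists2 t : R, - pi <= t <= pi &
  z = Complex (nc z) 0 * cis (- t).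
Proof.
move=> z0; have n0 : 0 < nc z by rewrite nc_gt0.
pose a := complex.Re z / nc z; pose b := complex.Im z / nc z.
have ab : a ^+ 2 + b ^+ 2 = 1.
  by rewrite !expr_div_n -mulrDl -sqr_nc divff// sqrf_eq0 gt_eqF.
have a1 : -1 <= a <= 1 by rewrite -ler_norml -(@ler_pXn2r _ 2)// ?nnegrE// expr1n real_normK ?num_real// -ab lerDl sqr_ge0.
have sa : sin (acos a) = `|b| by rewrite sin_acos// -ab addrC addKr sqrtr_sqr.
have ez (t : R) : cos t = a -> sin t = - b -> z = Complex (nc z) 0 * cis (- t).
  move=> ct st; have ea : nc z * a = complex.Re z by rewrite mulrC divfK// gt_eqF.
  have eb : nc z * b = complex.Im z by rewrite mulrC divfK// gt_eqF.
  rewrite /cis cosN sinN ct st opprK; apply/eqP; rewrite eq_complex.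
  by apply/andP; split; apply/eqP; rewrite -[nc z]/(nc z) -?ea -?eb /=; ring.
have [b0|b0] := leP b 0.
  exists (acos a); first by rewrite acos_lepi// (le_trans _ (acos_ge0 a1))// oppr_le0 pi_ge0.
  by apply: ez; rewrite ?acosK ?in_itv//= sa ler0_norm.
exists (- acos a); first by rewrite lerN2 acos_lepi//= (le_trans _ (pi_ge0 R))// oppr_le0 acos_ge0.
by apply: ez; rewrite ?cosN ?sinN ?acosK ?in_itv//= sa gtr0_norm.
Qed.

(* Logarithmic coordinates: the punctured disk of radius [r] is the image of the half plane
   [v.1 > - ln r], on which the pulled back density is [1 / v.1]. *)
Definition horo_exp (v : plane R) : plane R := oc (cexp (- tc v)).

Lemma cder_horo_exp v : cder (fC horo_exp) (tc v) (- cexp (- tc v)).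
Proof.
have h := cderN (@cder_id _ (tc v)).
have := cder_comp h (cder_cexp (- tc v)); rewrite mulrN1; apply: cder_near.
by apply: nhdT => w; rewrite /fC /horo_exp /= !ocK.
Qed.

Lemma modulus_horo_exp v : modulus (horo_exp v) = expR (- v.1).
Proof. by rewrite modulusE ocK nc_cexp. Qed.

Variables (S : riemannSurface R) (g : conformalMetric S) (r : R) (A : chart R S).
Hypothesis r01 : 0 < r < 1.
Hypothesis A_atlas : atlas S A.
Hypothesis A_crng : crng A = punctured_disk r.
Hypothesis A_dens : forall w, punctured_disk r w -> g A w = lam w.

Let L := - ln r.
Let L_gt0 : 0 < L. Proof. by rewrite oppr_gt0 ln_lt0. Qed.
Let r_gt0 : 0 < r. Proof. by case/andP: r01. Qed.

Let exp_in v : L < v.1 -> punctured_disk r (horo_exp v).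
Proof.
move=> Lv; apply/andP; rewrite modulus_horo_exp expR_gt0; split => //.
by rewrite -[r in X in _ < X]lnK// ltr_expR; move: Lv; rewrite /L; lra.
Qed.

Definition strip (a : R) : set (plane R) :=
  [set v | L < v.1 /\ a < v.2 < a + 2 * pi].

Let strip_open a : open (strip a).
Proof.
have -> : strip a = [set v | L < v.1] `&` ([set v | a < v.2] `&` [set v | v.2 < a + 2 * pi]).
  by apply/seteqP; split => v /= [? ]; [case/andP|case=> ? ?; split => //; exact/andP].
have o1 (B : set R) : open B -> open [set v : plane R | B v.1].
  by move=> oB; apply: (@open_comp _ _ fst B) => // v _; exact: cvg_fst.
have o2 (B : set R) : open B -> open [set v : plane R | B v.2].
  by move=> oB; apply: (@open_comp _ _ snd B) => // v _; exact: cvg_snd.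
apply: openI; first exact: (o1 _ (@open_gt R L)).
by apply: openI; [exact: (o2 _ (@open_gt R a))|exact: (o2 _ (@open_lt R (a + 2 * pi)))].
Qed.

(** The height [2 pi] keeps [horo_exp] injective on the open strip. The density [lam] at
    [horo_exp v], multiplied by the modulus [expR (- v.1)] of the derivative, simplifies to the
    reciprocal of [v.1]. *)
Lemma strip_chart a : exists Q : chart R S,
  [/\ atlas S Q, crng Q = strip a, cinv Q = cinv A \o horo_exp &
      forall v, strip a v -> g Q v = (v.1)^-1].
Proof.
have A_cont v : L < v.1 -> {for horo_exp v, continuous (cinv A)}.
  by move=> Lv; apply: cinv_continuous; rewrite A_crng; exact: exp_in.
have e_cont v : {for v, continuous horo_exp}.
  by apply/continuous_ccont/(cder_cont (cder_horo_exp v)).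
have [||||Q [aQ Q1 Q2 Q3]] := @chart_of_param R S (strip a) (cinv A \o horo_exp).
- exact: strip_open.
- move=> v w [Lv /andP[v1 v2]] [Lw /andP[w1 w2]] /= e.
  have : horo_exp v = horo_exp w.
    rewrite -(@cinvK _ _ A (horo_exp v)) ?A_crng; last exact: exp_in.
    by rewrite e cinvK// A_crng; exact: exp_in.
  move=> /(congr1 tc); rewrite /horo_exp !ocK => E.
  have E1 : v.1 = w.1.
    have := congr1 nc E; rewrite !nc_cexp => /expR_inj /oppr_inj; exact.
  have E2 : v.2 = w.2.
    move: E; rewrite /cexp /= E1 => /mulfI; rewrite -nc_eq0 nc_real normr_eq0 gt_eqF ?expR_gt0// => /(_ isT) /cis_inj.
    move=> H; apply/oppr_inj/H; rewrite ltr_norml; apply/andP; split; lra.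
  by move: E1 E2; case: (v) (w) => [? ?] [? ?] /= -> ->.
- move=> v [Lv _]; apply: continuous_comp; [exact: e_cont|exact: A_cont].
- move=> c v ac [Lv _] cv; apply/holomorphic_cdiff.
  have hA : crng A (horo_exp v) by rewrite A_crng; exact: exp_in.
  have /holomorphic_cdiff h := atlas_holomorphic A_atlas ac hA cv.
  have h' : cdiff (fC horo_exp) (tc v) by eexists; exact: cder_horo_exp.
  have h2 : cdiff (fC (cfun c \o cinv A)) (fC horo_exp (tc v)) by rewrite fCE.
  apply: cdiff_near (cdiff_comp h' h2); apply: nhdT => w.
  by rewrite /fC /= tcK.
exists Q; split => // v sv; have [Lv _] := sv.
have Qv : crng Q v by rewrite Q1.
have Av : crng A (horo_exp v) by rewrite A_crng; exact: exp_in.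
have cA : cdom A (cinv Q v) by rewrite Q2; exact: cinv_cdom.
have h := dens_transition g aQ A_atlas Qv cA.
have near : nhd (tc v) (fun w => fC horo_exp w = fC (cfun A \o cinv Q) w).
  have sn : nhd (tc v) (fun w => strip a (oc w)) by apply: open_nhd.
  apply: nhdS sn => w [Lw _].
  by rewrite /fC /= Q2 /= cinvK// A_crng; exact: exp_in.
have hd := cder_near near (cder_horo_exp v).
have e : (cfun A \o cinv Q) v = horo_exp v by rewrite Q2 /= cinvK.
have := (isometric_cder _ _ hd).1 h; rewrite e.
rewrite A_dens; last exact: exp_in.
rewrite /punctured_disk_density modulus_horo_exp ncN nc_cexp -[complex.Re _]/(- v.1) expRK => <-.
have v0 : 0 < v.1 by rewrite (lt_trans L_gt0).
rewrite normrM normrN !gtr0_norm ?expR_gt0// invfM mulrC mulrA mulfV ?mul1r//.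
by rewrite gt_eqF// expR_gt0.
Qed.

(** Since [area] is an infimum over covers, a single cover gives an upper bound, and an upper bound
    is what a lower estimate of the radius calls for. *)
Lemma area_horocyclic : (area g (cdom A) <= (2 * pi / L)%:E)%E.
Proof.
have [Q [aQ Q1 Q2 Q3]] := strip_chart (- pi).
have [P [aP P1 P2 P3]] := strip_chart 0.
pose T := (measurableTypeR R * measurableTypeR R)%type.
pose I : set (measurableTypeR R) := [set` `]L, +oo[%R].
pose J0 : set (measurableTypeR R) := [set` `](- pi : R), pi[%R].
pose J1 : set (measurableTypeR R) := [set pi].
(* The strip around angle [0] misses one ray; a half line of measure zero covers it through the
   chart [P], in whose strip the angle [pi] is interior. The remaining sets are empty. *)
pose K (n : nat) : set (plane R) :=
  if n is 0%N then I `*` J0 else if n is 1%N then I `*` J1 else set0.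
pose c (n : nat) := if n is 0%N then Q else P.
have mI : measurable I by exact: measurable_itv.
have mJ0 : measurable J0 by exact: measurable_itv.
have mJ1 : measurable J1 by exact: measurable_set1.
have pp := pi_gt0 R.
have K0 v : K 0%N v -> strip (- pi) v.
  rewrite /K /I /J0 /= !in_itv /= andbT => -[Lv /andP[v1 v2]]; split => //.
  apply/andP; split => //; lra.
have K1 v : K 1%N v -> strip 0 v.
  rewrite /K /I /J1 /= !in_itv /= andbT => -[Lv e]; split => //; rewrite e; lra.
apply: ereal_inf_lbound; exists c, K; split.
- by case.
- case => [|[|n]].
  + exact: (measurableX mI mJ0).
  + exact: (measurableX mI mJ1).
  + exact: measurable0.
- case => [|[|n]] v //.
  + by move=> /K0; rewrite /= Q1.
  + by move=> /K1; rewrite /= P1.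
- move=> x Ax; have := cfun_crng Ax; rewrite A_crng => Dw.
  set w := cfun A x in Dw.
  have w0 : tc w != 0 by rewrite -nc_gt0; case/andP: Dw.
  have [t tpi wE] := polar w0.
  have n0 : 0 < nc (tc w) by rewrite nc_gt0.
  pose v (u : R) : plane R := (- ln (nc (tc w)), u).
  have Lv u : L < (v u).1.
    by rewrite /= ltrN2 ltr_ln// ; case/andP: Dw.
  have vE : horo_exp (v t) = w.
    by apply: tc_inj; rewrite ocK wE /cexp /= opprK lnK.
  have xE : cinv A (horo_exp (v t)) = x by rewrite vE cfunK.
  have [tp|tp] := boolP (`|t| < pi).
    exists 0%N => //; exists (v t); last by rewrite /= Q2.
    split; rewrite /I /J0 /= in_itv /= ?andbT; [exact: Lv|by rewrite -ltr_norml].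
  exists 1%N => //; exists (v pi).
    split; last by [].
    by rewrite /I /= in_itv /= andbT; exact: Lv.
  rewrite /= P2 /= -xE; congr (cinv A _).
  (* Both ends of the angular interval stand for the missing ray. *)
  have : t = pi \/ t = - pi.
    have tp' : `|t| = pi.
      by apply/eqP; rewrite eq_le ler_norml tpi leNgt.
    by have := eqVneq t pi; case: (leP 0 t) tp' => t0; [rewrite ger0_norm|rewrite ltr0_norm]=> // e; [left|right; rewrite -e opprK].
  case=> -> //; apply: tc_inj; rewrite !ocK /cexp /=; congr (_ * _).
  by rewrite opprK /cis cosN sinN cospi sinpi oppr0.
- rewrite (nneseries_split 0 1); last first.
    by move=> k _; apply: integral_ge0 => z _; rewrite lee_fin sqr_ge0.
  rewrite big_nat1 eseries0; last first.
    move=> [|[|n]] // _ _; last by rewrite integral_set0.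
    rewrite (@eq_integral _ _ _ (mu \x mu)%E _ (fun z => ((z.1 ^+ 2)^-1)%:E)).
      by rewrite /K (integral_strip L_gt0 mJ1) lebesgue_measure_set1 mul0e.
    by move=> z; rewrite inE => /K1/P3 /= ->; rewrite exprVn.
  rewrite adde0 (@eq_integral _ _ _ (mu \x mu)%E _ (fun z => ((z.1 ^+ 2)^-1)%:E)).
    rewrite /K (integral_strip L_gt0 mJ0) lebesgue_measure_itv /= lte_fin.
    by rewrite ifT; [rewrite -EFinB -EFinM; congr (_%:E); rewrite opprK; congr (_ / _); lra|lra].
  by move=> z; rewrite inE => /K0/Q3 /= ->; rewrite exprVn.
Qed.

Lemma radius_gt : ((2 * pi)%:E < area g (cdom A))%E -> expR (-1) < r.
Proof.
move=> /lt_le_trans/(_ area_horocyclic); rewrite lte_fin.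
have p2 : 0 < 2 * pi :> R by rewrite mulr_gt0// pi_gt0.
rewrite ltr_pdivlMr// gtr_pMr// /L => l1.
by rewrite -[r in X in _ < X]lnK// ltr_expR; lra.
Qed.
End HorocyclicArea.

Section HorocyclicModel.
Variables (R : realType) (S Sc : riemannSurface R) (iota : S -> Sc).
Variable g : conformalMetric S.
Local Notation lam := (@punctured_disk_density R).
Hypothesis iota_hol : holomorphic iota.
Hypothesis iota_inj : injective iota.

Theorem horocyclic_model (p : Sc) (U : set S) : ~ range iota p ->
  horocyclic_nbhs iota g p U -> exists (r : R) (A : chart R S) (B : chart R Sc),
  [/\ 0 < r < 1,
      [/\ atlas S A, crng A = punctured_disk r, cdom A = U &
          forall w, punctured_disk r w -> g A w = lam w] &
      [/\ atlas Sc B, crng B = disk r, cdom B = iota @` U `|` [set p],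
          cinv B (0, 0) = p &
          forall w, punctured_disk r w -> cinv B w = iota (cinv A w)]].
Proof.
move=> pn [hp [r [F [r01 /(holomorphic_isometry r01)[G [Gb Gc Gh Gi]]]]]].
have [||||A [aA A1 A2 A3]] := @chart_of_param R S (punctured_disk r) G.
- exact: punctured_disk_open.
- by move=> z w Dz Dw; case: Gb => _ h _; apply: h; rewrite inE.
- exact: Gc.
- exact: Gh.
have AU : cdom A = U.
  rewrite A3; case: Gb => h1 _ h2; apply/seteqP; split => x; last exact: h2.
  by move=> [z Dz <-]; exact: h1.
have [A' [aA' B1 B2 B3]] := push_chart iota_hol iota_inj aA.
rewrite AU in B3.
have [||||B [aB C1 C2 C3 C4]] :=
  @cusp_disk_chart R Sc p r A' (iota \o cinv A) _ aA' _ B2.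
- by case/andP: r01.
- by rewrite B1.
- by rewrite B3 => -[x _ e]; apply: pn; exists x.
- by rewrite B3.
exists r, A, B; split => //; split => //; last by rewrite C2 B3.
move=> w Dw; have cA : cdom A (G w) by rewrite AU; case: Gb => h _ _; exact: h.
(* In the chart [A], whose inverse is [G], the isometry reads as the identity, so being isometric
   means equality of densities. *)
have hid : cder (fC (cfun A \o G)) (to_complex w) 1.
  apply: cder_near (@cder_id _ _); have := open_nhd (@punctured_disk_open R r) Dw.
  apply: nhdS => v Dv; rewrite /fC /= -A2 cinvK ?ocK//.
  by rewrite A1.
have := (isometric_cder _ _ hid).1 (Gi A w aA Dw cA).
by rewrite nc1 mulr1 /= -A2 cinvK ?A1.
Qed.
End HorocyclicModel.

(** * Smooth densities *)

Section Smoothness.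
Variable R : realType.
Local Notation C := (R[i]).
Local Notation tc := (@to_complex R).
Local Notation oc := (@of_complex R).
Implicit Types (D : set (plane R)) (f q : plane R -> R) (z v : plane R).
Implicit Types (W : R -> R) (E : set R) (F : C -> C).

Lemma near_eq_is_diff (h k : plane R -> R) z : (\forall w \near z, h w = k w) ->
  differentiable h z -> differentiable k z.
Proof.
move=> hk dh; have /diff_locallyP[dc hexp] := dh.
have hz : h z = k z := nbhs_singleton hk.
have kexp : k \o shift z = cst (k z) + 'd h z +o_ (0 : plane R) id.
  apply/eqaddoP => e e0; move/eqaddoP: hexp => /(_ e e0) H.
  have hk0 : \forall w \near (0 : plane R), h (w + z) = k (w + z).
    by move: hk; rewrite (near_shift 0 z) /= subr0.
  apply: filterS (filterI H hk0) => w [/=].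
  rewrite -![(_ - _) w]/(_ w - _ w) /= -![(_ + _) w]/(_ w + _ w) /=.
  by rewrite hz => h1 <-.
have dE := diff_unique dc kexp.
by apply/diff_locallyP; rewrite dE.
Qed.

Lemma near_open D z (P : set (plane R)) : open D -> D z -> (forall w, D w -> P w) ->
  \forall w \near z, P w.
Proof.
move=> oD Dz h; have : nbhs z D by exact: open_nbhs_nbhs.
exact: filterS.
Qed.

Lemma is_derive_comp1 W q z v (w dq : R) : differentiable q z ->
  is_derive z v q dq -> is_derive (q z) 1 W w ->
  differentiable (W \o q) z /\ is_derive z v (W \o q) (w * dq).
Proof.
move=> dif hq hW.
have dW : differentiable W (q z) by apply/derivable1_diffP; case: hW.
have dWq : differentiable (W \o q) z by exact: differentiable_comp.
split => //; apply: DeriveDef; first exact: diff_derivable.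
rewrite deriveE// (diff_comp dif dW).
have -> : ('d W (q z) \o 'd q z) v = 'd W (q z) ('d q z v) by [].
rewrite -(deriveE _ dif).
have -> : 'D_v q z = dq by case: hq.
have -> : 'd W (q z) dq = dq *: 'd W (q z) 1 by rewrite -linearZ /GRing.scale /= mulr1.
rewrite -(deriveE _ dW); have -> : 'D_1 W (q z) = w by case: hW.
by rewrite /GRing.scale /= mulrC.
Qed.

Definition smooth1 E W := forall (n : nat) x, E x -> derivable (derive1n n W) x 1.

Lemma smooth1_derive E W : smooth1 E W -> smooth1 E (W^`())%classic.
Proof. by move=> h n x Ex; rewrite -derive1Sn; exact: h. Qed.

(** A class closed under directional derivatives up to equality on [D]: the product and chain rules
    stay inside it. Smoothness of composite expressions then follows by one induction over the list
    of directions, without formulas for higher derivatives. *)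
Inductive smooth_gen D : (plane R -> R) -> Prop :=
| gen_base f : smooth_on D (f : _ -> R^o) -> smooth_gen D f
| gen_add f q : smooth_gen D f -> smooth_gen D q -> smooth_gen D (fun z => f z + q z)
| gen_mul f q : smooth_gen D f -> smooth_gen D q -> smooth_gen D (fun z => f z * q z)
| gen_comp E W q : smooth1 E W -> (forall z, D z -> E (q z)) -> smooth_gen D q ->
    smooth_gen D (W \o q)
| gen_eq f q : (forall z, D z -> f z = q z) -> smooth_gen D f -> smooth_gen D q.

Section Closure.
Variable D : set (plane R).
Hypothesis D_open : open D.

Let gen_derive f : smooth_gen D f ->
  (forall z, D z -> differentiable (f : _ -> R^o) z) /\
  forall v, smooth_gen D ('D_v f).
Proof.
elim => {f} [f sf|f q _ [df gf] _ [dq gq]|f q sf [df gf] sq [dq gq]|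
  E W q sW hE sq [dq gq]|f q fq _ [df gf]].
- split; first exact: (sf [::]).
  by move=> v; apply: gen_base => vs z Dz; have := sf (rcons vs v) z Dz; rewrite foldr_rcons.
- split; first by move=> z Dz; apply: differentiableD; [exact: df|exact: dq].
  move=> v; apply: gen_eq (gen_add (gf v) (gq v)) => z Dz.
  by rewrite (deriveD (f := f) (g := q))//; apply: diff_derivable; [exact: df|exact: dq].
- split; first by move=> z Dz; apply: differentiableM; [exact: df|exact: dq].
  move=> v; apply: gen_eq (gen_add (gen_mul sf (gq v)) (gen_mul sq (gf v))) => z Dz.
  by rewrite (deriveM (f := f) (g := q))//; apply: diff_derivable; [exact: df|exact: dq].
- have hd z v : D z -> differentiable (W \o q) z /\
      is_derive z v (W \o q) ((W^`())%classic (q z) * 'D_v q z).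
    move=> Dz; apply: is_derive_comp1; first exact: dq.
      by apply: derivableP; apply: diff_derivable; exact: dq.
    by rewrite derive1E; apply: derivableP; exact: (sW 0%N _ (hE _ Dz)).
  split; first by move=> z /(hd z 0)[].
  move=> v; apply: gen_eq (gen_mul (gen_comp (smooth1_derive sW) hE sq) (gq v)) => z Dz.
  by have [_ [_ ->]] := hd z v Dz.
- have nfq z : D z -> \forall w \near z, f w = q w.
    by move=> Dz; exact: near_open D_open Dz fq.
  split; first by move=> z Dz; exact: near_eq_is_diff (nfq z Dz) (df z Dz).
  move=> v; apply: gen_eq (gf v) => z Dz; exact: near_eq_derive (nfq z Dz).
Qed.

Lemma smooth_genP f : smooth_gen D f -> smooth_on D (f : _ -> R^o).
Proof.
move=> gf vs z Dz; suff /gen_derive[h _] : smooth_gen D (foldr (fun v h => 'D_v h) f vs).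
  exact: h.
by elim: vs => [//|v vs /gen_derive[_ h]] /=.
Qed.
End Closure.

Lemma smooth_on_local D f : (forall z, D z -> exists N q, [/\ open N, N z,
    forall w, N w -> f w = q w & smooth_on N (q : _ -> R^o)]) ->
  smooth_on D (f : _ -> R^o).
Proof.
move=> h vs z /h[N [q [oN Nz fq sq]]].
have gf : smooth_gen N f by apply: gen_eq (gen_base sq) => w /fq.
exact: (smooth_genP oN gf).
Qed.

(* [reC F] ranges over real parts of holomorphic functions; imaginary parts are the
   real parts of [-i F]. *)
Definition reC F (z : plane R) : R := complex.Re (F (tc z)).

Lemma is_derive_reC F z c v : cder F (tc z) c ->
  differentiable (reC F) z /\ is_derive z v (reC F) (complex.Re (c * tc v)).
Proof.
move=> hF; pose G (w : plane R) := oc (F (tc w)).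
have hG : cder (fC G) (tc z) c.
  by apply: cder_near hF; apply: nhdT => w; rewrite /fC /G /= !ocK.
have dG := cder_differentiable hG.
have cf : continuous (fst : plane R -> R) by move=> w; exact: cvg_fst.
have df : differentiable (fst : plane R -> R) (G z) := linear_differentiable _ cf.
have d : differentiable (reC F) z.
  exact: (differentiable_comp dG df).
split => //; apply: DeriveDef; first exact: diff_derivable.
rewrite deriveE//.
have E := diff_comp dG df.
apply: (etrans (congr1 (fun T : plane R -> R => T v) E)).
have E' := congr1 (fun T : plane R -> R => T ('d G z v))
  (diff_lin (f := fst) (G z) cf).
by apply: (etrans E'); rewrite (cder_diffE v hG).
Qed.

(** The derivative of the real part of [F] in direction [v] is the real part of [cd F] times [v],
    and [cd F] is again holomorphic by [cd_cdiff], so the argument repeats. *)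
Lemma smooth_reC D F : open D -> (forall z, D z -> cdiff F (tc z)) ->
  smooth_on D (reC F : _ -> R^o).
Proof.
move=> oD hF vs.
have hol G : (forall z, D z -> cdiff G (tc z)) -> forall z, D z -> cdiff (cd G) (tc z).
  move=> hG z Dz; have [d d0 hd] := open_nhd oD Dz.
  by apply: (@cd_cdiff _ G _ d) => // w /hd /hG; rewrite ocK.
have : exists2 G, (forall z, D z -> cdiff G (tc z)) &
    forall z, D z -> foldr (fun v h => 'D_v h) (reC F) vs z = reC G z.
  elim: vs => [|v vs [G hG e]]; first by exists F.
  exists (fun w => cd G w * tc v) => [z Dz|z Dz].
    by apply: cdiffM; [exact: hol|exact: cdiff_cst].
  rewrite /= (near_eq_derive _ (near_open oD Dz e)).
  by have [_ [_ ->]] := is_derive_reC v (cdP (hG z Dz)).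
move=> [G hG e] z Dz; apply: (@near_eq_is_diff (reC G)).
  by apply: (near_open oD Dz) => w /e.
by have [] := is_derive_reC 0 (cdP (hG z Dz)).
Qed.
End Smoothness.

(** * The Laplacian of a function of the squared modulus *)

Section LaplacianRadial.
Variable R : realType.
Local Notation C := (R[i]).
Local Notation nc := (@Normc.normc R).
Local Notation tc := (@to_complex R).
Local Notation I := (Complex 0 1 : R[i]).
Implicit Types (f h : plane R -> R) (z v : plane R).

Definition imC (F : C -> C) : plane R -> R := reC (fun w => - I * F w).
Definition sqnorm (F : C -> C) z : R := reC F z * reC F z + imC F z * imC F z.

Lemma imCE F z : imC F z = complex.Im (F (tc z)).
Proof. by rewrite /imC /reC; case: (F _) => a b /=; ring. Qed.
Lemma sqnormE F z : sqnorm F z = nc (F (tc z)) ^+ 2.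
Proof. by rewrite /sqnorm imCE sqr_nc !expr2. Qed.

Lemma der_mul f h z v (a b : R) : is_derive z v f a -> is_derive z v h b ->
  is_derive z v (fun w => f w * h w) (f z * b + h z * a).
Proof. by move=> hf hh; have := is_deriveM hf hh. Qed.
Lemma der_add f h z v (a b : R) : is_derive z v f a -> is_derive z v h b ->
  is_derive z v (fun w => f w + h w) (a + b).
Proof. by move=> hf hh; have := is_deriveD hf hh. Qed.

Section Holomorphic.
Variables (D : set (plane R)) (F : C -> C).
Hypothesis D_open : open D.
Hypothesis F_hol : forall z, D z -> cdiff F (tc z).

Lemma cd_hol_plane z : D z -> cdiff (cd F) (tc z).
Proof.
move=> Dz; have [d d0 hd] := open_nhd D_open Dz.
by apply: (@cd_cdiff _ F _ d) => // w /hd /F_hol; rewrite ocK.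
Qed.

Let a := reC F.
Let b := imC F.
Let A v := reC (fun w => cd F w * tc v).
Let B v := reC (fun w => - I * (cd F w * tc v)).

Let der_a z v : D z -> is_derive z v a (A v z).
Proof. by move=> /F_hol/cdP/(is_derive_reC v)[]. Qed.
Let der_b z v : D z -> is_derive z v b (B v z).
Proof.
move=> /F_hol/cdP/(cderZ (- I))/(is_derive_reC v)[_].
by rewrite /B /reC mulrA.
Qed.
Let diff_q z : D z -> differentiable (sqnorm F) z.
Proof.
move=> Dz; have [da _] := is_derive_reC 0 (cdP (F_hol Dz)).
have [db _] := is_derive_reC 0 (cderZ (- I) (cdP (F_hol Dz))).
by apply: differentiableD; exact: differentiableM.
Qed.
Let dq v z := 2 * (a z * A v z + b z * B v z).
Let der_q z v : D z -> is_derive z v (sqnorm F) (dq v z).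
Proof.
move=> Dz; have h := der_a v Dz; have h' := der_b v Dz.
have := der_add (der_mul h h) (der_mul h' h').
by congr is_derive; rewrite /dq; ring.
Qed.
Let der_dq z v : D z -> is_derive z v (dq v)
  (2 * (A v z * A v z + B v z * B v z
    + a z * complex.Re (cd (cd F) (tc z) * tc v * tc v)
    + b z * complex.Im (cd (cd F) (tc z) * tc v * tc v))).
Proof.
move=> Dz; have h2 := cdP (cd_hol_plane Dz).
have h3 : cder (fun w => cd F w * tc v) (tc z) (cd (cd F) (tc z) * tc v).
  by have := cderM h2 (cder_cst (tc v) (tc z)); rewrite mulr0 addr0.
have [_ hA] := is_derive_reC v h3.
have [_ hB] := is_derive_reC v (cderZ (- I) h3).
have h := der_a v Dz; have h' := der_b v Dz.
have h4 := der_add (der_mul h hA) (der_mul h' hB).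
have h5 : is_derive z v (cst 2 : plane R -> R) 0 by exact: is_derive_cst.
have := der_mul h5 h4; congr is_derive; rewrite /cst /=.
set X := cd (cd F) _ * _ * _.
have -> : - I * (cd (cd F) (tc z) * tc v) * tc v = - I * X by rewrite -mulrA.
have -> : complex.Re (- I * X) = complex.Im X by case: (X) => ? ? /=; ring.
by rewrite mulr0 addr0; ring.
Qed.

Variables (E : set R) (W W1 W2 : R -> R).
Hypothesis q_in : forall z, D z -> E (sqnorm F z).
Hypothesis dW : forall x, E x -> is_derive x 1 W (W1 x).
Hypothesis dW1 : forall x, E x -> is_derive x 1 W1 (W2 x).

Let der_Wq z v : D z -> is_derive z v (W \o sqnorm F) (W1 (sqnorm F z) * dq v z).
Proof.
by move=> Dz; have [] := is_derive_comp1 (diff_q Dz) (der_q v Dz) (dW (q_in Dz)).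
Qed.
Let der_W1q z v : D z -> is_derive z v (W1 \o sqnorm F) (W2 (sqnorm F z) * dq v z).
Proof.
by move=> Dz; have [] := is_derive_comp1 (diff_q Dz) (der_q v Dz) (dW1 (q_in Dz)).
Qed.

Lemma radial_derive z v : D z -> is_derive z v ('D_v (W \o sqnorm F))
  (W1 (sqnorm F z) * (2 * (A v z * A v z + B v z * B v z
    + a z * complex.Re (cd (cd F) (tc z) * tc v * tc v)
    + b z * complex.Im (cd (cd F) (tc z) * tc v * tc v)))
  + dq v z * (W2 (sqnorm F z) * dq v z)).
Proof.
move=> Dz; apply: near_eq_is_derive (der_mul (der_W1q v Dz) (der_dq v Dz)).
by apply: (near_open D_open Dz) => w Dw; have [_ ->] := der_Wq v Dw.
Qed.

(** The second derivatives of [F] in the directions [1] and [I] are [F''] and [- F''], so they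
    cancel in the sum; the Cauchy-Riemann equations turn the remaining terms into multiples of the
    squared modulus of [F']. *)
Lemma laplacian_radial z : D z -> laplacian (W \o sqnorm F) z =
  4 * nc (cd F (tc z)) ^+ 2 *
    (sqnorm F z * W2 (sqnorm F z) + W1 (sqnorm F z)).
Proof.
move=> Dz; rewrite /laplacian.
have [_ ->] := radial_derive (1, 0) Dz; have [_ ->] := radial_derive (0, 1) Dz.
move: (W1 _) (W2 _) => w1 w2; rewrite /dq /sqnorm /A /B /a /b imCE /reC.
rewrite -[tc (1, 0)]/(1 : C) -[tc (0, 1)]/I !mulr1 sqr_nc.
case: (F _) (cd F _) (cd (cd F) _) => [a0 b0] [a1 b1] [a2 b2] /=; ring.
Qed.
End Holomorphic.
End LaplacianRadial.

(** * Smooth functions of one variable and cutoffs *)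

Section OneVariable.
Variable R : realType.
Implicit Types (E : set R) (f h W : R -> R) (x : R).

Inductive smooth1_gen E : (R -> R) -> Prop :=
| gen1_base f : smooth1 E f -> smooth1_gen E f
| gen1_add f h : smooth1_gen E f -> smooth1_gen E h -> smooth1_gen E (fun x => f x + h x)
| gen1_mul f h : smooth1_gen E f -> smooth1_gen E h -> smooth1_gen E (fun x => f x * h x)
| gen1_comp E' W h : smooth1 E' W -> (forall x, E x -> E' (h x)) -> smooth1_gen E h ->
    smooth1_gen E (W \o h)
| gen1_eq f h : (forall x, E x -> f x = h x) -> smooth1_gen E f -> smooth1_gen E h.

Lemma near_open1 E x (P : set R) : open E -> E x -> (forall y, E y -> P y) ->
  \forall y \near x, P y.
Proof.
move=> oE Ex h; have : nbhs x E by exact: open_nbhs_nbhs.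
exact: filterS.
Qed.

Lemma smooth1_derivable E f x : smooth1 E f -> E x -> is_derive x 1 f ((f^`())%classic x).
Proof. by move=> sf Ex; rewrite derive1E; apply: derivableP; exact: (sf 0%N _ Ex). Qed.

Let gen1_derive E f : open E -> smooth1_gen E f ->
  exists2 f', smooth1_gen E f' & forall x, E x -> is_derive x 1 f (f' x).
Proof.
move=> oE; elim => {f} [f sf|f h _ [f' gf df] _ [h' gh dh]|
  f h sf [f' gf df] sh [h' gh dh]|E' W h sW hE sh [h' gh dh]|f h fh _ [f' gf df]].
- exists (f^`())%classic; first by apply: gen1_base; exact: smooth1_derive.
  by move=> x; exact: smooth1_derivable.
- exists (fun x => f' x + h' x); first exact: gen1_add.
  by move=> x Ex; have := is_deriveD (df x Ex) (dh x Ex).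
- exists (fun x => f x * h' x + h x * f' x).
    by apply: gen1_add; exact: gen1_mul.
  by move=> x Ex; have := is_deriveM (df x Ex) (dh x Ex).
- exists (fun x => (W^`())%classic (h x) * h' x).
    by apply: gen1_mul gh; exact: (gen1_comp (smooth1_derive sW) hE sh).
  move=> x Ex; apply: is_derive1_comp (dh x Ex).
  by apply: smooth1_derivable (hE _ Ex).
- exists f' => // x Ex; apply: near_eq_is_derive (df x Ex).
  exact: near_open1 oE Ex fh.
Qed.

Lemma smooth1_genP E f : open E -> smooth1_gen E f -> smooth1 E f.
Proof.
move=> oE gf n; suff [f' gf' e] : exists2 f', smooth1_gen E f' &
    forall x, E x -> derive1n n f x = f' x.
  move=> x Ex; have [f'' _ df] := gen1_derive oE gf'.
  apply: (@near_eq_derivable _ _ _ f'); last by have [] := df x Ex.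
  by apply: (near_open1 oE Ex) => y /e.
elim: n => [|n [f' gf' e]]; first by exists f.
have [f'' gf'' df] := gen1_derive oE gf'.
exists f'' => // x Ex; rewrite derive1nS derive1E.
rewrite (near_eq_derive _ (near_open1 oE Ex e)).
by have [_ ->] := df x Ex.
Qed.

Lemma smooth1_local E f : (forall x, E x -> exists N h, [/\ open N, N x,
    forall y, N y -> f y = h y & smooth1 N h]) -> smooth1 E f.
Proof.
move=> H n x /H[N [h [oN Nx fh sh]]].
have : smooth1_gen N f by apply: gen1_eq (gen1_base sh) => y /fh.
by move=> /(smooth1_genP oN) /(_ n x Nx).
Qed.

Lemma smooth1_primitive E f f' : open E -> (forall x, E x -> is_derive x 1 f (f' x)) ->
  smooth1 E f' -> smooth1 E f.
Proof.
move=> oE df sf' [|n] x Ex; first by have [] := df x Ex.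
rewrite derive1Sn; suff : smooth1 E (f^`())%classic by move/(_ n x Ex).
apply: smooth1_local => y Ey; exists E, f'; split => // w Ew.
by rewrite derive1E; have [_ ->] := df w Ew.
Qed.

Lemma smooth1_cst E (c : R) : smooth1 E (cst c).
Proof.
move=> n x _; have -> : derive1n n (cst c) = cst (if n is 0%N then c else 0).
  elim: n => [//|n IH]; rewrite derive1nS IH; apply/funext => y.
  by rewrite derive1_cst.
exact: derivable_cst.
Qed.

Lemma smooth1_id E : smooth1 E id.
Proof.
move=> [|n] x Ex; first exact: derivable_id.
rewrite derive1Sn (_ : (id^`())%classic = cst 1); first exact: (@smooth1_cst E 1).
by apply/funext => y; rewrite derive1_id.
Qed.

Lemma smooth1_expR E : smooth1 E (@expR R).
Proof.
move=> n x _; have -> : derive1n n (@expR R) = @expR R.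
  elim: n => [//|n IH]; rewrite derive1nS IH; apply/funext => y.
  by rewrite derive1E; have [_ ->] := is_derive_expR y.
exact: derivable_expR.
Qed.

Definition pos_reals : set R := [set x | 0 < x].
Lemma pos_reals_open : open pos_reals. Proof. exact: open_gt. Qed.

Lemma is_derive_inv x : x != 0 -> is_derive x 1 (fun y : R => y^-1) (- x ^- 2).
Proof.
move=> x0; apply: DeriveDef; first by apply: (@derivableV _ _ id).
by rewrite (@deriveV _ _ id)// derive_id /GRing.scale /= mulr1.
Qed.

Lemma is_derive_invX (c : R) m x : x != 0 ->
  is_derive x 1 (fun y => c * (y^-1) ^+ m) (- (c * m%:R) * (x^-1) ^+ m.+1).
Proof.
move=> x0; have hX : is_derive x^-1 1 (fun y : R => y ^+ m) (m%:R * x^-1 ^+ m.-1).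
  apply: DeriveDef; first exact: exprn_derivable.
  by rewrite exp_derive /GRing.scale /= mulr1.
have h2 : is_derive x 1 (fun y => c * (y^-1) ^+ m) _ :=
  is_deriveM (is_derive_cst c x 1) (is_derive1_comp hX (is_derive_inv x0)).
move: h2; congr is_derive; rewrite /cst /GRing.scale /= mulr0 addr0.
case: m {hX} => [|m]; first by rewrite !mul0r !mulr0 oppr0 !mul0r.
have -> : x^-1 ^+ m.+2 = x^-1 * x^-1 * x^-1 ^+ m by rewrite 2!exprS mulrA.
by rewrite -exprVn /=; ring.
Qed.

Lemma smooth1_inv : smooth1 pos_reals (fun x => x^-1).
Proof.
move=> n; suff [c [m e]] : exists c m, forall x, pos_reals x ->
    derive1n n (fun x => x^-1) x = c * (x^-1) ^+ m.
  move=> x x0; have xn : x != 0 by rewrite gt_eqF.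
  have [d _] := is_derive_invX c m xn; apply: near_eq_derivable d.
  by apply: (near_open1 pos_reals_open x0) => y /e.
elim: n => [|n [c [m e]]]; first by exists 1, 1%N => x _; rewrite mul1r.
exists (- (c * m%:R)), m.+1 => x x0; rewrite derive1nS derive1E.
rewrite (near_eq_derive _ (near_open1 pos_reals_open x0 e)).
have xn : x != 0 by rewrite gt_eqF.
by have [_ ->] := is_derive_invX c m xn.
Qed.

Lemma smooth1_ln : smooth1 pos_reals (@ln R).
Proof.
exact: (smooth1_primitive pos_reals_open (@is_derive1_ln R) smooth1_inv).
Qed.

(* The functions [p(1/x) exp(-1/x)], extended by [0] for [x <= 0]. *)
Definition flat (p : {poly R}) x : R := if 0 < x then p.[x^-1] * expR (- x^-1) else 0.

(** With [y = 1 / x], the exponential series gives that [expR y] is at least [y ^+ n.+1] over a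
    factorial, which settles monomials. The additional power [n] lets the induction on [p] pass from
    [p] to [p * 'X + a]. *)
Lemma flat_bound p : exists2 c : R, 0 <= c & forall x, `|flat p x| <= c * `|x|.
Proof.
suff H : forall n : nat, exists2 c : R, 0 <= c & forall x, 0 < x ->
    `|p.[x^-1] * (x^-1) ^+ n| * expR (- x^-1) <= c * x.
  have [c c0 hc] := H 0%N; exists c => // x; rewrite /flat; case: ifP => [x0|_].
    by have := hc x x0; rewrite expr0 mulr1 normrM (gtr0_norm (expR_gt0 _)) (gtr0_norm x0).
  by rewrite normr0 mulr_ge0.
elim/poly_ind: p => [|p a IH] n.
  by exists 0 => // x x0; rewrite horner0 !mul0r normr0 mul0r.
have [c c0 hc] := IH n.+1.
exists (c + `|a| * (n.+1)`!%:R); first by rewrite addr_ge0 ?mulr_ge0.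
move=> x x0; set y := x^-1; have y0 : 0 < y by rewrite invr_gt0.
have mono : y ^+ n * expR (- y) <= (n.+1)`!%:R * x.
  rewrite expRN ler_pdivrMr ?expR_gt0//.
  have f0 : 0 < (n.+1)`!%:R :> R by rewrite ltr0n fact_gt0.
  have h : y ^+ n.+1 / (n.+1)`!%:R <= expR y.
    by apply: le_trans (expR_ge1Dxn n (ltW y0)); rewrite lerDr.
  rewrite ler_pdivrMr// in h.
  have -> : y ^+ n = y ^+ n.+1 * x by rewrite exprS mulrAC mulVf ?mul1r// gt_eqF.
  have := ler_wpM2r (ltW x0) h; rewrite -!mulrA (mulrC x); lra.
rewrite hornerMXaddC mulrDl mulrDl -[p.[y] * y * _]mulrA -exprS.
apply: le_trans (_ : (`|p.[y] * y ^+ n.+1| + `|a * y ^+ n|) * expR (- y) <= _).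
  by rewrite ler_wpM2r ?expR_ge0 ?ler_normD.
rewrite mulrDl lerD//; first exact: hc.
rewrite normrM (ger0_norm (exprn_ge0 n (ltW y0))) -mulrA -[X in _ <= X]mulrA.
exact: ler_wpM2l (normr_ge0 a) _ _ mono.
Qed.

(** For [x > 0] the chain rule multiplies [p - p'] by the square of [1 / x]. At [0] the difference
    quotient is [flat (p * 'X)], which is continuous there by [flat_bound]. *)
Lemma flat_is_derive p x : is_derive x 1 (flat p) (flat ((p - p^`()) * 'X^2) x).
Proof.
have [x0|x0|->] := ltgtP x 0.
- have -> : flat ((p - p^`()) * 'X^2) x = 0 by rewrite /flat ltNge ltW.
  apply: (@near_eq_is_derive _ _ _ (cst 0)).
  have o : open [set y : R | y < 0] by exact: open_lt.
  apply: (near_open1 o) => // y y0; rewrite /flat ltNge.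
  by rewrite (ltW (y0 : y < 0)).
- have xn : x != 0 by rewrite gt_eqF.
  have dV := is_derive_inv xn.
  have h1 := is_derive1_comp (is_derive_poly p x^-1) dV.
  have dN : is_derive x 1 (fun y : R => - y^-1) _ := is_deriveN dV.
  have h2 := @is_derive1_comp _ _ (fun y : R => - y^-1) x _ _ (is_derive_expR (- x^-1)) dN.
  have h3 : is_derive x 1 (fun y : R => p.[y^-1] * expR (- y^-1)) _ := is_deriveM h1 h2.
  have -> : flat ((p - p^`()) * 'X^2) x =
      p.[x^-1] *: (expR (- x^-1) * - - x ^- 2) +
      expR (- x^-1) *: (p^`().[x^-1] * - x ^- 2).
    rewrite /flat x0 /GRing.scale /= hornerM hornerXn hornerD hornerN -exprVn.
    by ring.
  apply: near_eq_is_derive h3.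
  by apply: (near_open1 pos_reals_open) => // y y0; rewrite /flat ifT.
- rewrite {2}/flat ltxx; apply/is_derive1_caratheodory.
  exists (flat (p * 'X)); split; last by rewrite /flat ltxx.
  + move=> z; rewrite {2}/flat ltxx !subr0 /flat; case: ifP => z0; last by rewrite mul0r.
    by rewrite hornerMX; field; rewrite gt_eqF.
  + have [c c0 hc] := flat_bound (p * 'X).
    apply/rcontP => e e0; exists (e / (c + 1)).
      by rewrite divr_gt0// ltr_wpDl.
    move=> s; rewrite subr0 {2}/flat ltxx subr0 => hs.
    apply: le_lt_trans (hc s) _; move: hs; rewrite ltr_pdivlMr ?ltr_wpDl//.
    by apply: le_lt_trans; rewrite mulrC ler_wpM2l// lerDl.
Qed.

Lemma smooth1_flat E p : smooth1 E (flat p).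
Proof.
move=> n x _; suff [q ->] : exists q, derive1n n (flat p) = flat q.
  by have [] := flat_is_derive q x.
elim: n => [|n [q IH]]; first by exists p.
exists ((q - q^`()) * 'X^2); rewrite derive1nS IH; apply/funext => y.
by rewrite derive1E; have [_ ->] := flat_is_derive q y.
Qed.

(** The quotient [u / (u + v)] of a flat function vanishing left of [a] and one vanishing right of
    [b]. The derivative [X'] is kept explicit because its sign enters the curvature estimate. *)
Lemma smooth_step (a b : R) : a < b -> exists X X' : R -> R,
  [/\ smooth1 setT X, forall x, is_derive x 1 X (X' x),
      forall x, 0 <= X x <= 1 /\ 0 <= X' x,
      forall x, x <= a -> X x = 0 /\ X' x = 0 & forall x, b <= x -> X x = 1].
Proof.
move=> ab; pose u x := flat 1 (x - a); pose v x := flat 1 (b - x).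
have f0 p (x : R) : x <= 0 -> flat p x = 0 by rewrite /flat ltNge => ->.
have fp (x : R) : 0 <= flat 1 x.
  by rewrite /flat; case: ifP => // _; rewrite hornerC mul1r expR_ge0.
have fpp (x : R) : 0 < x -> 0 < flat 1 x.
  by move=> x0; rewrite /flat x0 hornerC mul1r expR_gt0.
pose fl' := flat ((1 - 1^`()) * 'X^2).
have fp' (x : R) : 0 <= fl' x.
  rewrite /fl' /flat; case: ifP => // _.
  by rewrite derivC subr0 mul1r hornerXn mulr_ge0 ?expR_ge0 ?sqr_ge0.
have uv x : 0 < u x + v x.
  have [xa|xa] := ltP a x.
    by apply: ltr_pwDl; [apply: fpp; rewrite subr_gt0|exact: fp].
  by apply: ltr_wpDl; [exact: fp|apply: fpp; rewrite subr_gt0 (le_lt_trans xa)].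
have du x : is_derive x 1 u (fl' (x - a)).
  have h : is_derive x 1 (fun x : R => x - a) 1.
    by have := is_deriveB (is_derive_id x 1) (is_derive_cst a x 1); rewrite subr0.
  by have := @is_derive1_comp _ _ (fun x : R => x - a) x _ _ (flat_is_derive 1 (x - a)) h; rewrite mulr1.
have dv x : is_derive x 1 v (- fl' (b - x)).
  have h : is_derive x 1 (fun x : R => b - x) (-1).
    by have := is_deriveB (is_derive_cst b x 1) (is_derive_id x 1); rewrite sub0r.
  by have := @is_derive1_comp _ _ (fun x : R => b - x) x _ _ (flat_is_derive 1 (b - x)) h; rewrite mulrN1.
pose X x := u x * (u x + v x)^-1.
pose X' x := (fl' (x - a) * v x + u x * fl' (b - x)) / (u x + v x) ^+ 2.
have gu : smooth1_gen setT u.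
  apply: (@gen1_comp _ setT (flat 1) (fun x => x + - a)) => //; first exact: smooth1_flat.
  by apply: gen1_add; apply: gen1_base; [exact: smooth1_id|exact: (@smooth1_cst _ (- a))].
have gv : smooth1_gen setT v.
  apply: (@gen1_comp _ setT (flat 1) (fun x => b - x)) => //; first exact: smooth1_flat.
  apply: (@gen1_add _ (cst b) (fun x => - x)); first by apply: gen1_base; exact: smooth1_cst.
  apply: (@gen1_eq _ (fun x => -1 * x)); first by move=> x _; rewrite mulN1r.
  by apply: gen1_mul; apply: gen1_base; [exact: (@smooth1_cst _ (-1))|exact: smooth1_id].
exists X, X'; split.
- apply: smooth1_genP; first exact: openT.
  apply: gen1_mul => //.
  exact: (@gen1_comp _ pos_reals (fun x => x^-1) (fun x => u x + v x) smooth1_inv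
    (fun x _ => uv x) (gen1_add gu gv)).
- move=> x; have uvn : u x + v x != 0 by rewrite gt_eqF.
  have hs := is_deriveD (du x) (dv x).
  have hV := @is_derive1_comp _ _ (fun y => u y + v y) x _ _ (is_derive_inv uvn) hs.
  have hX : is_derive x 1 X _ := is_deriveM (du x) hV.
  move: hX; congr is_derive.
  by rewrite /X' /GRing.scale /=; field.
- move=> x; rewrite /X /X'; split.
    have u0 : 0 <= u x := fp _; have v0 : 0 <= v x := fp _.
    apply/andP; split; first by rewrite mulr_ge0// invr_ge0 ltW.
    by rewrite ler_pdivrMr// mul1r lerDl.
  by rewrite divr_ge0 ?sqr_ge0// addr_ge0// mulr_ge0// ?fp'// fp.
- move=> x xa; have u0 : u x = 0 by apply: f0; rewrite subr_le0.
  have u'0 : fl' (x - a) = 0 by apply: f0; rewrite subr_le0.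
  by rewrite /X /X' u0 u'0 !mul0r addr0 mul0r.
- move=> x bx; have v0 : v x = 0 by apply: f0; rewrite subr_le0.
  by rewrite /X v0 addr0 divff// gt_eqF// fpp// subr_gt0 (lt_le_trans ab).
Qed.
End OneVariable.

(** * The rotationally symmetric profile *)

Section Profile.
Variable R : realType.
Implicit Types x : R.

(* The logarithm of the density of the punctured disk, as a function of [x = |z| ^+ 2];
   [x W0'(x) = q0 x] is positive exactly when [|z| > 1/e]. *)
Definition W0 x : R := - (ln x / 2) - ln (- (ln x / 2)).
Definition q0 x : R := - 2^-1 + (- ln x)^-1.

Lemma density_profile (z : plane R) : 0 < modulus z < 1 ->
  punctured_disk_density z = expR (W0 (modulus z ^+ 2)).
Proof.
move=> /andP[z0 z1]; rewrite /W0 lnXn//.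
have -> : ln (modulus z) *+ 2 / 2 = ln (modulus z) by rewrite -(mulr_natr (ln _)) mulfK.
have l0 : 0 < - ln (modulus z) by rewrite oppr_gt0 ln_lt0// z0.
rewrite expRD !expRN !lnK// /punctured_disk_density normrM gtr0_norm//.
by rewrite ler0_norm ?invfM// -oppr_ge0 ltW.
Qed.

Let unit_itv : set R := [set x | 0 < x < 1].
Let unit_itv_open : open unit_itv.
Proof.
have -> : unit_itv = [set x | 0 < x] `&` [set x | x < 1].
  by apply/seteqP; split => x /= => [/andP//|[? ?]]; exact/andP.
by apply: openI; [exact: open_gt|exact: open_lt].
Qed.
Let ln_neg x : unit_itv x -> 0 < - ln x.
Proof. by move=> h; rewrite oppr_gt0 ln_lt0. Qed.

Lemma is_derive_W0 x : 0 < x < 1 -> is_derive x 1 W0 (q0 x * x^-1).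
Proof.
move=> x01; have /andP[x0 x1] := x01; have l0 := ln_neg x01.
have dl := is_derive1_ln x0.
have l2 : 0 < - (ln x / 2) by rewrite -mulNr divr_gt0.
have h1 : is_derive x 1 (fun x : R => - (ln x / 2)) (- (x^-1 / 2)).
  have := is_deriveN (is_deriveM dl (is_derive_cst (2^-1 : R) x 1)).
  by congr is_derive; rewrite /cst /GRing.scale /=; ring.
have h2 := @is_derive1_comp _ _ (fun x : R => - (ln x / 2)) x _ _ (is_derive1_ln l2) h1.
have h3 : is_derive x 1 W0 _ := is_deriveB h1 h2.
move: h3; congr is_derive; rewrite /q0; field.
by rewrite gt_eqF// -oppr_eq0 gt_eqF.
Qed.

Let dq0 x : 0 < x < 1 -> is_derive x 1 q0 (x^-1 / ln x ^+ 2).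
Proof.
move=> x01; have /andP[x0 x1] := x01; have l0 := ln_neg x01.
have ln0 : - ln x != 0 by rewrite gt_eqF.
have h1 : is_derive x 1 (fun x : R => - ln x) _ := is_deriveN (is_derive1_ln x0).
have h2 := @is_derive1_comp _ _ (fun x : R => - ln x) x _ _ (is_derive_inv ln0) h1.
have h3 : is_derive x 1 q0 _ := is_deriveD (is_derive_cst (- 2^-1 : R) x 1) h2.
have lnn : ln x != 0 by rewrite -oppr_eq0.
by move: h3; congr is_derive; field; rewrite lnn gt_eqF.
Qed.

Let smooth_K : smooth1_gen unit_itv (fun x => q0 x * x^-1).
Proof.
have gl : smooth1_gen unit_itv (fun x => - ln x).
  apply: (@gen1_eq _ _ (fun x => -1 * ln x)); first by move=> x _; rewrite mulN1r.
  apply: gen1_mul; first by apply: gen1_base; exact: (@smooth1_cst _ _ (-1)).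
  by apply: gen1_base => n x /andP[x0 _]; exact: smooth1_ln.
apply: gen1_mul; last by apply: gen1_base => n x /andP[x0 _]; exact: smooth1_inv.
apply: gen1_add; first by apply: gen1_base; exact: (@smooth1_cst _ _ (- 2^-1)).
exact: (@gen1_comp _ _ (@pos_reals R) (fun x => x^-1) (fun x => - ln x) (@smooth1_inv R) ln_neg gl).
Qed.

(** The derivative [k] of [W] is interpolated by the cutoff [X] between a constant [e] near [0] and
    [q0 x / x] near the rim. The derivative of [x * k x] is then
    [X' (q0 - e x) + X q0' + (1 - X) e], a sum of nonnegative terms of which one of the last two is
    positive. *)
Theorem radial_profile (r : R) : expR (-1) < r < 1 ->
  exists (rho : R) (W W1 W2 : R -> R) (E := [set x : R | -1 < x < r ^+ 2]),
  [/\ 0 < rho < r ^+ 2, smooth1 E W,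
      forall x, E x -> is_derive x 1 W (W1 x) /\ is_derive x 1 W1 (W2 x),
      forall x, E x -> 0 <= x -> 0 < x * W2 x + W1 x &
      forall x, E x -> rho <= x -> W x = W0 x].
Proof.
move=> /andP[er r1]; have er0 := lt_trans (expR_gt0 (-1)) er.
(* The zero of [q0]; the points [s1], [s2], [s3] divide the interval from [m] to [r ^+ 2] into
   quarters. *)
pose m : R := expR (-1) ^+ 2; have m0 : 0 < m by rewrite exprn_gt0// expR_gt0.
have mr : m < r ^+ 2 by rewrite ltrXn2r// ?nnegrE ?expR_ge0 ?ltW.
have r21 : r ^+ 2 < 1 by rewrite exprn_ilt1// ltW.
have lm : ln m = -2 by rewrite lnXn ?expR_gt0// expRK mulNrn.
pose d := r ^+ 2 - m; have d0 : 0 < d by rewrite subr_gt0.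
pose s1 := m + d / 4; pose s2 := m + d / 2; pose s3 := m + 3 * d / 4.
have s12 : s1 < s2 by rewrite /s1 /s2; lra.
have s23 : s2 < s3 by rewrite /s2 /s3; lra.
have s3r : s3 < r ^+ 2 by rewrite /s3 /d; move: mr; lra.
have ms1 : m < s1 by rewrite /s1; lra.
have s1i : unit_itv s1 by apply/andP; split; lra.
have q0_mono x : s1 <= x -> x < 1 -> q0 s1 <= q0 x.
  move=> sx x1; have xi : unit_itv x by apply/andP; split; lra.
  rewrite /q0 lerD2l lef_pV2 ?posrE ?ln_neg// lerN2 ler_ln//.
    by case/andP: s1i.
  by case/andP: xi.
(* With this value [q0 x >= e >= e * x] for [s1 <= x < 1], so the term carrying [X'] is not
   negative. *)
pose e := q0 s1.
have e0 : 0 < e.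
  rewrite /e /q0 addrC subr_gt0 ltf_pV2 ?posrE ?ln_neg//.
  have : ln m < ln s1 by rewrite ltr_ln//; case/andP: s1i.
  rewrite lm; lra.
have [X [X' [sX dX X01 Xa Xb]]] := smooth_step s12.
pose k x := (1 - X x) * e + X x * (q0 x * x^-1).
have klow x : x <= s1 -> k x = e.
  by move=> /Xa[h _]; rewrite /k h subr0 mul1r mul0r addr0.
have khigh x : s2 <= x -> k x = q0 x * x^-1.
  by move=> /Xb h; rewrite /k h subrr mul0r add0r mul1r.
pose E0 : set R := [set x | x < r ^+ 2].
have oE0 : open E0 by exact: open_lt.
have sk : smooth1 E0 k.
  apply: smooth1_local => x xr; case: (ltP x s1) => xs.
    exists [set y | y < s1], (cst e); split.
    - exact: open_lt.
    - exact: xs.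
    - by move=> y /ltW/klow.
    - exact: smooth1_cst.
  exists unit_itv, k; split => //.
    by apply/andP; split; [lra|exact: (@lt_trans _ _ (r ^+ 2))].
  apply: (smooth1_genP unit_itv_open).
  have gX : smooth1_gen unit_itv X by apply: gen1_base => n y _; exact: sX.
  apply: gen1_add; last exact: gen1_mul gX smooth_K.
  apply: gen1_mul; last by apply: gen1_base; exact: (@smooth1_cst _ _ e).
  apply: (@gen1_eq _ _ (fun x => 1 + -1 * X x)).
    by move=> y _; rewrite mulN1r.
  apply: gen1_add; first by apply: gen1_base; exact: (@smooth1_cst _ _ 1).
  by apply: gen1_mul gX; apply: gen1_base; exact: (@smooth1_cst _ _ (-1)).
(* Any negative lower end would do: it makes [x = 0], the cusp, an interior point of the domain of
   [W]. *)
have s30 : -1 <= s3 by rewrite /s3; lra.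
have kc t : -1 <= t <= s3 -> pcont (fun t => Complex (k t) 0) t.
  move=> /andP[_ t3]; apply/pcontP; split => /=; last exact: cst_continuous.
  have tE : E0 t by exact: le_lt_trans t3 s3r.
  have [dk _] := smooth1_derivable sk tE.
  exact/differentiable_continuous/derivable1_diffP.
have [P hP] := primitive_exists s30 kc.
have dP t : -1 <= t <= s3 -> is_derive t 1 (fun t => complex.Re (P t)) (k t).
  by move=> /hP/pderP[].
have PW x : s2 <= x <= s3 ->
    complex.Re (P x) - complex.Re (P s2) = W0 x - W0 s2.
  move=> /andP[x2 x3].
  have hQ t : s2 <= t <= x -> pder (fun t => Complex (W0 t) 0) t (Complex (k t) 0).
    move=> /andP[t2 tx]; apply/pderP; split => /=; last exact: is_derive_cst.
    rewrite khigh//; apply: is_derive_W0; apply/andP; split; lra.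
  have hP' t : s2 <= t <= x -> pder P t (Complex (k t) 0).
    by move=> /andP[t2 tx]; apply: hP; apply/andP; split; lra.
  have := congr1 (@complex.Re R) (primitive_unique x2 hP' hQ).
  by rewrite !raddfB.
(* The primitive of [k] is available up to [s3] only. Normalized at [s2], it agrees with [W0]
   between [s2] and [s3], so the change of formula at [s3] is invisible. *)
pose W x := if x < s3 then complex.Re (P x) - complex.Re (P s2) + W0 s2 else W0 x.
have Whigh x : s2 <= x -> W x = W0 x.
  move=> x2; rewrite /W; case: ifP => // /ltW x3.
  by rewrite PW ?x2// subrK.
pose E := [set x : R | -1 < x < r ^+ 2].
have oE : open E.
  have -> : E = [set x | -1 < x] `&` E0.
    by apply/seteqP; split => x /= => [/andP//|[? ?]]; exact/andP.
  by apply: openI => //; exact: open_gt.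
have EE0 x : E x -> E0 x by case/andP.
have dW x : E x -> is_derive x 1 W (k x).
  move=> /andP[x1 xr]; case: (ltP x s3) => x3.
    have h : is_derive x 1 (fun t => complex.Re (P t) + (- complex.Re (P s2) + W0 s2)) (k x).
      have := is_deriveD (dP x _) (is_derive_cst (- complex.Re (P s2) + W0 s2) x 1).
      by rewrite addr0; apply; rewrite !ltW.
    apply: near_eq_is_derive h; have o3 : open [set y : R | y < s3] by exact: open_lt.
    by apply: (near_open1 o3) => // y y3; rewrite /W ifT// addrA.
  rewrite khigh; last lra.
  have h : is_derive x 1 W0 (q0 x * x^-1).
    by apply: is_derive_W0; apply/andP; split; [lra|exact: (@lt_trans _ _ (r ^+ 2))].
  apply: near_eq_is_derive h; have o2 : open [set y : R | s2 < y] by exact: open_gt.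
  by apply: (near_open1 o2) => [/=|y /ltW/Whigh//]; lra.
have dk x : E x -> is_derive x 1 k ((k^`())%classic x).
  by move=> /EE0; exact: smooth1_derivable.
exists s2, W, k, (k^`())%classic; split.
- by apply/andP; split; lra.
- apply: (smooth1_primitive oE dW) => n x /EE0; exact: sk.
- by move=> x Ex; split; [exact: dW|exact: dk].
- move=> x Ex x0; have /andP[_ xr] := Ex.
  case: (ltP x s1) => xs.
    have -> : (k^`())%classic x = 0.
      have o1 : open [set y : R | y < s1] by exact: open_lt.
      have nk : \forall y \near x, k y = cst e y.
        by apply: (near_open1 o1) => // y /ltW/klow.
      by rewrite derive1E (near_eq_derive _ nk) derive_cst.
    by rewrite mulr0 add0r klow// ltW.
  have xi : 0 < x < 1 by apply/andP; split; [lra|exact: (@lt_trans _ _ (r ^+ 2))].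
  have /andP[xp x1] := xi; have xn : x != 0 by rewrite gt_eqF.
  have hK : is_derive x 1 (fun x => q0 x * x^-1) _ := is_deriveM (dq0 xi) (is_derive_inv xn).
  have h1 := is_deriveB (is_derive_cst (1 : R) x 1) (dX x).
  have h2 := is_deriveM h1 (is_derive_cst e x 1).
  have h3 : is_derive x 1 k _ := is_deriveD h2 (is_deriveM (dX x) hK).
  rewrite derive1E; have [_ ->] := h3; rewrite /cst /GRing.scale /= -/(k x).
  have [/andP[X0 X1] X'0] := X01 x.
  have l2 : 0 < ln x ^+ 2 by rewrite -sqrrN exprn_gt0// ln_neg.
  (* If [X x] is positive the middle term is, and otherwise [X x = 0] and the last term equals
     [e]. *)
  rewrite [X in 0 < X](_ : _ = X' x * (q0 x - e * x) + X x * (x^-1 / ln x ^+ 2) + (1 - X x) * e).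
    have a1 : 0 <= X' x * (q0 x - e * x).
      rewrite mulr_ge0// subr_ge0 (le_trans _ (q0_mono x xs x1))//.
      by rewrite -/e ler_piMr ?ltW.
    case: (ltrP 0 (X x)) => Xp.
      apply: ltr_wpDr; first by apply: mulr_ge0; [rewrite subr_ge0|exact: ltW].
      have p : 0 < X x * (x^-1 / ln x ^+ 2) by rewrite !mulr_gt0 ?invr_gt0.
      exact: ltr_wpDl a1 p.
    have -> : X x = 0 by apply/eqP; rewrite eq_le X0 Xp.
    by rewrite mul0r addr0 subr0 mul1r; exact: ltr_wpDl a1 e0.
  rewrite /k; move: (q0 x) (X x) (X' x) (ln x) l2 => q y y' l l2.
  by field; rewrite xn -sqrf_eq0 gt_eqF.
- by move=> x _; exact: Whigh.
Qed.
End Profile.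

(** * Curvature of pulled back densities *)

Section Gluing.
Variable R : realType.
Local Notation C := (R[i]).
Local Notation nc := (@Normc.normc R).
Local Notation tc := (@to_complex R).

Lemma laplacian_near (N : set (plane R)) (f h : plane R -> R) z : open N -> N z ->
  (forall w, N w -> f w = h w) -> laplacian f z = laplacian h z.
Proof.
move=> oN Nz fh.
have D1 v w : N w -> 'D_v f w = 'D_v h w.
  by move=> Nw; exact: near_eq_derive (near_open oN Nw fh).
have D2 v : 'D_v ('D_v f) z = 'D_v ('D_v h) z.
  exact: near_eq_derive (near_open oN Nz (D1 v)).
by rewrite /laplacian !D2.
Qed.

Lemma laplacian_add (N : set (plane R)) (f h : plane R -> R) z : open N -> N z ->
  smooth_on N (f : _ -> R^o) -> smooth_on N (h : _ -> R^o) ->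
  laplacian (fun w => f w + h w) z = laplacian f z + laplacian h z.
Proof.
move=> oN Nz sf sh.
have D1 v w : N w -> 'D_v (fun w => f w + h w) w = 'D_v f w + 'D_v h w.
  move=> Nw; apply: (@deriveD _ _ _ f h); apply: diff_derivable; [exact: (sf [::])|exact: (sh [::])].
have D2 v : 'D_v ('D_v (fun w => f w + h w)) z = 'D_v ('D_v f) z + 'D_v ('D_v h) z.
  apply: (etrans (near_eq_derive _ (near_open oN Nz (D1 v)))).
  apply: (@deriveD _ _ _ ('D_v f) ('D_v h)); apply: diff_derivable;
    [exact: (sf [:: v])|exact: (sh [:: v])].
rewrite /laplacian !D2; move: ('D_(1, 0) ('D_(1, 0) f) z) => a.
move: ('D_(1, 0) ('D_(1, 0) h) z) ('D_(0, 1) ('D_(0, 1) f) z) ('D_(0, 1) ('D_(0, 1) h) z) => b c d.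
by rewrite addrACA.
Qed.

Lemma smooth_sqnorm (N : set (plane R)) F : open N -> (forall z, N z -> cdiff F (tc z)) ->
  smooth_gen N (sqnorm F).
Proof.
move=> oN hF; have hI z : N z -> cdiff (fun w => - Complex 0 1 * F w) (tc z).
  by move=> Nz; apply: cdiffM (cdiff_cst _ _) (hF z Nz).
by apply: gen_add; apply: gen_mul; apply: gen_base; exact: smooth_reC.
Qed.

(* The density [expR (W (|F| ^+ 2)) * |F'|] is the pullback under [F] of the rotationally
   symmetric one; [ln |F'|] is harmonic and does not contribute to the curvature. *)
Section PulledDensity.
Variables (N : set (plane R)) (F : C -> C) (E : set R) (W W1 W2 : R -> R).
Hypothesis N_open : open N.
Hypothesis F_hol : forall z, N z -> cdiff F (tc z).
Hypothesis F_imm : forall z, N z -> cd F (tc z) != 0.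
Hypothesis W_smooth : smooth1 E W.
Hypothesis W_der : forall x, E x -> is_derive x 1 W (W1 x) /\ is_derive x 1 W1 (W2 x).
Hypothesis W_pos : forall x, E x -> 0 <= x -> 0 < x * W2 x + W1 x.
Hypothesis F_in : forall z, N z -> E (sqnorm F z).

Definition pulled_density z := expR (W (sqnorm F z)) * nc (cd F (tc z)).

Let L x : R := ln x / 2.
Let q_pos z : N z -> 0 < sqnorm (cd F) z.
Proof. by move=> /F_imm h; rewrite sqnormE exprn_gt0// nc_gt0. Qed.
Let cdF_hol z : N z -> cdiff (cd F) (tc z).
Proof. exact: (cd_hol_plane N_open F_hol). Qed.

Let densityE z : N z ->
  pulled_density z = expR (W (sqnorm F z) + L (sqnorm (cd F) z)).
Proof.
move=> Nz; have n0 : 0 < nc (cd F (tc z)) by rewrite nc_gt0 F_imm.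
rewrite expRD /pulled_density /L (sqnormE (cd F)) lnXn//; congr (_ * _).
by rewrite -(mulr_natr (ln _)) mulfK// lnK.
Qed.

Lemma pulled_density_gt0 z : N z -> 0 < pulled_density z.
Proof. by move=> /densityE ->; exact: expR_gt0. Qed.

Let smooth_Wq : smooth_gen N (W \o sqnorm F).
Proof. exact: (gen_comp W_smooth F_in (smooth_sqnorm N_open F_hol)). Qed.
Let smooth_Lq : smooth_gen N (L \o sqnorm (cd F)).
Proof.
apply: (@gen_comp _ _ (@pos_reals R)); [|exact: q_pos|exact: smooth_sqnorm N_open cdF_hol].
apply: (smooth1_genP (@pos_reals_open R)); apply: gen1_mul; apply: gen1_base.
  exact: smooth1_ln.
exact: (@smooth1_cst _ _ (2^-1)).
Qed.

Lemma pulled_density_smooth : smooth_on N (pulled_density : _ -> R^o).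
Proof.
apply: (smooth_genP N_open).
apply: (@gen_eq _ _ (@expR R \o (fun z => (W \o sqnorm F) z + (L \o sqnorm (cd F)) z))).
  by move=> z /densityE ->.
apply: (@gen_comp _ _ setT) => //; first exact: smooth1_expR.
exact: gen_add.
Qed.

Lemma pulled_density_curvature z : N z -> gauss_curvature pulled_density z < 0.
Proof.
move=> Nz; rewrite /gauss_curvature.
have -> : laplacian (fun w => ln (pulled_density w)) z =
    laplacian (fun w => (W \o sqnorm F) w + (L \o sqnorm (cd F)) w) z.
  by apply: (laplacian_near N_open Nz) => w Nw; rewrite densityE// expRK.
rewrite (laplacian_add N_open Nz (smooth_genP N_open smooth_Wq) (smooth_genP N_open smooth_Lq)).
rewrite (laplacian_radial N_open F_hol F_in (fun x Ex => (W_der Ex).1) (fun x Ex => (W_der Ex).2) Nz).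
have dL x : @pos_reals R x -> is_derive x 1 L (x^-1 / 2).
  move=> x0; have h : is_derive x 1 L _ := is_deriveM (is_derive1_ln x0) (is_derive_cst (2^-1 : R) x 1).
  by move: h; congr is_derive; rewrite /cst /GRing.scale /=; ring.
have dL1 x : @pos_reals R x -> is_derive x 1 (fun x => x^-1 / 2) (- x ^- 2 / 2).
  move=> x0; have xn : x != 0 by rewrite gt_eqF.
  have h : is_derive x 1 (fun x => x^-1 / 2) _ := is_deriveM (is_derive_inv xn) (is_derive_cst (2^-1 : R) x 1).
  by move: h; congr is_derive; rewrite /cst /GRing.scale /=; ring.
rewrite (laplacian_radial N_open cdF_hol q_pos dL dL1 Nz).
have q0 := q_pos Nz; have d0 := pulled_density_gt0 Nz.
(* For [L x = ln x / 2] the expression [x L'' + L'] vanishes: this is the harmonicity of the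
   logarithm of the modulus of [cd F]. *)
have -> : sqnorm (cd F) z * (- sqnorm (cd F) z ^- 2 / 2) + (sqnorm (cd F) z)^-1 / 2 = 0.
  by move: (sqnorm (cd F) z) q0 => q q0; field; rewrite gt_eqF.
rewrite mulr0 addr0 mulNr oppr_lt0 divr_gt0 ?exprn_gt0//.
apply: mulr_gt0; last by apply: (W_pos (F_in Nz)); rewrite sqnormE sqr_ge0.
by rewrite mulr_gt0// exprn_gt0// nc_gt0 F_imm.
Qed.
End PulledDensity.
End Gluing.

(** * Gluing *)

Section Transition.
Variables (R : realType) (X : riemannSurface R).
Implicit Types (c d e : chart R X) (z : plane R).
Local Notation nc := (@Normc.normc R).
Local Notation tc := (@to_complex R).
Local Notation oc := (@of_complex R).

Lemma isometric_near lam mu mu' (f h : plane R -> plane R) z : cdiff (fC f) (tc z) ->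
  (\forall w \near z, f w = h w) -> mu (f z) = mu' (h z) ->
  isometric_at lam mu f z -> isometric_at lam mu' h z.
Proof.
move=> df fh e; have hn : nhd (tc z) (fun w => fC f w = fC h w).
  by move/nbhs_nhd: fh; apply: nhdS => w; rewrite /fC /= => ->.
have hf := cdP df.
move=> /(isometric_cder _ _ hf) h1.
by apply/(isometric_cder _ _ (cder_near hn hf)); rewrite -e.
Qed.

Definition trans c d := fC (cfun d \o cinv c).
Definition overlap c d : set (plane R) := crng c `&` [set z | cdom d (cinv c z)].

Lemma overlap_preim c (V : set X) z : open V -> crng c z -> V (cinv c z) ->
  nbhs z (crng c `&` [set w | V (cinv c w)]).
Proof.
move=> oV cz Vz; apply: filterI.
  by apply: open_nbhs_nbhs; split => //; exact: crng_open.
by apply: (cinv_continuous cz); exact: open_nbhs_nbhs.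
Qed.

Lemma preim_open c (V : set X) : open V -> open (crng c `&` [set w | V (cinv c w)]).
Proof. by move=> oV; rewrite openE => z [cz Vz]; exact: overlap_preim. Qed.

Lemma overlap_open c d : open (overlap c d).
Proof. exact: preim_open (@cdom_open _ _ d). Qed.

Lemma trans_cdiff c d z : atlas X c -> atlas X d -> overlap c d z ->
  cdiff (trans c d) (tc z).
Proof.
by move=> ac ad [cz dz]; apply/holomorphic_cdiff; exact: atlas_holomorphic.
Qed.

Lemma trans_cd_neq0 c d z : atlas X c -> atlas X d -> overlap c d z ->
  cd (trans c d) (tc z) != 0.
Proof.
move=> ac ad Nz.
apply: (@inj_hol_cd_neq0 _ (fun w => overlap c d (oc w)) _ (trans d c)).
- by move=> w Nw; rewrite -{1}[w]ocK; exact: open_nhd (@overlap_open c d) Nw.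
- by move=> w Nw; rewrite -[w]ocK; exact: trans_cdiff.
- by move=> w [cw dw]; rewrite /trans /fC /= tcK cfunK// cinvK// ocK.
- by rewrite tcK.
Qed.

Lemma trans_comp c d e z : atlas X c -> atlas X d -> atlas X e ->
  overlap c d z -> cdom e (cinv c z) ->
  cd (trans c e) (tc z) =
    cd (trans d e) (tc (cfun d (cinv c z))) * cd (trans c d) (tc z).
Proof.
move=> ac ad ae Nz ez; have [cz dz] := Nz.
have Nz' : overlap d e (cfun d (cinv c z)).
  by split; [exact: cfun_crng|rewrite /= cfunK].
have h1 := cdP (trans_cdiff ac ad Nz); have h2 := cdP (trans_cdiff ad ae Nz').
rewrite -(fCE (cfun d \o cinv c)) in h2 *.
apply: cdE; apply: cder_near (cder_comp h1 h2).
apply: nhdS (open_nhd (@overlap_open c d) Nz) => w [cw dw].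
by rewrite /trans /fC /= tcK cfunK.
Qed.

Lemma trans_cd1 c z : atlas X c -> crng c z -> cd (trans c c) (tc z) = 1.
Proof.
move=> ac cz; apply: cdE; apply: (@cder_near _ id _ _ _ _ (cder_id (tc z))).
apply: nhdS (open_nhd (@crng_open _ _ c) cz) => w cw.
by rewrite /trans /fC /= cinvK// ocK.
Qed.

Lemma dens_trans (g : conformalMetric X) c d z : atlas X c -> atlas X d -> overlap c d z ->
  g d (cfun d (cinv c z)) * nc (cd (trans c d) (tc z)) = g c z.
Proof.
move=> ac ad Nz; have [cz dz] := Nz.
exact/(isometric_cder _ _ (cdP (trans_cdiff ac ad Nz)))/dens_transition.
Qed.
End Transition.

Lemma gauss_curvature_near (R : realType) (N : set (plane R)) (f h : plane R -> R) z :
  open N -> N z -> (forall w, N w -> f w = h w) ->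
  gauss_curvature f z = gauss_curvature h z.
Proof.
move=> oN Nz fh; apply: (congr2 (fun a b => - a / b ^+ 2)); last exact: fh.
by apply: (laplacian_near oN Nz) => w Nw; apply: congr1; exact: fh.
Qed.

(** * The glued metric *)

Section GluedMetric.
Variables (R : realType) (S Sc : riemannSurface R) (iota : S -> Sc).
Variable g : conformalMetric S.
Local Notation nc := (@Normc.normc R).
Local Notation tc := (@to_complex R).
Local Notation oc := (@of_complex R).
Hypothesis iota_hol : holomorphic iota.
Hypothesis iota_inj : injective iota.
Hypothesis iota_open : open (range iota).
Local Notation is_pullback := (is_pullback iota).

(** The transition map between the two pullbacks is that between [c] and [d], restricted, so the
    compatibility of [g] carries over. *)
Lemma pull_trans (c d : chart R Sc) c' d' z : atlas Sc c -> atlas Sc d ->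
  is_pullback c c' -> is_pullback d d' -> crng c' z -> cdom d (cinv c z) ->
  g d' (cfun d (cinv c z)) * nc (cd (trans c d) (tc z)) = g c' z.
Proof.
move=> ac ad [ac' c1 c2 c3 c4] [ad' d1 d2 d3 d4] cz dz.
have e w : crng c' w -> cdom d (cinv c w) -> cfun d' (cinv c' w) = cfun d (cinv c w).
  by move=> cw dw; rewrite d3 ?c4.
have Nz : overlap c' d' z by split; rewrite //= d2 /= c4.
have Nz' : overlap c d z by split => //; move: cz; rewrite c1 => -[].
rewrite -(dens_trans g ac' ad' Nz) e//; congr (_ * nc _).
apply/esym/cdE; apply: cder_near (cdP (trans_cdiff ac ad Nz')).
apply: nhdS (open_nhd (@overlap_open _ _ c' d') Nz) => w [cw].
by rewrite /= d2 /= c4// => dw; rewrite /trans /fC /= e.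
Qed.

(** By [pull_densE] the chosen pullback does not matter; [1] is a default for charts without one. *)
Definition pull_dens (c : chart R Sc) z : R :=
  if pselect (exists c', is_pullback c c') is left H then g (projT1 (cid H)) z else 1.

Lemma pull_densE c c' z : atlas Sc c -> is_pullback c c' -> crng c' z ->
  pull_dens c z = g c' z.
Proof.
move=> ac cc' cz; rewrite /pull_dens; case: pselect => [H|[]]; last by exists c'.
case: (cid H) => c'' /= cc''; have [_ c1 _ _ _] := cc'.
have cz' : crng c z by move: cz; rewrite c1 => -[].
have := pull_trans ac ac cc' cc'' cz (cinv_cdom cz').
by rewrite cinvK// trans_cd1// nc1 mulr1.
Qed.

Variables (l : nat) (r rho : 'I_l -> R) (A : 'I_l -> chart R S) (B : 'I_l -> chart R Sc).
Variables (W W1 W2 : 'I_l -> R -> R).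
Let E i : set R := [set x | -1 < x < r i ^+ 2].
Hypothesis r01 : forall i, 0 < r i < 1.
Hypothesis rho_r : forall i, 0 < rho i < r i ^+ 2.
Hypothesis B_atlas : forall i, atlas Sc (B i).
Hypothesis B_crng : forall i, crng (B i) = disk (r i).
Hypothesis B_pull : forall i, is_pullback (B i) (A i).
Hypothesis A_dens : forall i w, crng (A i) w -> g (A i) w = punctured_disk_density w.
Hypothesis A_punctured : forall i w, crng (A i) w -> 0 < modulus w < 1.
Hypothesis B_disj : forall i j x, cdom (B i) x -> cdom (B j) x -> i = j.
Hypothesis B_cover : forall x, range iota x \/ exists i, cdom (B i) x.
Hypothesis W_smooth : forall i, smooth1 (E i) (W i).
Hypothesis W_der : forall i x, E i x ->
  is_derive x 1 (W i) (W1 i x) /\ is_derive x 1 (W1 i) (W2 i x).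
Hypothesis W_pos : forall i x, E i x -> 0 <= x -> 0 < x * W2 i x + W1 i x.
Hypothesis W_out : forall i x, E i x -> rho i <= x -> W i x = W0 x.

Definition cusp_dens (c : chart R Sc) i := pulled_density (trans c (B i)) (W i).

(** The cusp formula takes precedence on the whole domain of [B i], not just on its core; [B_disj]
    makes the index unambiguous. *)
Definition glued_dens (c : chart R Sc) z : R :=
  if pselect (exists i, cdom (B i) (cinv c z)) is left H
  then cusp_dens c (projT1 (cid H)) z else pull_dens c z.

Lemma glued_in c z i : cdom (B i) (cinv c z) -> glued_dens c z = cusp_dens c i z.
Proof.
move=> hi; rewrite /glued_dens; case: pselect => [H|[]]; last by exists i.
by case: (cid H) => j /= hj; rewrite (B_disj hj hi).
Qed.

Let transE c i z : sqnorm (trans c (B i)) z = modulus (cfun (B i) (cinv c z)) ^+ 2.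
Proof. by rewrite sqnormE /trans fCE. Qed.

Let sqnorm_in c i z : overlap c (B i) z -> E i (sqnorm (trans c (B i)) z).
Proof.
move=> [_ bz]; have := cfun_crng bz; rewrite B_crng /disk /= => h.
have m0 : 0 <= modulus (cfun (B i) (cinv c z)) by rewrite modulusE nc_ge0.
rewrite /E /= transE (lt_le_trans (ltrN10 R)) ?sqr_ge0//=.
by rewrite ltr_pXn2r// ?nnegrE// ltW//; case/andP: (r01 i).
Qed.

(** Outside the core [W i] equals [W0], so the cusp formula is the punctured disk density, that is
    [g] in the chart [A i], pulled back by the transition map. *)
Lemma glued_out c c' z : atlas Sc c -> is_pullback c c' -> crng c' z ->
  (forall i, cdom (B i) (cinv c z) -> rho i <= sqnorm (trans c (B i)) z) ->
  glued_dens c z = g c' z.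
Proof.
move=> ac cc' cz ho; have [_ c1 _ _ c4] := cc'.
have cz' : crng c z by move: cz; rewrite c1 => -[].
case: (pselect (exists i, cdom (B i) (cinv c z))) => [[i hi]|hn]; last first.
  by rewrite /glued_dens; case: pselect => // _; exact: pull_densE.
rewrite (glued_in hi) -(pull_trans ac (B_atlas i) cc' (B_pull i) cz hi).
have aw : crng (A i) (cfun (B i) (cinv c z)).
  have [_ -> _ _ _] := B_pull i; split; first exact: cfun_crng.
  by rewrite /= cfunK// -c4//; exists (cinv c' z).
rewrite A_dens// (density_profile (A_punctured aw)) /cusp_dens /pulled_density.
have hE := sqnorm_in (conj cz' hi).
by rewrite (W_out hE (ho i hi)) transE.
Qed.

(** The core of the cusp, where the metric may differ from [g]. Being compact in a Hausdorff space
    it is closed, so a point outside all the domains of the [B i], even on their boundary, has a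
    neighbourhood free of cores. *)
Let K i : set Sc := cinv (B i) @` [set w | modulus w ^+ 2 <= rho i].
Let K_crng i w : modulus w ^+ 2 <= rho i -> crng (B i) w.
Proof.
have /andP[_ h] := rho_r i => hw; have := le_lt_trans hw h.
have m0 : 0 <= modulus w by rewrite modulusE nc_ge0.
have r0 : 0 <= r i by apply: ltW; case/andP: (r01 i).
by rewrite B_crng /disk /= ltr_pXn2r ?nnegrE.
Qed.
Let K_closed i : closed (K i).
Proof.
apply: compact_closed; first exact: rs_hausdorff.
apply: continuous_compact.
  by apply: continuous_in_subspaceT => w; rewrite inE => /K_crng; exact: cinv_continuous.
have modE (w : plane R) : modulus w ^+ 2 = w.1 * w.1 + w.2 * w.2.
  by rewrite /modulus sqr_sqrtr ?addr_ge0 ?sqr_ge0// !expr2.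
have rho1 : rho i <= 1.
  have /andP[_ /ltW h] := rho_r i; apply: le_trans h _.
  by have /andP[r0 r1] := r01 i; rewrite exprn_ile1// ltW.
have -> : [set w | modulus w ^+ 2 <= rho i] =
    [set w : plane R | w.1 * w.1 + w.2 * w.2 <= rho i].
  by apply/seteqP; split => w /=; rewrite modE.
apply: (@subclosed_compact _ _ (`[-1 : R, 1] `*` `[-1 : R, 1])).
- apply: (@preimage_closed _ _ (fun w : plane R => w.1 * w.1 + w.2 * w.2) [set x | x <= rho i]).
    by move=> w _; apply: cvgD; apply: cvgM; (exact: cvg_fst || exact: cvg_snd).
  exact: closed_le.
- by apply: compact_setX; exact: segment_compact.
- move=> [x y] /= h; rewrite !in_itv /=; split; nra.
Qed.

(** Positivity, smoothness and curvature are local, and this dichotomy reduces them to a pulled back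
    density or to [g] itself. *)
Lemma glued_local c z : atlas Sc c -> crng c z ->
  (exists i, overlap c (B i) z) \/
  exists c' N, [/\ is_pullback c c', open N, N z, N `<=` crng c' &
    forall w, N w -> glued_dens c w = g c' w].
Proof.
move=> ac cz; case: (pselect (exists i, cdom (B i) (cinv c z))) => [[i hi]|hn].
  by left; exists i.
right; have [] := B_cover (cinv c z); last by [].
move=> rz; have [x _ _] := rz; have [c' cc'] := pull_chart iota_hol iota_inj iota_open x ac.
have [ac' c1 _ _ c4] := cc'.
pose V : set Sc := range iota `&` ~` \bigcup_(i in [set: 'I_l]) K i.
have oV : open V.
  apply: openI => //; apply: closed_openC; apply: closed_bigcup; first exact: finite_finset.
  by move=> i _; exact: K_closed.
exists c', (crng c `&` [set w | V (cinv c w)]); split => //.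
- exact: preim_open.
- split => //; split => //= -[i _ [w hw e]]; apply: hn; exists i; rewrite -e.
  by apply: cinv_cdom; exact: K_crng.
- by move=> w [cw [rw _]]; rewrite c1.
- move=> w [cw [rw nK]]; apply: glued_out => //; first by rewrite c1.
  move=> i hi; rewrite leNgt; apply/negP => h; apply: nK; exists i => //.
  exists (cfun (B i) (cinv c w)); last by rewrite cfunK.
  by rewrite /= -transE ltW.
Qed.

Let cusp_imm c i : atlas Sc c -> forall z, overlap c (B i) z -> cd (trans c (B i)) (tc z) != 0.
Proof. by move=> ac z; exact: trans_cd_neq0. Qed.
Let cusp_hol c i : atlas Sc c -> forall z, overlap c (B i) z -> cdiff (trans c (B i)) (tc z).
Proof. by move=> ac z; exact: trans_cdiff. Qed.

Lemma glued_gt0 c z : atlas Sc c -> crng c z -> 0 < glued_dens c z.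
Proof.
move=> ac cz; have [[i Nz]|[c' [N [[ac' _ _ _ _] _ Nz Nc gE]]]] := glued_local ac cz.
  rewrite (glued_in Nz.2).
  exact: (pulled_density_gt0 _ (cusp_imm ac) Nz).
by rewrite gE//; apply: dens_gt0 => //; exact: Nc.
Qed.

Lemma glued_smooth c : atlas Sc c -> smooth_on (crng c) (glued_dens c : _ -> R^o).
Proof.
move=> ac; apply: smooth_on_local => z cz.
have [[i Nz]|[c' [N [[ac' _ _ _ _] oN Nz Nc gE]]]] := glued_local ac cz.
  exists (overlap c (B i)), (cusp_dens c i); split => //.
  - exact: overlap_open.
  - by move=> w [_ /glued_in].
  - exact: (pulled_density_smooth (overlap_open (d := B i)) (cusp_hol ac) (cusp_imm ac)
      (W_smooth (i := i)) (sqnorm_in (c := c) (i := i))).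
exists N, (g c'); split => // vs w /Nc; exact: dens_smooth.
Qed.

Lemma glued_curvature c z : hyperbolic g -> atlas Sc c -> crng c z ->
  gauss_curvature (glued_dens c) z < 0.
Proof.
move=> gh ac cz.
have [[i Nz]|[c' [N [[ac' _ _ _ _] oN Nz Nc gE]]]] := glued_local ac cz.
  rewrite (gauss_curvature_near (overlap_open (d := B i)) Nz (h := cusp_dens c i)).
    exact: (pulled_density_curvature (overlap_open (d := B i)) (cusp_hol ac) (cusp_imm ac)
      (W_smooth (i := i)) (W_der (i := i)) (W_pos (i := i)) (sqnorm_in (c := c) (i := i))).
  by move=> w [_ /glued_in].
rewrite (gauss_curvature_near oN Nz gE) gh// ?ltrN10//; exact: Nc.
Qed.

Lemma glued_transition c d z : atlas Sc c -> atlas Sc d -> crng c z -> cdom d (cinv c z) ->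
  isometric_at (glued_dens c) (glued_dens d) (cfun d \o cinv c) z.
Proof.
move=> ac ad cz dz; have Nz : overlap c d z by [].
apply/(isometric_cder _ _ (cdP (trans_cdiff ac ad Nz))) => /=.
have dw : crng d (cfun d (cinv c z)) by exact: cfun_crng.
have e : cinv d (cfun d (cinv c z)) = cinv c z by exact: cfunK.
have [[i Bz]|[c' [N [cc' _ Nz' Nc gE]]]] := glued_local ac cz.
  have hi := Bz.2; rewrite (glued_in hi) (@glued_in d _ i) ?e//.
  rewrite /cusp_dens /pulled_density !transE e.
  by rewrite (trans_comp ac ad (B_atlas i) Nz hi) ncM mulrA.
have [[i Bw]|[d' [M [dd' _ Mz Md hE]]]] := glued_local ad dw; last first.
  by rewrite gE// hE// (pull_trans ac ad cc' dd')//; exact: Nc.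
have hi := Bw.2; rewrite /= e in hi.
rewrite (glued_in hi) (@glued_in d _ i) ?e//.
rewrite /cusp_dens /pulled_density !transE e.
by rewrite (trans_comp ac ad (B_atlas i) Nz hi) ncM mulrA.
Qed.

Definition glued_metric : conformalMetric Sc :=
  ConformalMetric glued_gt0 glued_smooth glued_transition.

(** Off all the cusp charts the condition of [glued_out] on the cores is vacuous, and the
    compatibility of [g] between [c] and a pullback of [d] gives the claim. *)
Lemma glued_coincide x : (forall i, ~ cdom (A i) x) -> coincide_at iota g glued_metric x.
Proof.
move=> nx c d ac ad cx dx.
have [d' dd'] := pull_chart iota_hol iota_inj iota_open x ad.
have [ad' d1 d2 d3 d4] := dd'.
have dx' : cdom d' x by rewrite d2.
have Nx : overlap c d' (cfun c x) by split; [exact: cfun_crng|rewrite /= cfunK].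
have [h1 h2] := Nx.
apply: isometric_near (trans_cdiff ac ad' Nx) _ _ (dens_transition g ac ad' h1 h2).
  apply: (near_open (@overlap_open _ _ c d') Nx) => w [_ /=].
  by rewrite d2 => /d3.
rewrite /= cfunK// d3//; apply/esym; apply: (glued_out ad dd').
  by rewrite -d3//; exact: cfun_crng.
rewrite cfunK// => i hi; case: (nx i).
by have [_ _ -> _ _] := B_pull i.
Qed.
End GluedMetric.

Lemma cusp_pullback (R : realType) (S Sc : riemannSurface R) (iota : S -> Sc) p r
    (A : chart R S) (B : chart R Sc) : 0 < r -> injective iota -> ~ range iota p ->
  atlas S A -> crng A = punctured_disk r -> crng B = disk r ->
  cdom B = iota @` cdom A `|` [set p] -> cinv B (0, 0) = p ->
  (forall w, punctured_disk r w -> cinv B w = iota (cinv A w)) ->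
  is_pullback iota B A.
Proof.
move=> r0 inj np aA A1 B1 B2 B3 BA; split => //.
- rewrite A1 B1; apply/seteqP; split => w.
    move=> Dw; split; first by case/andP: Dw.
    by rewrite /= BA//; exists (cinv A w).
  by move=> [wr rw]; apply: disk_punctured => // w0; apply: np; rewrite -B3 -w0.
- rewrite B2; apply/seteqP; split => x /=; first by left; exists x.
  by move=> [[y Ay /inj <-]|e] //; case: np; exists x.
- move=> x; rewrite B2 => -[[y Ay /inj <-]|e]; last by case: np; exists x.
  have Dy : punctured_disk r (cfun A y) by rewrite -A1; exact: cfun_crng.
  have := BA _ Dy; rewrite cfunK// => <-; rewrite cinvK// B1.
  by case/andP: Dy.
- by move=> w; rewrite A1 => /BA.
Qed.

Theorem theorem2p3p1 (R : realType) (S : riemannSurface R)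
    (g : conformalMetric S)
    (g_hyperbolic : hyperbolic g)
    (g_complete : complete_metric g)
    (g_finite_area : (area g [set: S] < +oo)%E)
    (Sc : riemannSurface R) (iota : S -> Sc) (l : nat) (cusp : 'I_l -> Sc)
    (Sc_compactification : conformal_compactification iota cusp)
    (S_cusps : cusps_bigger iota g cusp (2 * pi)) :
  exists h : conformalMetric Sc, negatively_curved h /\
    exists U : 'I_l -> set S,
      horocyclic_nbhs_bigger iota g cusp (2 * pi) U /\
      forall x, (forall i, ~ U i x) -> coincide_at iota g h x.
Proof.
have [_ [hol inj] [cinj crange] _] := Sc_compactification.
have [U HU] := S_cusps; have [Utriv Uhoro Uarea] := HU.
have iota_open : open (range iota).
  (* The complement of the image is the finite set of cusps, closed in a Hausdorff space. *)
  rewrite -[range iota]setCK -crange; apply: closed_openC.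
  have acc := hausdorff_accessible (@rs_hausdorff _ Sc).
  apply: (iffLR accessible_finite_set_closed acc).
  exact/finite_image/finite_finset.
have ncusp i : ~ range iota (cusp i).
  by have : range cusp (cusp i); [exists i|rewrite crange].
have /choice[r /choice[A /choice[B /choice[rho /choice[W /choice[W1 /choice[W2 H]]]]]]] :
    forall i, exists r A B rho W W1 W2, [/\ 0 < r < 1,
      [/\ crng A = punctured_disk r, cdom A = U i &
        forall w, punctured_disk r w -> g A w = punctured_disk_density w],
      [/\ atlas Sc B, crng B = disk r, cdom B = iota @` U i `|` [set cusp i] &
        is_pullback iota B A], 0 < rho < r ^+ 2 &
      [/\ smooth1 [set x | -1 < x < r ^+ 2] W,
        forall x, -1 < x < r ^+ 2 -> is_derive x 1 W (W1 x) /\ is_derive x 1 W1 (W2 x),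
        forall x, -1 < x < r ^+ 2 -> 0 <= x -> 0 < x * W2 x + W1 x &
        forall x, -1 < x < r ^+ 2 -> rho <= x -> W x = W0 x]].
  move=> i.
  have [r [A [B [r01 [aA A1 A2 gA] [aB B1 B2 B3 BA]]]]] :=
    horocyclic_model hol inj (@ncusp i) (Uhoro i).
  (* The area bound turns into the lower bound on the radius that [radial_profile] demands. *)
  have r_gt : expR (-1) < r by apply: (radius_gt r01 aA A1 gA); rewrite A2.
  have r1 : expR (-1) < r < 1 by rewrite r_gt; case/andP: r01.
  have [rho [W [W1 [W2 [hrho Ws Wd Wp Wo]]]]] := radial_profile r1.
  exists r, A, B, rho, W, W1, W2; split => //; split => //.
  apply: (cusp_pullback _ inj (@ncusp i) aA A1 B1 _ B3 BA); first by case/andP: r01.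
  by rewrite A2.
have [r01 /all_and3[A_crng A_dom A_lam] /all_and4[B_atlas B_crng B_dom B_pull] rho_r
  /all_and4[W_smooth W_der W_pos W_out]] := all_and5 H.
have A_dens i w : crng (A i) w -> g (A i) w = punctured_disk_density w.
  by rewrite A_crng; exact: A_lam.
have A_punctured i w : crng (A i) w -> 0 < modulus w < 1.
  rewrite A_crng => /andP[-> h]; apply: lt_trans h _; by case/andP: (r01 i).
have B_disj i j x : cdom (B i) x -> cdom (B j) x -> i = j.
  rewrite !B_dom => -[[y Uy <-]|->] [[y' Uy']|].
  - by move=> /inj e; apply: Utriv => //; exists y; split => //; rewrite -e.
  - by move=> /= e; case: (@ncusp j); exists y.
  - by move=> e; case: (@ncusp i); exists y'.
  - exact: cinj.
have B_cover x : range iota x \/ exists i, cdom (B i) x.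
  case: (pselect (range iota x)) => [|n]; first by left.
  right; have : range cusp x by rewrite crange.
  by move=> [i _ <-]; exists i; rewrite B_dom; right.
exists (glued_metric hol inj iota_open r01 rho_r B_atlas B_crng B_pull A_dens A_punctured
  B_disj B_cover W_smooth W_out); split.
  move=> c z ac cz.
  exact: (glued_curvature hol inj iota_open r01 rho_r B_atlas B_crng B_pull A_dens
    A_punctured B_disj B_cover W_smooth W_der W_pos W_out g_hyperbolic).
exists U; split => // x nx; apply: glued_coincide => // i; rewrite A_dom; exact: nx.
Qed.
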